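(* Let $A$ be a C*-algebra. For $F\subseteq A^1_+$, the following are equivalent. (1) $F$ is a $\mathbf{d}$-filter. (2) $F$ is a $\mathbf{d}$-initial $\mathbf{h}$-filter. (3) $F$ is the norm closure of a $\mathbf{d}$-initial $\leq$-filter. (4) $F$ is norm closed, $\leq$-closed and $\odot$-closed. (5) $F$ is norm closed, $\leq$-closed, $^2$-closed and convex. (6) $F$ is a norm closed $\mathbf{d}$-cofinal face of $A^1_+$. (7) $F$ is a norm filter. If $A$ is separable or commutative, they are also equivalent to the following. (8) $F$ is the norm closure of a $\ll$-filter.
   Context: $A_+$ is the set of positive elements of the C*-algebra $A$, and $A^1_+=\{a\in A_+:\|a\|\le 1\}$. $\widetilde A=A$ if $A$ is unital and $\widetilde A$ is the unitization of $A$ otherwise; for $b\in A$ put $b^\perp=1-b\in\widetilde A$. For $a,b\in A^1_+$ let $$\mathbf{d}(a,b)=\|a-ab\|,\qquad \mathbf{h}(a,b)=\|(a-b)_+\|,\qquad a\odot b=\sqrt a\,b\sqrt a,$$ where $x_+$ is the positive part of a self-adjoint $x$. Write $a\ll b$ if $a=ab$, and $a\le b$ if $b-a\in A_+$. For a function $\mathbf{D}:A^1_+\times A^1_+\to[0,\infty]$ and $Y\subseteq A^1_+$ (infima being taken in $[0,\infty]$): - $Y$ is a $\mathbf{D}$-filter if for all $a,b\in A^1_+$: ($a\in Y$ and $b\in Y$) $\Leftrightarrow$ $\inf_{c\in Y}(\mathbf{D}(c,b)+\mathbf{D}(c,a))=0$. - $Y$ is $\mathbf{D}$-closed if for all $b\in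 A^1_+$: $\inf_{c\in Y}\mathbf{D}(c,b)=0\Rightarrow b\in Y$. - $Y$ is $\mathbf{D}$-initial if for all $b\in Y$: $\inf_{c\in Y}\mathbf{D}(c,b)=0$. - $Y$ is $\mathbf{D}$-cofinal if for all $c\in A^1_+$: $\inf_{b\in Y}\mathbf{D}(c,b)=0$. A relation $R$ on $A^1_+$ is identified with the function that is $0$ at $(x,y)$ when $xRy$ and $\infty$ otherwise. So a $\leq$-filter (resp. $\ll$-filter) is a set $Y\subseteq A^1_+$ such that for all $a,b\in A^1_+$: $a,b\in Y$ iff there is $c\in Y$ with $c\le a$ and $c\le b$ (resp. $c\ll a$ and $c\ll b$); $\leq$-closed means upwards closed in $A^1_+$. $F$ is $\odot$-closed if $a\odot b\in F$ for all $a,b\in F$, and $^2$-closed if $a^2\in F$ for all $a\in F$. $F$ is convex if $\epsilon a+(1-\epsilon)b\in F$ whenever $a,b\in F$ and $\epsilon\in(0,1)$. $F\subseteq A^1_+$ is a face of $A^1_+$ if for all $a,b\in A^1_+$ and $\epsilon\in(0,1)$: $a,b\in F\Leftrightarrow \epsilon a+(1-\epsilon)b\in F$. $F\subseteq A^1_+$ is a norm filter if for every $b\in A^1_+$: $\inf\{\|a_1a_2\cdots a_kb^\perp\|:k\in\mathbb{N},\ a_1,\dots,a_k\in F\}=0$ implies $b\in F$ (here $\mathbb{N}=\{1,2,\dots\}$).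
   Formalization: The equivalence with (6) is stated only for nonempty F: the empty set satisfies (1)–(5), (7), (8) but is not d-cofinal, as the infimum over the empty set is ∞ and 0 lies in A^1_+; all other equivalences are for every F. *)

(* Defs.v *)
From HB Require Import structures.
From mathcomp Require Import all_boot all_order all_algebra.
From mathcomp Require Import all_classical all_reals.
From mathcomp Require Import ereal topology normedtype.
From mathcomp Require Import complex.

Set Implicit Arguments.
Unset Strict Implicit.
Unset Printing Implicit Defensive.

Import Order.TTheory GRing.Theory Num.Theory.
Import numFieldNormedType.Exports.

Local Open Scope classical_set_scope.
Local Open Scope ring_scope.
Local Open Scope complex_scope.

(* The ring structures of MathComp all have a unit; C*-algebras need not, so
   the product is introduced here. *)
HB.mixin Record CompleteNormedModule_isCStarAlgebra (R : realType) A
    of CompleteNormedModule R[i] A := {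
  cmul : A -> A -> A;
  star : A -> A;
  cmulA : associative cmul;
  cmulDl : left_distributive cmul +%R;
  cmulDr : right_distributive cmul +%R;
  cscaleAl : forall (k : R[i]) (x y : A), k *: cmul x y = cmul (k *: x) y;
  cscaleAr : forall (k : R[i]) (x y : A), k *: cmul x y = cmul x (k *: y);
  starK : involutive star;
  starD : {morph star : x y / x + y};
  starZ : forall (k : R[i]) (x : A), star (k *: x) = Num.conj k *: star x;
  starM : forall x y : A, star (cmul x y) = cmul (star y) (star x);
  normcM : forall x y : A, `|cmul x y| <= `|x| * `|y|;
  normc_star : forall x : A, `|cmul (star x) x| = `|x| ^+ 2
}.

#[short(type="cstarAlgType")]
HB.structure Definition CStarAlgebra (R : realType) :=
  {A of CompleteNormedModule_isCStarAlgebra R A & CompleteNormedModule R[i] A}.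

Declare Scope cstar_scope.
Delimit Scope cstar_scope with CS.
Local Open Scope cstar_scope.
Notation "x ** y" := (cmul x y)
  (at level 40, left associativity) : cstar_scope.
Notation "x ^star" := (star x) (at level 2, format "x ^star") : cstar_scope.

Section CStarNotions.
Context {R : realType} {A : cstarAlgType R}.
Implicit Types (a b c x y : A) (k l : R[i]) (F Y : set A).

(* MathComp's norm on a module over R[i] takes (nonnegative real) values in
   R[i]. *)
Definition cnorm x : R := complex.Re `|x|.

Definition is_identity e := forall x, e ** x = x /\ x ** e = x.

Definition unital := exists e, is_identity e.

Definition invertible_wrt e x := exists y, x ** y = e /\ y ** x = e.

(* (x, k) stands for x + k 1. *)
Definition unitization_mul (u v : A * R[i]) : A * R[i] :=
  (u.1 ** v.1 + v.2 *: u.1 + u.2 *: v.1, u.2 * v.2).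

Definition unitization_invertible (u : A * R[i]) :=
  exists v, unitization_mul u v = (0, 1) /\ unitization_mul v u = (0, 1).

(* The spectrum is computed in A when A is unital, and in the unitization
   otherwise. *)
Definition spectrum x : set R[i] := [set l |
  (exists2 e, is_identity e & ~ invertible_wrt e (l *: e - x)) \/
  (~ unital /\ ~ unitization_invertible (- x, l))].

(* For l : R[i], 0 <= l says that l is real and nonnegative. *)
Definition positive x := x^star = x /\ spectrum x `<=` [set l | 0 <= l].

Definition posball : set A := [set a | positive a /\ cnorm a <= 1].

(* The unique positive square root of a positive element. *)
Definition csqrt x : A := xget 0 [set y | positive y /\ y ** y = x].

(* x_+ = (|x| + x) / 2 with |x| = sqrt (x^2), for self-adjoint x. *)
Definition pospart x : A := (2%:R^-1 : R[i]) *: (csqrt (x ** x) + x).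

Definition dfun a b : \bar R := (cnorm (a - a ** b))%:E.

Definition hfun a b : \bar R := (cnorm (pospart (a - b)))%:E.

Definition odot a b := csqrt a ** b ** csqrt a.

Definition ll a b : Prop := a = a ** b.

Definition cle a b : Prop := positive (b - a).

Definition rel_fun (r : A -> A -> Prop) a b : \bar R :=
  if `[< r a b >] then 0%E else +oo%E.

Section DFilters.
Variable D : A -> A -> \bar R.

Definition is_filter Y := Y `<=` posball /\
  forall a b, posball a -> posball b ->
    (Y a /\ Y b) <-> ereal_inf [set (D c b + D c a)%E | c in Y] = 0%E.

Definition is_Dclosed Y :=
  forall b, posball b -> ereal_inf [set D c b | c in Y] = 0%E -> Y b.

Definition is_initial Y :=
  forall b, Y b -> ereal_inf [set D c b | c in Y] = 0%E.

Definition is_cofinal Y :=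
  forall c, posball c -> ereal_inf [set D c b | b in Y] = 0%E.

End DFilters.

(* The infimum is taken in [0, +oo], so that it is +oo over the empty set. *)
Lemma rel_filterP (r : A -> A -> Prop) Y : Y `<=` posball ->
  is_filter (rel_fun r) Y <->
  (forall a b, posball a -> posball b ->
    (Y a /\ Y b) <-> exists2 c, Y c & r c a /\ r c b).
Proof.
move=> YP.
have infP a b : ereal_inf [set (rel_fun r c b + rel_fun r c a)%E | c in Y] = 0%E
    <-> exists2 c, Y c & r c a /\ r c b.
  have ge0 : (0 <= ereal_inf
      [set (rel_fun r c b + rel_fun r c a)%E | c in Y])%E.
    apply: le_ereal_inf_tmp => _ [c Yc <-]; rewrite /rel_fun.
    by case: asboolP => _; case: asboolP => _; rewrite ?adde0 ?leey.
  split=> [inf0|[c Yc [rca rcb]]].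
    have /ereal_inf_lt : (ereal_inf
        [set (rel_fun r c b + rel_fun r c a)%E | c in Y] < 1)%E.
      by rewrite inf0.
    case=> _ [c Yc <-]; rewrite /rel_fun.
    by case: asboolP => // rcb; case: asboolP => // rca _; exists c.
  apply/eqP; rewrite eq_le ge0 andbT; apply: ereal_inf_lbound.
  by exists c => //; rewrite /rel_fun !asboolT// adde0.
by split=> [[_ H]|H]; [move=> a b Pa Pb|split=> // a b Pa Pb];
  rewrite H// infP.
Qed.

Definition odot_closed F := forall a b, F a -> F b -> F (odot a b).

Definition sq_closed F := forall a, F a -> F (a ** a).

Definition segment_pt (t : R) a b : A := t%:C *: a + (1 - t)%:C *: b.

Definition is_convex F := forall a b (t : R),
  F a -> F b -> 0 < t < 1 -> F (segment_pt t a b).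

Definition is_face F := forall a b (t : R),
  posball a -> posball b -> 0 < t < 1 ->
  (F a /\ F b) <-> F (segment_pt t a b).

Lemma unitization_mul_perp p b :
  unitization_mul (p, 0) (- b, 1) = (p - p ** b, 0).
Proof.
have cmulN : p ** (- b) = - (p ** b).
  apply: (addrI (p ** b)); rewrite -cmulDr !subrr.
  by apply: (addrI (p ** 0)); rewrite -cmulDr !addr0.
by rewrite /unitization_mul /= mul0r scale1r scale0r addr0 cmulN addrC.
Qed.

(* [foldl cmul a s] is a product of k = (size s).+1 elements; by
   unitization_mul_perp, p (1 - b) is the element p - p b of A. *)
Definition is_norm_filter F := forall b, posball b ->
  ereal_inf [set r | exists a s, [/\ F a, forall x, x \in s -> F x &
    r = (cnorm (foldl cmul a s - foldl cmul a s ** b))%:E]] = 0%E ->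
  F b.

End CStarNotions.

Definition separable_space (T : topologicalType) :=
  exists2 S : set T, countable S & dense S.

Definition commutative_calg {R : realType} (A : cstarAlgType R) :=
  commutative (@cmul R A).

(* Main.v *)
Require Import Defs.
From HB Require Import structures.
From mathcomp Require Import all_boot all_order all_algebra.
From mathcomp Require Import all_classical all_reals.
From mathcomp Require Import ereal topology normedtype complex.
From mathcomp Require Import ssrAC ring lra.

(* Everything takes place in the algebra obtained from A by adjoining a new
   unit (whether or not A has one), where positivity of a self-adjoint h means
   |t - h| <= t for some real t; square roots come from an explicit iteration,
   and the link with spectra from Neumann series.  Each condition on F is
   compared with the following form of (1): F contains b as soon as c (1 - b)
   is arbitrarily small for c in F, and for a, b in F both c (1 - a) and
   c (1 - b) can be made small with c in F.  Two devices do most of the work.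
   If c (1 - b) is small, then b is close to 1 - (1 - c) (1 - b) (1 - c), which
   lies in the unit interval above c.  If x = a b a, or x is a convex
   combination of a and b, then x^n (1 - a) and x^n (1 - b) tend to 0.
   For (3), elements of the filter that are bounded below admit the common
   lower bound (z1^-1 + z2^-1 - 1)^-1; for (8), cutting the spectrum near 1
   produces exact relations k = k c with k in F. *)

Set Implicit Arguments.
Unset Strict Implicit.
Unset Printing Implicit Defensive.

Import Order.TTheory GRing.Theory Num.Theory.
Import numFieldNormedType.Exports.
Local Open Scope classical_set_scope.
Local Open Scope ring_scope.

(** * Deciding identities in noncommutative algebras *)

(** A unit is adjoined even to a unital algebra so that one construction serves both cases; an
    element of the unitization lies in A exactly when its scalar part is 0, and witnesses built
    there are brought back to A by computing that part. Powers, square roots, positive parts and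
    inverses do the work of continuous functional calculus. The recurrent loss is a square: the
    order controls c (1 - b) c, and |c (1 - b)|^2 <= |c (1 - b) c|; this is harmless because only
    arbitrary smallness matters. The obstacle for the order and for [<<] is that F is directed only
    approximately, so exact lower bounds have to be manufactured. For [<=] this is done by inversion
    in the unitization. For [<<], relations a1 << b1 and a2 << b2 combine at once only if elements
    commute: a1 a2 a1 kills 1 - b1 but in general not 1 - b2. In the separable case a decreasing
    chain is therefore built along a dense sequence, and the filter is read off from the chain. *)

Section AlgebraExpressions.
Context {R : comNzRingType} {U : algType R}.

Inductive aexp :=
  | AVar of nat
  | AOne
  | AZero
  | AAdd of aexp & aexp
  | AOpp of aexp
  | AMul of aexp & aexp
  | AScale of R & aexp
  | AExp of aexp & nat.

Fixpoint aeval (env : seq U) (e : aexp) : U :=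
  match e with
  | AVar i => nth 0 env i
  | AOne => 1
  | AZero => 0
  | AAdd e1 e2 => aeval env e1 + aeval env e2
  | AOpp e1 => - aeval env e1
  | AMul e1 e2 => aeval env e1 * aeval env e2
  | AScale c e1 => c *: aeval env e1
  | AExp e1 n => aeval env e1 ^+ n
  end.

(* A list of coefficients and words stands for a linear combination of
   products of atoms. *)
Definition anf := seq (seq nat * R).

(** Plain fixpoints and [if] keep the computation on words within the constants that [alg_compute]
    unfolds, so that coefficients in [R] are never reduced. *)
Fixpoint weq (v w : seq nat) : bool :=
  match v, w with
  | [::], [::] => true
  | i :: v', j :: w' => if Nat.eqb i j then weq v' w' else false
  | _, _ => false
  end.

Fixpoint winsert (i : nat) (w : seq nat) : seq nat :=
  match w with
  | [::] => [:: i]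
  | j :: w' => if Nat.leb i j then i :: w else j :: winsert i w'
  end.

Fixpoint wcat (v w : seq nat) : seq nat :=
  match v with [::] => w | i :: v' => i :: wcat v' w end.

Fixpoint wsort (v : seq nat) : seq nat :=
  match v with [::] => [::] | i :: v' => winsert i (wsort v') end.

Section Normalisation.
Context (comm : bool).

Definition wnorm (v : seq nat) := if comm then wsort v else v.

Fixpoint ains (w : seq nat) (c : R) (l : anf) : anf :=
  match l with
  | [::] => [:: (w, c)]
  | (v, d) :: l' => if weq w v then (v, d + c) :: l' else (v, d) :: ains w c l'
  end.

Fixpoint aadd (l1 l2 : anf) : anf :=
  match l1 with [::] => l2 | (w, c) :: l' => ains w c (aadd l' l2) end.

Fixpoint ascale (c : R) (l : anf) : anf :=
  match l with [::] => [::] | (w, d) :: l' => (w, c * d) :: ascale c l' end.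

Fixpoint amulw (v : seq nat) (c : R) (l : anf) : anf :=
  match l with
  | [::] => [::]
  | (w, d) :: l' => ains (wnorm (wcat v w)) (c * d) (amulw v c l')
  end.

Fixpoint amul (l1 l2 : anf) : anf :=
  match l1 with [::] => [::] | (w, c) :: l' => aadd (amulw w c l2) (amul l' l2) end.

Fixpoint apow (l : anf) (n : nat) : anf :=
  match n with O => [:: ([::], 1)] | S m => amul l (apow l m) end.

Fixpoint anorm (e : aexp) : anf :=
  match e with
  | AVar i => [:: ([:: i], 1)]
  | AOne => [:: ([::], 1)]
  | AZero => [::]
  | AAdd e1 e2 => aadd (anorm e1) (anorm e2)
  | AOpp e1 => ascale (-1) (anorm e1)
  | AMul e1 e2 => amul (anorm e1) (anorm e2)
  | AScale c e1 => ascale c (anorm e1)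
  | AExp e1 n => apow (anorm e1) n
  end.

(** Normalisation collects like words but tests no coefficient; an identity becomes a conjunction of
    scalar equations, left to [ring], [field] or [lra]. *)
Definition acoefs0 (l : anf) : Prop :=
  (fix F (l : anf) : Prop := match l with
   | [::] => True | (w, c) :: l' => c = 0 /\ F l' end) l.

Context (env : seq U).

Fixpoint allcomm (x : U) (s : seq U) : Prop :=
  match s with [::] => True | y :: s' => x * y = y * x /\ allcomm x s' end.

Fixpoint paircomm (s : seq U) : Prop :=
  match s with [::] => True | y :: s' => allcomm y s' /\ paircomm s' end.

Context (env_comm : if comm then paircomm env else True).

Definition weval (w : seq nat) : U := \prod_(i <- w) nth 0 env i.

Definition leval (l : anf) : U := \sum_(t <- l) t.2 *: weval t.1.

Lemma allcomm_nth x s i : allcomm x s -> x * nth 0 s i = nth 0 s i * x.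
Proof.
by elim: s i => [|y s IH] [|i] /=; rewrite ?mulr0 ?mul0r //; case => // _ /IH.
Qed.

Lemma paircomm_nth s i j : paircomm s ->
  nth 0 s i * nth 0 s j = nth 0 s j * nth 0 s i.
Proof.
elim: s i j => [|y s IH] [|i] [|j] /=; rewrite ?mulr0 ?mul0r //.
- by case=> /allcomm_nth ->.
- by case=> /allcomm_nth ->.
- by case=> _ /IH.
Qed.

Lemma weval_cat v w : weval (wcat v w) = weval v * weval w.
Proof.
elim: v => [|i v IH] /=; first by rewrite /weval big_nil mul1r.
by rewrite /weval !big_cons -/(weval _) IH mulrA.
Qed.

Lemma weqP v w : weq v w -> v = w.
Proof.
elim: v w => [|i v IH] [|j w] //=.
by case: (PeanoNat.Nat.eqb_spec i j) => // -> /IH ->.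
Qed.

Lemma weval_norm w : weval (wnorm w) = weval w.
Proof.
rewrite /wnorm; move: env_comm; case: comm => // Hc.
elim: w => [|i v IH] //=.
rewrite [RHS]/weval big_cons -/(weval v) -{}IH.
elim: (wsort v) => [|j w IH] /=; first by rewrite /weval big_cons.
case: Nat.leb; first by rewrite /weval !big_cons.
by rewrite [LHS]/weval [in RHS]/weval !big_cons -!/(weval _) IH !mulrA
  (paircomm_nth _ _ Hc).
Qed.

Lemma leval_ins w c l : leval (ains w c l) = c *: weval w + leval l.
Proof.
elim: l => [|[v d] l IH] /=; first by rewrite /leval big_cons.
case: ifP => [/weqP ->|_]; rewrite /leval !big_cons -!/(leval _) /=.
  by rewrite scalerDl addrA [c *: _ + _]addrC.
by rewrite IH addrCA.
Qed.

Lemma leval_add l1 l2 : leval (aadd l1 l2) = leval l1 + leval l2.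
Proof.
elim: l1 => [|[w c] l IH] /=; first by rewrite /leval big_nil add0r.
by rewrite leval_ins IH /leval big_cons addrA.
Qed.

Lemma leval_scale c l : leval (ascale c l) = c *: leval l.
Proof.
elim: l => [|[w d] l IH] /=; first by rewrite /leval big_nil scaler0.
by rewrite /leval !big_cons -!/(leval _) IH scalerDr scalerA.
Qed.

Lemma leval_mulw v c l : leval (amulw v c l) = c *: weval v * leval l.
Proof.
elim: l => [|[w d] l IH] /=; first by rewrite /leval big_nil mulr0.
rewrite leval_ins IH weval_norm weval_cat /leval big_cons mulrDr /=.
by congr (_ + _); rewrite -scalerAr -scalerAl scalerA mulrC.
Qed.

Lemma leval_mul l1 l2 : leval (amul l1 l2) = leval l1 * leval l2.
Proof.
elim: l1 => [|[w c] l IH] /=; first by rewrite /leval big_nil mul0r.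
by rewrite leval_add leval_mulw IH /leval big_cons mulrDl.
Qed.

Lemma leval1 : leval [:: ([::], 1)] = 1.
Proof. by rewrite /leval big_seq1 scale1r /weval big_nil. Qed.

Lemma leval_norm e : leval (anorm e) = aeval env e.
Proof.
elim: e => /=.
- by move=> i; rewrite /leval big_seq1 scale1r /weval big_seq1.
- exact: leval1.
- by rewrite /leval big_nil.
- by move=> e1 <- e2 <-; rewrite leval_add.
- by move=> e1 <-; rewrite leval_scale scaleN1r.
- by move=> e1 <- e2 <-; rewrite leval_mul.
- by move=> c e1 <-; rewrite leval_scale.
- move=> e1 IH n; rewrite -IH; elim: n => [|n IHn] /=; first exact: leval1.
  by rewrite leval_mul IHn exprS.
Qed.

Lemma aeval_eq e1 e2 :
  acoefs0 (anorm (AAdd e1 (AOpp e2))) -> aeval env e1 = aeval env e2.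
Proof.
move=> H; apply/eqP; rewrite -subr_eq0; apply/eqP.
rewrite -[RHS]/(0) -[LHS]/(aeval env (AAdd e1 (AOpp e2))) -leval_norm.
elim: (anorm _) H => [|[w c] l IH] /=; first by rewrite /leval big_nil.
by case=> -> /IH H; rewrite /leval big_cons scale0r add0r.
Qed.

End Normalisation.
End AlgebraExpressions.

Ltac in_seq x s :=
  lazymatch s with
  | x :: _ => constr:(true)
  | _ :: ?s' => in_seq x s'
  | _ => constr:(false)
  end.

Ltac index_seq x s :=
  lazymatch s with
  | x :: _ => constr:(O)
  | _ :: ?s' => let n := index_seq x s' in constr:(S n)
  end.

(** Powers with a numeral exponent are expanded; any other power is an atom, so [x ^+ n] with [n] a
    variable enters the commutation side goals on its own. *)
Ltac alg_atoms e s :=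
  lazymatch e with
  | @GRing.add _ ?a ?b => let s' := alg_atoms a s in alg_atoms b s'
  | @GRing.mul _ ?a ?b => let s' := alg_atoms a s in alg_atoms b s'
  | @GRing.opp _ ?a => alg_atoms a s
  | @GRing.scale _ _ _ ?a => alg_atoms a s
  | @GRing.one _ => s
  | @GRing.zero _ => s
  | @GRing.exp _ ?a (S ?n) =>
    lazymatch isnat n with true => alg_atoms a s | _ =>
    lazymatch in_seq e s with true => s | false => constr:(e :: s) end end
  | _ => lazymatch in_seq e s with true => s | false => constr:(e :: s) end
  end
with isnat n :=
  lazymatch n with O => constr:(true) | S ?m => isnat m | _ => constr:(false) end.

Ltac alg_reify R e s :=
  lazymatch e with
  | @GRing.add _ ?a ?b =>
    let a' := alg_reify R a s in let b' := alg_reify R b s in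
    constr:(@AAdd R a' b')
  | @GRing.mul _ ?a ?b =>
    let a' := alg_reify R a s in let b' := alg_reify R b s in
    constr:(@AMul R a' b')
  | @GRing.opp _ ?a => let a' := alg_reify R a s in constr:(@AOpp R a')
  | @GRing.scale _ _ ?c ?a => let a' := alg_reify R a s in constr:(@AScale R c a')
  | @GRing.one _ => constr:(@AOne R)
  | @GRing.zero _ => constr:(@AZero R)
  | @GRing.exp _ ?a (S ?n) =>
    lazymatch isnat n with
    | true => let a' := alg_reify R a s in constr:(@AExp R a' (S n))
    | _ => let i := index_seq e s in constr:(@AVar R i)
    end
  | _ => let i := index_seq e s in constr:(@AVar R i)
  end.

Ltac alg_compute :=
  cbv beta iota zeta delta [anorm aadd ains ascale amul amulw apow wnorm wcat
    wsort winsert weq acoefs0 Nat.eqb Nat.leb paircomm allcomm].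

Ltac alg_ring_with R U comm :=
  lazymatch goal with
  | |- @eq _ ?a ?b =>
    let s := alg_atoms a (@nil U) in
    let s := alg_atoms b s in
    let a' := alg_reify R a s in
    let b' := alg_reify R b s in
    change (aeval s a' = aeval s b');
    apply: (@aeval_eq _ _ comm s _ a' b');
    alg_compute; repeat split;
    first [assumption | symmetry; assumption | ring | field | lra]
  end.

(* A complex unital C*-algebra is presented as a real algebra with a central
   square root of -1, so that all scalars are real; completeness is stated for
   sequences whose increments are dominated by those of a bounded sequence. *)
HB.mixin Record Algebra_isUnitalCStar (R : realType) U of GRing.Algebra R U := {
  adj : U -> U;
  im : U;
  nrm : U -> R;
  adjK : involutive adj;
  adjD : {morph adj : x y / x + y};
  adjZ : forall (t : R) x, adj (t *: x) = t *: adj x;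
  adjM : forall x y, adj (x * y) = adj y * adj x;
  imC : forall x, im * x = x * im;
  im_sqr : im * im = -1;
  adj_im : adj im = - im;
  nrmD : forall x y, nrm (x + y) <= nrm x + nrm y;
  nrmZ : forall (t : R) x, nrm (t *: x) = `|t| * nrm x;
  nrmM : forall x y, nrm (x * y) <= nrm x * nrm y;
  nrm_star : forall x, nrm (adj x * x) = nrm x ^+ 2;
  nrm0_eq0 : forall x, nrm x = 0 -> x = 0;
  nrm_complete : forall (s : nat -> U) (b : nat -> R) B,
    (forall n, nrm (s n.+1 - s n) <= b n.+1 - b n) -> (forall n, b n <= B) ->
    exists l, forall e, 0 < e ->
      exists m, forall n, (m <= n)%N -> nrm (s n - l) <= e
}.

#[short(type="ucstarType")]
HB.structure Definition UnitalCStar (R : realType) :=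
  {U of Algebra_isUnitalCStar R U & GRing.Algebra R U}.

(* Lets the tactic below recover R and U from an element, by unification. *)
Definition ucstar_of (R : realType) (U : ucstarType R) (x : U) := x.

Ltac alg_ring comm :=
  lazymatch goal with
  | |- @eq _ ?a _ =>
    lazymatch constr:(ucstar_of a) with @ucstar_of ?R ?U _ =>
      alg_ring_with R (UnitalCStar.sort U) comm end
  end.

Tactic Notation "ncring" := alg_ring false.
(* All the atoms are assumed to commute pairwise. *)
Tactic Notation "cring" := alg_ring true.

(** * Norm, adjoint and limits *)

Section NormAdjoint.
Context {R : realType} {U : ucstarType R}.
Implicit Types (x y z l : U) (s : nat -> U).

Lemma nrm0 : nrm (0 : U) = 0.
Proof. by rewrite -(scale0r (0 : U)) nrmZ normr0 mul0r. Qed.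

Lemma nrmN x : nrm (- x) = nrm x.
Proof. by rewrite -scaleN1r nrmZ normrN1 mul1r. Qed.

Lemma nrm_ge0 x : 0 <= nrm x.
Proof. by have := nrmD x (- x); rewrite subrr nrm0 nrmN; lra. Qed.

Lemma nrmB x y : nrm (x - y) <= nrm x + nrm y.
Proof. by rewrite (le_trans (nrmD _ _))// nrmN. Qed.

Lemma nrm_distC x y : nrm (x - y) = nrm (y - x).
Proof. by rewrite -nrmN opprB. Qed.

Lemma nrm_tri y x z : nrm (x - z) <= nrm (x - y) + nrm (y - z).
Proof. by rewrite (le_trans _ (nrmD _ _))// [_ + (y - z)]addrA subrK. Qed.

Lemma nrmM_le x y a b : nrm x <= a -> nrm y <= b -> nrm (x * y) <= a * b.
Proof.
by move=> xa yb; rewrite (le_trans (nrmM _ _))// ler_pM// nrm_ge0.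
Qed.

Lemma adj0 : adj (0 : U) = 0.
Proof. by rewrite -(scale0r (0 : U)) adjZ !scale0r. Qed.

Lemma adjN x : adj (- x) = - adj x.
Proof. by rewrite -scaleN1r adjZ scaleN1r. Qed.

Lemma adjB x y : adj (x - y) = adj x - adj y.
Proof. by rewrite adjD adjN. Qed.

Lemma adj1 : adj (1 : U) = 1.
Proof. by rewrite -[LHS]mulr1 -{2}[1 in LHS]adjK -adjM mulr1 adjK. Qed.

Lemma adjX x n : adj (x ^+ n) = adj x ^+ n.
Proof.
by elim: n => [|n IH]; [rewrite !expr0 adj1|rewrite exprSr adjM IH -exprS].
Qed.

Lemma nrm1 : nrm (1 : U) = 1.
Proof.
have := nrm_star (1 : U); rewrite adj1 mul1r => h.
have n0 : nrm (1 : U) != 0.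
  by apply/eqP => /nrm0_eq0 /eqP; rewrite oner_eq0.
by apply: (mulfI n0); rewrite mulr1 -expr2 -h.
Qed.

Lemma nrmA (t : R) : nrm (t%:A : U) = `|t|.
Proof. by rewrite nrmZ nrm1 mulr1. Qed.

Lemma nrm_adj x : nrm (adj x) = nrm x.
Proof.
have H y : nrm y <= nrm (adj y).
  have [->|y0] := eqVneq (nrm y) 0; first exact: nrm_ge0.
  have yp : 0 < nrm y by rewrite lt_def y0 nrm_ge0.
  by rewrite -(ler_pM2r yp) -expr2 -nrm_star nrmM.
by apply/eqP; rewrite eq_le -{2}(adjK x) !H.
Qed.

Lemma nrm_starr x : nrm (x * adj x) = nrm x ^+ 2.
Proof. by rewrite -{1}(adjK x) nrm_star nrm_adj. Qed.

Lemma nrm_sa x : adj x = x -> nrm (x * x) = nrm x ^+ 2.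
Proof. by move=> h; rewrite -{1}h nrm_star. Qed.

Lemma nrm_sa_pow x k : adj x = x -> nrm (x ^+ (2 ^ k)) = nrm x ^+ (2 ^ k).
Proof.
move=> h; elim: k => [|k IH]; first by rewrite expn0 !expr1.
by rewrite expnSr exprM [RHS]exprM -IH expr2 nrm_sa// adjX h.
Qed.

Lemma nrm_eps0 x C : (forall e, 0 < e -> nrm x <= e * C) -> x = 0.
Proof.
move=> H; apply: nrm0_eq0; apply/eqP; rewrite eq_le nrm_ge0 andbT.
rewrite leNgt; apply/negP => xp.
have Cp : 0 < `|C| + 1 by rewrite ltr_wpDl.
have ep : 0 < nrm x / 2 / (`|C| + 1) by rewrite !divr_gt0.
have := H _ ep; apply/negP; rewrite -ltNge.
apply: (@le_lt_trans _ _ (nrm x / 2 / (`|C| + 1) * (`|C| + 1))).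
  by rewrite ler_pM2l// (le_trans (ler_norm C))// lerDl.
by rewrite mulfVK ?gt_eqF//; lra.
Qed.

Definition ulim s l :=
  forall e, 0 < e -> exists m, forall n, (m <= n)%N -> nrm (s n - l) <= e.

(** In this form, [x = 1] yields uniqueness of limits and equal sequences yield commutation with the
    limit. *)
Lemma ulim_intertwine s1 s2 l1 l2 x : ulim s1 l1 -> ulim s2 l2 ->
  (forall n, s1 n * x = x * s2 n) -> l1 * x = x * l2.
Proof.
move=> h1 h2 h; apply/eqP; rewrite -subr_eq0; apply/eqP.
apply: (@nrm_eps0 _ (2 * nrm x)) => e e0.
have [m1 {}h1] := h1 _ e0; have [m2 {}h2] := h2 _ e0.
have {}h1 := h1 _ (leq_maxl m1 m2); have {}h2 := h2 _ (leq_maxr m1 m2).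
move: h1 h2; set n := maxn _ _ => h1 h2.
have -> : l1 * x - x * l2 = x * (s2 n - l2) - (s1 n - l1) * x.
  by rewrite mulrBr mulrBl h; ncring.
apply: (le_trans (nrmB _ _)).
have := nrmM_le (lexx (nrm x)) h2; have := nrmM_le h1 (lexx (nrm x)); lra.
Qed.

Lemma ulim_uniq s l1 l2 : ulim s l1 -> ulim s l2 -> l1 = l2.
Proof.
move=> h1 h2; have := @ulim_intertwine s s l1 l2 1 h1 h2.
by rewrite mulr1 mul1r; apply => n; rewrite mulr1 mul1r.
Qed.

Lemma ulim_sa s l : ulim s l -> (forall n, adj (s n) = s n) -> adj l = l.
Proof.
move=> h sa; apply: (ulim_uniq _ h) => e /h [m {}h]; exists m => n /h.
by rewrite -(nrm_adj (_ - l)) adjB sa.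
Qed.

Lemma ulim_nrm s l C : ulim s l -> (forall n, nrm (s n) <= C) -> nrm l <= C.
Proof.
move=> h b; apply/ler_addgt0Pr => e /h [m {}h].
have := h m (leqnn m); have := b m; have := nrm_tri (s m) l 0.
by rewrite !subr0 nrm_distC; lra.
Qed.

End NormAdjoint.

(** * Square roots by iteration *)

Section SqrtIteration.
Context {R : realType} {U : ucstarType R}.
Implicit Types (x y z l : U).

(* Converges to 1 - sqrt (1 - y) for y of norm at most 1. *)
Fixpoint sqit y (n : nat) : U :=
  if n is n'.+1 then 2^-1 *: (y + sqit y n' * sqit y n') else 0.

(** The scalar iteration for [y = 1], which dominates the norms and the increments of [sqit y]
    whenever [nrm y <= 1]. *)
Fixpoint sqit_bound (n : nat) : R :=
  if n is n'.+1 then 2^-1 * (1 + sqit_bound n' * sqit_bound n') else 0.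

Lemma sqit_bound_itv n : 0 <= sqit_bound n <= 1.
Proof. elim: n => [|n IH] /=; [lra|nra]. Qed.

Lemma sqit_intertwine y1 y2 x n : y1 * x = x * y2 ->
  sqit y1 n * x = x * sqit y2 n.
Proof.
move=> h; elim: n => [|n IH] /=; first by rewrite mul0r mulr0.
by rewrite -scalerAl -scalerAr mulrDl mulrDr h -mulrA IH !mulrA IH.
Qed.

Lemma sqit_sa y n : adj y = y -> adj (sqit y n) = sqit y n.
Proof.
by move=> h; elim: n => [|n IH] /=; rewrite ?adj0// adjZ adjD adjM h IH.
Qed.

Lemma sqit_nrm y n : nrm y <= 1 -> nrm (sqit y n) <= sqit_bound n.
Proof.
move=> h; elim: n => [|n IH] /=; first by rewrite nrm0.
rewrite nrmZ ger0_norm ?invr_ge0// ler_pM2l ?invr_gt0//.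
by rewrite (le_trans (nrmD _ _))// lerD// nrmM_le.
Qed.

Lemma sqit_comm y m n : sqit y m * sqit y n = sqit y n * sqit y m.
Proof. by apply: sqit_intertwine; apply/esym/sqit_intertwine. Qed.

(** The iterates commute, so the difference of their squares factors, exactly as for the scalar
    bounds. *)
Lemma sqit_step y n : nrm y <= 1 ->
  nrm (sqit y n.+1 - sqit y n) <= sqit_bound n.+1 - sqit_bound n.
Proof.
move=> h; elim: n => [|n IH].
  have := sqit_nrm 1 h; rewrite /= ?subr0; apply.
have E m : sqit y m.+1 = 2^-1 *: (y + sqit y m * sqit y m) by [].
have -> : sqit y n.+2 - sqit y n.+1 =
    2^-1 *: ((sqit y n.+1 - sqit y n) * (sqit y n.+1 + sqit y n)).
  rewrite mulrBl !mulrDr (sqit_comm y n n.+1) (E n.+1) [X in _ - X = _](E n).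
  by move: (sqit y n.+1) (sqit y n) => a b; ncring.
have -> : sqit_bound n.+2 - sqit_bound n.+1 = 2^-1 *
  ((sqit_bound n.+1 - sqit_bound n) * (sqit_bound n.+1 + sqit_bound n)).
  by rewrite /=; field.
rewrite nrmZ ger0_norm ?invr_ge0// ler_pM2l ?invr_gt0// nrmM_le//.
by rewrite (le_trans (nrmD _ _))// lerD// sqit_nrm.
Qed.

(** The limit is a fixed point of the recursion, [l + l = y + l * l], which is the square equation
    rearranged. *)
Lemma sqit_lim y : nrm y <= 1 ->
  exists l, [/\ ulim (sqit y) l, nrm l <= 1 & (1 - l) * (1 - l) = 1 - y].
Proof.
move=> h; have [] := @nrm_complete _ _ (sqit y) sqit_bound 1.
- by move=> n; apply: sqit_step.
- by move=> n; case/andP: (sqit_bound_itv n).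
move=> l hl; have lim : ulim (sqit y) l by [].
have l1 : nrm l <= 1.
  apply: (ulim_nrm lim) => n; apply: (le_trans (sqit_nrm _ h)).
  by case/andP: (sqit_bound_itv n).
exists l; split => //.
have lE : l = 2^-1 *: (y + l * l).
  apply/eqP; rewrite -subr_eq0; apply/eqP.
  apply: (@nrm_eps0 _ _ _ 2) => e /hl [m {}hl].
  have := hl m.+1 (leqnSn m); have := hl m (leqnn m).
  rewrite [sqit y m.+1]/=; set s := sqit y m => h1 h2.
  have -> : l - 2^-1 *: (y + l * l) =
    - (2^-1 *: (y + s * s) - l) + 2^-1 *: ((s - l) * s + l * (s - l)).
    by ncring.
  rewrite (le_trans (nrmD _ _))// nrmN nrmZ ger0_norm ?invr_ge0//.
  have s1 : nrm s <= 1.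
    by apply: (le_trans (sqit_nrm _ h)); case/andP: (sqit_bound_itv m).
  have := nrmD ((s - l) * s) (l * (s - l)).
  have := nrmM_le h1 s1; have := nrmM_le l1 h1.
  by lra.
have h2 : l + l = y + l * l by rewrite {1 2}lE; ncring.
by rewrite -[y](addrK (l * l)) -h2; ncring.
Qed.

End SqrtIteration.

(** * Positive elements *)

Section Positivity.
Context {R : realType} {U : ucstarType R}.
Implicit Types (a b h k x y z l : U) (t : R).

(** With this encoding sums of positive elements are positive by the triangle inequality alone,
    before any spectral theory. *)
Definition pos h := adj h = h /\ exists t, nrm (t%:A - h) <= t.

Lemma nrm_rescale c h : 0 < c -> nrm h <= c -> nrm (c^-1 *: h) <= 1.
Proof.
by move=> c0 hc; rewrite nrmZ gtr0_norm ?invr_gt0// mulrC ler_pdivrMr// mul1r.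
Qed.

Lemma adjA t : adj (t%:A : U) = t%:A.
Proof. by rewrite adjZ adj1. Qed.

Lemma pos_sa h : pos h -> adj h = h.
Proof. by case. Qed.

Lemma pos_bound_mono h t t' : t <= t' -> nrm (t%:A - h) <= t ->
  nrm (t'%:A - h) <= t'.
Proof.
move=> tt' H; have -> : t'%:A - h = (t' - t)%:A + (t%:A - h) by ncring.
have := nrmD (t' - t)%:A (t%:A - h); rewrite nrmA ger0_norm ?subr_ge0//.
by lra.
Qed.

Lemma posD a b : pos a -> pos b -> pos (a + b).
Proof.
move=> [a1 [t ta]] [b1 [s sb]]; split; first by rewrite adjD a1 b1.
exists (t + s); have -> : (t + s)%:A - (a + b) = (t%:A - a) + (s%:A - b).
  by ncring.
by rewrite (le_trans (nrmD _ _))// lerD.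
Qed.

Lemma posZ t a : 0 <= t -> pos a -> pos (t *: a).
Proof.
move=> t0 [a1 [s sa]]; split; first by rewrite adjZ a1.
exists (t * s); have -> : (t * s)%:A - t *: a = t *: (s%:A - a) by ncring.
by rewrite nrmZ ger0_norm// ler_wpM2l.
Qed.

Lemma posA t : 0 <= t -> pos t%:A.
Proof.
by move=> t0; split; [rewrite adjA|exists t; rewrite subrr nrm0].
Qed.

Lemma pos0 : pos 0.
Proof. by have := posA (lexx 0); rewrite scale0r. Qed.

Lemma pos1 : pos 1.
Proof. by have := posA ler01; rewrite scale1r. Qed.

Lemma posA_ge0 t : pos t%:A -> 0 <= t.
Proof.
move=> [_ [s]]; rewrite -scalerBl nrmA; have := ler_norm (s - t); lra.
Qed.

Lemma sa_ub h t : adj h = h -> nrm h <= t -> pos (t%:A - h).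
Proof.
move=> h1 ht; split; first by rewrite adjB adjA h1.
by exists t; rewrite opprB addrCA subrr addr0.
Qed.

Lemma pos_ub h : adj h = h -> pos ((nrm h)%:A - h).
Proof. by move=> /sa_ub; apply. Qed.

(** For the normal element u = k + i l, the sum k^2 + l^2 is [adj u * u], the difference k^2 - l^2
    is the real part of u^2, and k is the real part of u; the C*-identity bounds both by |u|^2. *)
Lemma nrm_sq_comm k l : adj k = k -> adj l = l -> k * l = l * k ->
  nrm (k * k - l * l) <= nrm (k * k + l * l) /\
  nrm k ^+ 2 <= nrm (k * k + l * l).
Proof.
move=> k1 l1 kl; pose u := k + im * l.
have ua : adj u = k - im * l by rewrite adjD adjM adj_im k1 l1 mulrN -imC.
have kc : k * im = im * k := esym (imC k).
have lc : l * im = im * l := esym (imC l).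
have uu : adj u * u = k * k + l * l.
  have -> : adj u * u = k * k - (im * im) * (l * l) by rewrite ua /u; cring.
  by rewrite im_sqr mulN1r opprK.
rewrite -uu nrm_star; split.
  have -> : k * k - l * l = 2^-1 *: (u * u + adj u * adj u).
    transitivity (k * k + (im * im) * (l * l)).
      by rewrite im_sqr mulN1r.
    by rewrite ua /u; cring.
  rewrite nrmZ ger0_norm ?invr_ge0//.
  have := nrmD (u * u) (adj u * adj u).
  by have := nrmM u u; have := nrmM (adj u) (adj u); rewrite nrm_adj; nra.
rewrite lerXn2r ?nnegrE ?nrm_ge0//.
have -> : k = 2^-1 *: (u + adj u) by rewrite ua /u; ncring.
rewrite nrmZ ger0_norm ?invr_ge0//.
have := nrmD u (adj u); rewrite nrm_adj; lra.
Qed.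

(** After rescaling to norm at most 1, the iteration gives a self-adjoint 1 - l commuting with k'
    whose square is 1 - k'^2. The two squares add up to 1, so their difference has norm at most 1,
    that is, |1/2 - k'^2| <= 1/2. *)
Lemma pos_sq k : adj k = k -> pos (k * k).
Proof.
move=> k1; pose c := nrm k + 1.
have c0 : 0 < c by rewrite ltr_wpDl// nrm_ge0.
pose k' := c^-1 *: k.
have k'1 : adj k' = k' by rewrite adjZ k1.
have nk' : nrm k' <= 1.
  by apply: nrm_rescale => //; rewrite lerDl.
have /sqit_lim[l [ll _ lE]] : nrm (k' * k') <= 1.
  by rewrite nrm_sa// expr_le1// nrm_ge0.
have l1 : adj l = l.
  by apply: (ulim_sa ll) => n; apply: sqit_sa; rewrite adjM k'1.
have lk : l * k' = k' * l.
  by apply: (ulim_intertwine ll ll) => n; apply: sqit_intertwine; rewrite mulrA.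
have [|||H _] := @nrm_sq_comm k' (1 - l); rewrite ?adjB ?adj1 ?l1//.
  by rewrite mulrBl mulrBr lk mul1r mulr1.
move: H; rewrite lE (_ : k' * k' + (1 - k' * k') = 1) ?nrm1 => [H|]; last by ncring.
have : pos (k' * k').
  split; first by rewrite adjM k'1.
  exists 2^-1.
  have -> : 2^-1%:A - k' * k' = - 2^-1 *: (k' * k' - (1 - k' * k')) by ncring.
  by rewrite nrmZ normrN ger0_norm ?invr_ge0//; lra.
have -> : k * k = (c * c) *: (k' * k').
  have -> : k = c *: k' by rewrite scalerA divff ?gt_eqF// scale1r.
  by ncring.
by apply: posZ; rewrite mulr_ge0// ltW.
Qed.

(* [k] is the square root of [h] produced by the iteration, [t] being a scale
   for which it converges. *)
Definition root_at t h k := exists l,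
  [/\ ulim (sqit (1 - t^-1 *: h)) l, nrm l <= 1 & k = Num.sqrt t *: (1 - l)].

Lemma root_at_ex t h : 0 < t -> adj h = h -> nrm (t%:A - h) <= t ->
  exists k, [/\ root_at t h k, pos k & k * k = h].
Proof.
move=> t0 h1 ht; have : nrm (1 - t^-1 *: h) <= 1.
  have -> : 1 - t^-1 *: h = t^-1 *: (t%:A - h).
    by rewrite scalerBr scalerA mulVf ?gt_eqF// scale1r.
  exact: nrm_rescale.
move=> /sqit_lim[l [ll nl lE]]; exists (Num.sqrt t *: (1 - l)); split.
- by exists l.
- apply: posZ; first exact: sqrtr_ge0.
  rewrite -[1]scale1r; apply: sa_ub => //.
  by apply: (ulim_sa ll) => n; apply: sqit_sa; rewrite adjB adj1 adjZ h1.
- rewrite -scalerAl -scalerAr scalerA -expr2 sqr_sqrtr ?ltW// lE.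
  by rewrite opprB addrCA subrr addr0 scalerA mulfV ?gt_eqF// scale1r.
Qed.

Lemma root_at_intertwine t h1 h2 k1 k2 x : root_at t h1 k1 -> root_at t h2 k2 ->
  h1 * x = x * h2 -> k1 * x = x * k2.
Proof.
move=> [l1 [ll1 _ ->]] [l2 [ll2 _ ->]] hx.
suff hl : l1 * x = x * l2.
  by rewrite -scalerAl -scalerAr mulrBl mulrBr hl mul1r mulr1.
apply: (ulim_intertwine ll1 ll2) => n; apply: sqit_intertwine.
by rewrite mulrBl mulrBr -scalerAl -scalerAr hx mul1r mulr1.
Qed.

Lemma pos_scale_ex h : pos h -> exists2 t, 0 < t & nrm (t%:A - h) <= t.
Proof.
move=> [_ [t ht]]; exists (t + 1).
  by have := le_trans (nrm_ge0 _) ht; lra.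
by apply: pos_bound_mono ht; lra.
Qed.

Lemma pos_root h : pos h -> exists k,
  [/\ pos k, k * k = h & forall x, h * x = x * h -> k * x = x * k].
Proof.
move=> ph; have [t t0 ht] := pos_scale_ex ph.
have [k [kr pk kk]] := root_at_ex t0 (pos_sa ph) ht.
by exists k; split => // x; apply: (root_at_intertwine kr kr).
Qed.

(** Write h = k^2 and t - h = l^2 with commuting roots; then |k|^2 <= |k^2 + l^2| = t. *)
Lemma pos_nrm_le h t : pos h -> pos (t%:A - h) -> nrm h <= t.
Proof.
move=> ph pth; have t0 : 0 <= t.
  by apply: posA_ge0; rewrite -[t%:A](subrK h); apply: posD.
have [k [pk kk kc]] := pos_root ph; have [l [pl ll lc]] := pos_root pth.
have kl : k * l = l * k.
  by apply: kc; symmetry; apply: lc; rewrite mulrBl mulrBr; ncring.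
have [_] := nrm_sq_comm (pos_sa pk) (pos_sa pl) kl.
by rewrite kk ll addrC subrK nrmA ger0_norm// -kk nrm_sa// pos_sa.
Qed.

Lemma nrm_mono a b : pos a -> pos (b - a) -> nrm a <= nrm b.
Proof.
move=> pa pba; apply: pos_nrm_le => //.
have pb : pos b by rewrite -(subrK a b); apply: posD.
have -> : (nrm b)%:A - a = (nrm b)%:A - b + (b - a) by ncring.
by apply: posD => //; apply: pos_ub; apply: pos_sa.
Qed.

Lemma pos_anti h : pos h -> pos (- h) -> h = 0.
Proof.
move=> ph pnh; apply: nrm0_eq0; apply/eqP; rewrite eq_le nrm_ge0 andbT.
by apply: pos_nrm_le => //; rewrite scale0r add0r.
Qed.

Lemma posM a b : pos a -> pos b -> a * b = b * a -> pos (a * b).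
Proof.
move=> pa pb ab; have [k [pk kk kc]] := pos_root pa.
have [l [pl ll lc]] := pos_root pb.
have kl : k * l = l * k by apply: kc; symmetry; apply: lc.
have -> : a * b = (k * l) * (k * l) by rewrite -kk -ll; cring.
by apply: pos_sq; rewrite adjM !pos_sa.
Qed.

Lemma posX a n : pos a -> pos (a ^+ n).
Proof.
move=> pa; elim: n => [|n IH]; first by rewrite expr0; apply: pos1.
by rewrite exprS; apply: posM => //; rewrite -exprS exprSr.
Qed.

(** The bound [C] serves as one scale for all terms, and |C - s n| <= C passes to the limit. *)
Lemma ulim_pos s l C : ulim s l -> (forall n, pos (s n)) ->
  (forall n, nrm (s n) <= C) -> pos l.
Proof.
move=> sl ps sC; split; first by apply: (ulim_sa sl) => n; apply: pos_sa.
exists C; apply/ler_addgt0Pr => e /sl[m {}sl].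
have -> : C%:A - l = (C%:A - s m) + (s m - l) by ncring.
rewrite (le_trans (nrmD _ _))// lerD ?sl//.
apply: pos_nrm_le; first by apply: sa_ub => //; apply: pos_sa.
by rewrite opprB addrCA subrr addr0.
Qed.

(* The defect [1 - h^n - n h^n (1 - h)] is positive by induction. *)
Lemma pos_pow_bound h n : pos h -> pos (1 - h) ->
  nrm (h ^+ n * (1 - h)) *+ n <= 1.
Proof.
move=> ph p1h; have hX m : h * h ^+ m = h ^+ m * h by rewrite -exprS exprSr.
have p1X m : pos (1 - h ^+ m).
  elim: m => [|m IH]; first by rewrite expr0 subrr; apply: pos0.
  have -> : 1 - h ^+ m.+1 = (1 - h) + h * (1 - h ^+ m) by rewrite exprS; ncring.
  by apply: posD => //; apply: posM => //; have := hX m => ?; cring.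
have G : pos (1 - h ^+ n - n%:R *: (h ^+ n * (1 - h))).
  elim: n => [|n IH]; first by rewrite expr0 subrr scale0r subr0; apply: pos0.
  have -> : 1 - h ^+ n.+1 - n.+1%:R *: (h ^+ n.+1 * (1 - h)) =
    h * (1 - h ^+ n - n%:R *: (h ^+ n * (1 - h))) + (1 - h) * (1 - h ^+ n.+1).
    have := hX n => hXn; rewrite exprS -natr1; cring.
  apply: posD; apply: posM => //.
    by have := hX n => ?; cring.
  by have := hX n.+1 => ?; cring.
rewrite -mulr_natl -[n%:R]ger0_norm ?ler0n// -nrmZ; apply: pos_nrm_le.
  apply: posZ => //; apply: posM => //; first exact: posX.
  by have := hX n => ?; cring.
rewrite scale1r; have -> : 1 - n%:R *: (h ^+ n * (1 - h)) =
  1 - h ^+ n - n%:R *: (h ^+ n * (1 - h)) + h ^+ n by ncring.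
by apply: posD => //; apply: posX.
Qed.

Lemma pos_pow_small h e : pos h -> pos (1 - h) -> 0 < e ->
  exists m, forall n, (m <= n)%N -> nrm (h ^+ n * (1 - h)) < e.
Proof.
move=> ph p1h e0; exists (Num.truncn e^-1).+1 => n mn.
have n0 : (0 < n%:R :> R) by rewrite ltr0n (leq_trans _ mn).
have := pos_pow_bound n ph p1h; rewrite -mulr_natl => H.
rewrite -(ltr_pM2l n0) (le_lt_trans H)// -ltr_pdivrMr// div1r.
apply: (lt_le_trans (truncnS_gt _)); first by rewrite ?ler_nat.
Qed.

(** After rescaling, |h| is 1 - l with l the limit of [sqit (1 - h * h)]. For g = h and g = - h, the
    element 1 - g is another fixed point of this iteration, and the iterates, which start at 0, stay
    below it; hence 1 - l >= g. *)
Lemma pos_abs h : adj h = h -> exists a,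
  [/\ pos a, a * a = h * h, pos (a - h), pos (a + h) &
      forall x, h * x = x * h -> a * x = x * a].
Proof.
wlog nh : h / nrm h <= 1 => [H h1|h1].
  pose c := nrm h + 1; have c0 : 0 < c by rewrite ltr_wpDl// nrm_ge0.
  have cc : c * c^-1 = 1 by rewrite mulfV// gt_eqF.
  have [||a [pa aa p1 p2 ac]] := H (c^-1 *: h).
  - by apply: nrm_rescale => //; rewrite lerDl.
  - by rewrite adjZ h1.
  have hE : h = c *: (c^-1 *: h) by rewrite scalerA cc scale1r.
  exists (c *: a); split.
  - by apply: posZ => //; apply: ltW.
  - rewrite [in RHS]hE; transitivity ((c * c) *: (a * a)); first by ncring.
    by rewrite aa; ncring.
  - by rewrite {1}hE -scalerBr; apply: posZ => //; apply: ltW.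
  - by rewrite {1}hE -scalerDr; apply: posZ => //; apply: ltW.
  - move=> x hx; rewrite -scalerAl -scalerAr ac//.
    by rewrite -scalerAl -scalerAr hx.
have y1 : adj (1 - h * h) = 1 - h * h by rewrite adjB adj1 adjM h1.
have ny : nrm (1 - h * h) <= 1.
  apply: pos_nrm_le.
    rewrite -[1]scale1r; apply: sa_ub; first by rewrite adjM h1.
    by rewrite nrm_sa// expr_le1// nrm_ge0.
  by rewrite scale1r opprB addrCA subrr addr0; apply: pos_sq.
have py : pos (1 - h * h).
  rewrite -[1]scale1r; apply: sa_ub; first by rewrite adjM h1.
  by rewrite nrm_sa// expr_le1// nrm_ge0.
have [l [ll nl lE]] := sqit_lim ny.
have ps n : pos (sqit (1 - h * h) n).
  elim: n => [|n IH] /=; first exact: pos0.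
  apply: posZ; rewrite ?invr_ge0//; apply: posD => //.
  by apply: pos_sq; apply: pos_sa.
have key g : adj g = g -> nrm g <= 1 -> g * g = h * h -> pos (1 - l - g).
  move=> g1 ng gg.
  have gs n : sqit (1 - h * h) n * g = g * sqit (1 - h * h) n.
    by apply: sqit_intertwine; rewrite -gg; ncring.
  have {}ps n : pos (1 - g - sqit (1 - h * h) n).
    elim: n => [|n IH].
      by rewrite subr0 -[1]scale1r; apply: sa_ub.
    have -> : 1 - g - sqit (1 - h * h) n.+1 = 2^-1 *:
       ((1 - g - sqit (1 - h * h) n) * (1 - g + sqit (1 - h * h) n)).
      have := gs n; rewrite [sqit _ n.+1]/= -gg; move: (sqit _ n) => s gsn.
      by cring.
    apply: posZ; rewrite ?invr_ge0//; apply: posM => //.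
      apply: posD => //; rewrite -[1]scale1r; exact: sa_ub.
    have := gs n; move: (sqit _ n) => s gsn; cring.
  apply: (@ulim_pos (fun n => 1 - g - sqit (1 - h * h) n) _ 3).
  - move=> e /ll[m {}ll]; exists m => n /ll.
    rewrite nrm_distC; congr (nrm _ <= _); ncring.
  - by [].
  - move=> n; have := nrmB (1 - g) (sqit (1 - h * h) n).
    have := nrmB 1 g; rewrite nrm1; have := sqit_nrm n ny.
    by case/andP: (@sqit_bound_itv R n); lra.
exists (1 - l); split.
- rewrite -[1]scale1r; apply: sa_ub => //.
  by apply: (ulim_sa ll) => n; apply: sqit_sa.
- by rewrite lE opprB addrCA subrr addr0.
- exact: key.
- by rewrite -[h]opprK; apply: key; rewrite ?adjN ?h1 ?nrmN// mulrNN.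
- move=> x hx; suff : l * x = x * l by move=> lx; rewrite mulrBl mulrBr lx; ncring.
  apply: (ulim_intertwine ll ll) => n; apply: sqit_intertwine.
  by rewrite mulrBl mulrBr -mulrA hx mulrA hx; ncring.
Qed.

End Positivity.

(** * Uniqueness of roots, positive parts, and positivity of [adj x * x] *)

Section PositiveRoot.
Context {R : realType} {U : ucstarType R}.
Implicit Types (a b c h k p x y z l r : U) (t : R).

Lemma nrm_cube0 x : adj x = x -> x * x * x = 0 -> x = 0.
Proof.
move=> x1 x3; have : x ^+ (2 ^ 2) = 0.
  by rewrite !exprS expr0 mulr1 !mulrA x3 mul0r.
move=> /(congr1 nrm); rewrite nrm_sa_pow// nrm0 => /eqP.
by rewrite expf_eq0 => /andP[_ /eqP /nrm0_eq0].
Qed.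

(** Both roots are compared with the root s that commutes with everything commuting with h. For a
    root y, (y - s)^2 y and (y - s)^2 s are positive with sum (y - s) (y^2 - s^2) = 0, so both
    vanish and (y - s)^3 = 0. *)
Lemma pos_root_uniq k l : pos k -> pos l -> k * k = l * l -> k = l.
Proof.
suff H y s h : pos y -> pos s -> y * y = h -> s * s = h ->
    (forall x, h * x = x * h -> s * x = x * s) -> y = s.
  move=> pk pl kl; have [s [ps ss sc]] := pos_root (pos_sq (pos_sa pl)).
  by rewrite (H k s (l * l))// (H l s (l * l)).
move=> py ps yy ss sc; have sy : s * y = y * s.
  by apply: sc; rewrite -yy mulrA.
have y1 := pos_sa py; have s1 := pos_sa ps.
have d1 : adj (y - s) = y - s by rewrite adjB y1 s1.
have dd := pos_sq d1.
have pA : pos ((y - s) * (y - s) * y) by apply: posM => //; cring.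
have pB : pos ((y - s) * (y - s) * s) by apply: posM => //; cring.
have AB : (y - s) * (y - s) * y = - ((y - s) * (y - s) * s).
  apply/eqP; rewrite -addr_eq0; apply/eqP.
  transitivity ((y - s) * (y * y - s * s)); first by cring.
  by rewrite yy ss subrr mulr0.
have A0 : (y - s) * (y - s) * y = 0.
  by apply: pos_anti => //; rewrite AB opprK.
have B0 : (y - s) * (y - s) * s = 0.
  by apply: pos_anti => //; rewrite -AB.
apply/eqP; rewrite -subr_eq0; apply/eqP; apply: nrm_cube0 => //.
by rewrite mulrBr A0 B0 subrr.
Qed.

Definition usqrt h : U := xget 0 [set k | pos k /\ k * k = h].

Lemma usqrtP h : pos h -> pos (usqrt h) /\ usqrt h * usqrt h = h.
Proof.
move=> /pos_root[k [pk kk _]]; rewrite /usqrt.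
by apply: (@xgetPex _ 0 [set k | pos k /\ k * k = h]); exists k.
Qed.

Lemma usqrt_pos h : pos h -> pos (usqrt h).
Proof. by case/usqrtP. Qed.

Lemma usqrt_sq h : pos h -> usqrt h * usqrt h = h.
Proof. by case/usqrtP. Qed.

Lemma usqrtE h k : pos k -> k * k = h -> usqrt h = k.
Proof.
move=> pk kk; have ph : pos h by rewrite -kk; apply/pos_sq/pos_sa.
by apply: pos_root_uniq => //; rewrite ?usqrt_sq//; apply: usqrt_pos.
Qed.

(** Both roots are computed at one common scale, hence as limits of the same polynomials in h1 and
    in h2. *)
Lemma usqrt_intertwine h1 h2 x : pos h1 -> pos h2 -> h1 * x = x * h2 ->
  usqrt h1 * x = x * usqrt h2.
Proof.
move=> p1 p2; have [t1 t10 ht1] := pos_scale_ex p1.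
have [t2 t20 ht2] := pos_scale_ex p2; pose t := t1 + t2.
have t0 : 0 < t by rewrite /t addr_gt0.
have [|k1 [r1 pk1 kk1]] := root_at_ex t0 (pos_sa p1).
  by apply: pos_bound_mono ht1; rewrite /t lerDl ltW.
have [|k2 [r2 pk2 kk2]] := root_at_ex t0 (pos_sa p2).
  by apply: pos_bound_mono ht2; rewrite /t lerDr ltW.
by rewrite (usqrtE pk1 kk1) (usqrtE pk2 kk2); apply: (root_at_intertwine r1 r2).
Qed.

Lemma usqrtC h x : pos h -> h * x = x * h -> usqrt h * x = x * usqrt h.
Proof. by move=> ph; apply: usqrt_intertwine. Qed.

Definition upos h : U := 2^-1 *: (usqrt (h * h) + h).

Lemma uposP h : adj h = h ->
  [/\ pos (upos h), pos (upos h - h), upos h * (upos h - h) = 0 &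
      forall x, h * x = x * h -> upos h * x = x * upos h].
Proof.
move=> h1; have [a [pa aa p1 p2 ac]] := pos_abs h1.
rewrite /upos (usqrtE pa aa); split.
- by apply: posZ; rewrite ?invr_ge0.
- have -> : 2^-1 *: (a + h) - h = 2^-1 *: (a - h) by ncring.
  by apply: posZ; rewrite ?invr_ge0.
- have ah := ac h erefl.
  have -> : 2^-1 *: (a + h) * (2^-1 *: (a + h) - h) = 2^-1 *: (2^-1 *: (a * a - h * h)).
    by cring.
  by rewrite aa subrr !scaler0.
- move=> x hx; rewrite -scalerAl -scalerAr mulrDl mulrDr hx.
  by rewrite (ac x hx).
Qed.

Lemma pos_decomp h : adj h = h -> exists p n,
  [/\ pos p, pos n, p * n = 0, n * p = 0 & h = p - n].
Proof.
move=> /uposP[pp pn pn0 _]; exists (upos h), (upos h - h); split=> //.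
  by have := congr1 adj pn0; rewrite adjM adj0 (pos_sa pn) (pos_sa pp).
by ncring.
Qed.

(** From p^3 <= t p^2 one gets |p|^4 = |p^4| <= |p^3| |p| <= t |p|^3. This bounds a positive or
    negative part p of h when only compressions such as p h p are known. *)
Lemma pos_cube_le p t : pos p -> 0 <= t -> pos (t *: (p * p) - p * p * p) ->
  nrm p <= t.
Proof.
move=> pp t0 H; have p1 := pos_sa pp.
have [p0|p0] := eqVneq (nrm p) 0; first by rewrite p0.
have {}p0 : 0 < nrm p by rewrite lt_def p0 nrm_ge0.
have c3 : nrm (p * p * p) <= t * nrm p ^+ 2.
  rewrite -nrm_sa// -[t in leRHS]ger0_norm// -nrmZ; apply: nrm_mono => //.
  by apply: posM; rewrite ?mulrA//; apply: pos_sq.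
have c4 : nrm p ^+ 4 <= nrm (p * p * p) * nrm p.
  rewrite -(@nrm_sa_pow _ _ p 2)//.
  by rewrite !exprS expr0 mulr1 !mulrA; apply: nrmM.
rewrite -(ler_pM2r (exprn_gt0 3 p0)) -exprS (le_trans c4)//.
by rewrite [nrm p ^+ 3]exprSr mulrA ler_pM2r.
Qed.

(** For the positive part p one has p h p = p^3, so t - h >= 0 compressed by p gives t p^2 - p^3 >=
    0. *)
Lemma upos_le h t : adj h = h -> 0 <= t -> pos (t%:A - h) -> nrm (upos h) <= t.
Proof.
move=> h1 t0 ph; have [pp pn pn0 pc] := uposP h1.
set p := upos h in pp pn pn0 pc *; apply: pos_cube_le => //.
have hp : h * p = p * h by rewrite pc.
have php : p * h * p = p * p * p.
  apply/eqP; rewrite -subr_eq0; apply/eqP.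
  have -> : p * h * p - p * p * p = - (p * (p - h) * p) by ncring.
  by rewrite pn0 mul0r oppr0.
have -> : t *: (p * p) - p * p * p = (t%:A - h) * (p * p) by rewrite -php; cring.
by apply: posM => //; [apply: pos_sq; apply: pos_sa|cring].
Qed.

(* If [q = y y*] then [q y = - y m], so [(t - q) y = y (t + m)] for
   [t = |y|^2]; taking norms contradicts [(t + m) m (t + m) >= 2 t m^2]. *)
Lemma star_neg y m : pos m -> adj y * y = - m -> y = 0.
Proof.
move=> pm ym; pose q := y * adj y.
pose b := 2^-1 *: (y + adj y); pose c := 2^-1 *: (im * (adj y - y)).
have b1 : adj b = b by rewrite adjZ adjD adjK addrC.
have c1 : adj c = c.
  by rewrite adjZ adjM adjB adjK adj_im mulrN -imC -mulrN opprB.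
(* [b] and [c] are the real and imaginary parts of y: y [adj y] + [adj y] y = 2 (b^2 + c^2), and
   [adj y] y = - m. *)
have pq : pos q.
  have -> : q = 2 *: (b * b + c * c) + m.
    have -> : c * c = - (2^-1 *: (2^-1 *: ((adj y - y) * (adj y - y)))).
      rewrite /c -scalerAl -scalerAr mulrA -[im * _ * im]mulrA -imC.
      by rewrite mulrA im_sqr -!mulrA mulN1r !scalerN.
    by rewrite -[m]opprK -ym /b /q; ncring.
  by apply: posD => //; apply: posZ => //; apply: posD; apply: pos_sq.
have m1 := pos_sa pm.
pose t := nrm y ^+ 2.
have t0 : 0 <= t by rewrite sqr_ge0.
have tq : nrm q = t by rewrite nrm_starr.
have tm : nrm m = t by rewrite -nrmN -ym nrm_star.
have E : (t%:A - q) * y = y * (t%:A + m).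
  by rewrite /q mulrBl -mulrA ym; ncring.
have le1 : nrm (t%:A - q) <= t.
  apply: pos_nrm_le; first by rewrite -tq; apply: pos_ub; apply: pos_sa.
  by rewrite opprB addrCA subrr addr0.
have a1 : adj (t%:A + m) = t%:A + m by rewrite adjD adjA m1.
have : nrm (y * (t%:A + m)) ^+ 2 <= t ^+ 2 * t.
  rewrite -E -[in t ^+ 2 * t]/(nrm y ^+ 2) -exprMn.
  by rewrite lerXn2r ?nnegrE ?nrm_ge0 ?mulr_ge0 ?nrm_ge0// nrmM_le.
rewrite -nrm_star adjM a1 mulrA -[_ * adj y * y]mulrA ym mulrN mulNr nrmN.
have : nrm ((2 * t) *: (m * m)) <= nrm ((t%:A + m) * m * (t%:A + m)).
  apply: nrm_mono; first by apply: posZ; [nra|apply: pos_sq].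
  have -> : (t%:A + m) * m * (t%:A + m) - (2 * t) *: (m * m) =
    (t ^+ 2) *: m + m * m * m by ncring.
  apply: posD; first by apply: posZ; rewrite ?sqr_ge0.
  by apply: posM; rewrite ?mulrA//; apply: pos_sq.
have t2 : 0 <= 2 * t by lra.
rewrite nrmZ (ger0_norm t2) (nrm_sa m1) tm => H1 H2.
have /eqP : t = 0.
  have [//|t1] := eqVneq t 0; have {}t1 : 0 < t by rewrite lt_def t1.
  have := le_trans H1 H2.
  have -> : 2 * t * t ^+ 2 = 2 * (t ^+ 2 * t) by ring.
  have : 0 < t ^+ 2 * t by rewrite mulr_gt0// exprn_gt0.
  by lra.
by rewrite sqrf_eq0 => /eqP /nrm0_eq0.
Qed.

(** Let n be the negative part of [adj x * x]. Then y = x n satisfies [adj y * y = - n^3], so y = 0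
    by the preceding lemma, and therefore n^3 = 0. *)
Lemma star_pos x : pos (adj x * x).
Proof.
have h1 : adj (adj x * x) = adj x * x by rewrite adjM adjK.
have [p [n [pp pn _ np hE]]] := pos_decomp h1; have n1 := pos_sa pn.
suff n0 : n = 0 by rewrite hE n0 subr0.
have y0 : x * n = 0.
  apply: (@star_neg _ (n * n * n)).
    by apply: posM; rewrite ?mulrA//; apply: pos_sq.
  rewrite adjM n1 mulrA -[n * _ * x]mulrA hE mulrBr np sub0r.
  by rewrite mulNr.
apply: nrm_cube0 => //.
rewrite -[LHS]opprK; apply/eqP; rewrite oppr_eq0; apply/eqP.
transitivity (n * (p - n) * n); first by rewrite mulrBr np sub0r mulNr.
by rewrite -hE -!mulrA y0 !mulr0.
Qed.

Lemma conj_pos x h : pos h -> pos (adj x * h * x).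
Proof.
move=> ph; have -> : adj x * h * x = adj (usqrt h * x) * (usqrt h * x).
  rewrite adjM (pos_sa (usqrt_pos ph)) -{1}(usqrt_sq ph).
  by rewrite !mulrA.
exact: star_pos.
Qed.

Lemma conj_posr x h : pos h -> pos (x * h * adj x).
Proof. by move=> ph; rewrite -{1}(adjK x); apply: conj_pos. Qed.

Lemma conj_sa x h : adj x = x -> pos h -> pos (x * h * x).
Proof. by move=> x1 ph; rewrite -{1}x1; apply: conj_pos. Qed.

Lemma nrm_conj_le x a b : pos a -> pos (b - a) ->
  nrm (x * a * adj x) <= nrm (x * b * adj x).
Proof.
move=> pa pba; apply: nrm_mono; first exact: conj_posr.
by rewrite -mulrBl -mulrBr; apply: conj_posr.
Qed.

Lemma contr_sq c : pos c -> pos (1 - c) -> pos (c - c * c).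
Proof.
move=> pc p1c; have -> : c - c * c = c * (1 - c) by ncring.
by apply: posM => //; ncring.
Qed.

(** The left side is |x c^2 [adj x]| and c^2 <= c. Used with c = 1 - a, it turns order estimates
    into bounds on x (1 - a). *)
Lemma nrm_contr_sq x c : pos c -> pos (1 - c) ->
  nrm (x * c) ^+ 2 <= nrm (x * c * adj x).
Proof.
move=> pc p1c; rewrite -nrm_starr adjM (pos_sa pc) mulrA -[x * c * c]mulrA.
by apply: nrm_conj_le; [apply: pos_sq; apply: pos_sa|apply: contr_sq].
Qed.

Lemma contr_nrm c : pos c -> pos (1 - c) -> nrm c <= 1.
Proof. by move=> pc p1c; apply: pos_nrm_le => //; rewrite scale1r. Qed.

Lemma nrm_contr c : pos c -> nrm c <= 1 -> pos (1 - c).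
Proof. by move=> pc c1; rewrite -[1]scale1r; apply: sa_ub => //; apply: pos_sa. Qed.

(** * Invertibility *)

(** The partial sums of the Neumann series follow Horner's recursion, and the same recursion at
    [rho] dominates their increments. *)
Lemma neumann r (rho : R) : 0 <= rho < 1 -> nrm r <= rho ->
  exists l, (1 - r) * l = 1 /\ l * r = r * l.
Proof.
move=> /andP[r0 r1] nr.
pose S := fix S n : U := if n is n'.+1 then 1 + r * S n' else 0.
pose b := fix b n : R := if n is n'.+1 then 1 + rho * b n' else 0.
have Sr n : S n * r = r * S n.
  by elim: n => [|n IH] /=; rewrite ?mulr0 ?mul0r// mulrDl mulrDr -mulrA IH; ncring.
have step n : nrm (S n.+1 - S n) <= b n.+1 - b n.
  elim: n => [|n IH]; first by rewrite /= !mulr0 !addr0 !subr0 nrm1.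
  have -> : S n.+2 - S n.+1 = r * (S n.+1 - S n).
    have ES m : S m.+1 = 1 + r * S m by [].
    by rewrite (ES n.+1) [X in _ - X = _](ES n); move: (S _) (S _) => x y; ncring.
  have -> : b n.+2 - b n.+1 = rho * (b n.+1 - b n) by rewrite /=; ring.
  by rewrite nrmM_le.
have bB n : b n <= (1 - rho)^-1.
  have H : 0 < 1 - rho by lra.
  elim: n => [|n IH]; first by rewrite invr_ge0 ltW.
  rewrite [b _]/= (_ : (1 - rho)^-1 = 1 + rho * (1 - rho)^-1).
    by rewrite lerD2l ler_wpM2l.
  by field; rewrite gt_eqF.
have [l hl] := @nrm_complete _ _ S b _ step bB.
have lim : ulim S l by [].
exists l; split; last exact: (ulim_intertwine lim lim).
apply/eqP; rewrite -subr_eq0; apply/eqP.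
apply: (@nrm_eps0 _ _ _ 2) => e /hl[m {}hl].
have h1 := hl m (leqnn m); have h2 := hl m.+1 (leqnSn m).
have -> : (1 - r) * l - 1 = r * (S m - l) - (S m.+1 - l).
  by rewrite /=; move: (S m) => s; ncring.
apply: (le_trans (nrmB _ _)); have := nrmM_le (le_trans nr (ltW r1)) h1.
by lra.
Qed.

(** If |s - h| <= s, then t + h = (s + t) (1 - r) with |r| <= s / (s + t) < 1. The inverse y is
    positive because it equals [adj y] (t + h) y. *)
Lemma pos_inv h t : pos h -> 0 < t ->
  exists y, [/\ (t%:A + h) * y = 1, y * (t%:A + h) = 1 & pos y].
Proof.
move=> ph t0; have [s s0 hs] := pos_scale_ex ph.
have st : 0 < s + t by rewrite addr_gt0.
pose r := (s + t)^-1 *: (s%:A - h).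
have [||l [l1 lr]] := @neumann r (s / (s + t)).
- by rewrite divr_ge0 ?ltW//= ltr_pdivrMr// mul1r ltrDl.
- rewrite nrmZ gtr0_norm ?invr_gt0// mulrC.
  by rewrite ler_pM2r ?invr_gt0.
have E : t%:A + h = (s + t) *: (1 - r).
  rewrite scalerBr scalerA mulfV ?gt_eqF// scale1r; ncring.
have y1 : (t%:A + h) * ((s + t)^-1 *: l) = 1.
  by rewrite E -scalerAl -scalerAr scalerA mulfV ?gt_eqF// l1 scale1r.
have y2 : (s + t)^-1 *: l * (t%:A + h) = 1.
  rewrite E -scalerAl -scalerAr scalerA mulVf ?gt_eqF// scale1r.
  by transitivity ((1 - r) * l) => //; rewrite mulrBr mulrBl lr mul1r mulr1.
set y := _ *: l in y1 y2; exists y; split => //.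
have pth : pos (t%:A + h) by apply: posD => //; apply: posA; apply: ltW.
have ay : adj y * (t%:A + h) = 1 by rewrite -(pos_sa pth) -adjM y1 adj1.
by rewrite -[y]mul1r -ay; apply: conj_pos.
Qed.

(** Suppose the negative part n has norm v > 0 and put w = n / v. Then w (v + h) = v w (1 - w), so
    with y a right inverse of v + h, w^N = v w^N (1 - w) y. The right side tends to 0, while |w^N| =
    1 for N a power of 2. *)
Lemma pos_of_inv h : adj h = h ->
  (forall t, 0 < t -> exists y, (t%:A + h) * y = 1) -> pos h.
Proof.
move=> h1 hinv; have [p [n [pp pn _ np hE]]] := pos_decomp h1.
have [n0|n0] := eqVneq (nrm n) 0.
  by rewrite hE (nrm0_eq0 _ n0) subr0.
pose v := nrm n; have {n0}v0 : 0 < v by rewrite lt_def n0 nrm_ge0.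
have [y hy] := hinv v v0.
pose w := v^-1 *: n.
have pw : pos w by apply: posZ => //; rewrite invr_ge0 ltW.
have nw : nrm w = 1.
  by rewrite nrmZ gtr0_norm ?invr_gt0// mulVf// gt_eqF.
have p1w : pos (1 - w) by apply: nrm_contr; rewrite ?nw.
have wv : w * (v%:A + h) = v *: (w * (1 - w)).
  have nE : n = v *: w by rewrite scalerA mulfV ?gt_eqF// scale1r.
  have wp : w * p = 0 by rewrite -scalerAl np scaler0.
  by rewrite hE addrCA mulrDr wp add0r {1}nE; ncring.
have E m : w ^+ m.+1 = v *: (w ^+ m.+1 * (1 - w)) * y.
  rewrite exprSr -[w ^+ m * w * (1 - w)]mulrA scalerAr -wv.
  by rewrite -!mulrA hy mulr1.
have d0 : 0 < v * nrm y + 1 by have := nrm_ge0 y; nra.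
have [|m hm] := @pos_pow_small _ _ w (v * nrm y + 1)^-1 pw p1w.
  by rewrite invr_gt0.
have {}hm := hm (2 ^ m)%N (ltnW (ltn_expl _ (ltnSn 1))).
have : nrm (w ^+ (2 ^ m)) = 1 by rewrite nrm_sa_pow ?nw ?expr1n// (pos_sa pw).
have := E (2 ^ m).-1; rewrite prednK ?expn_gt0// => -> H.
have := nrmM (v *: (w ^+ (2 ^ m)%N * (1 - w))) y.
rewrite H nrmZ gtr0_norm//.
move: hm; set N := nrm (_ * _) => hm H2.
have N0 : 0 <= N by apply: nrm_ge0.
have : N * (v * nrm y + 1) < 1 by rewrite -ltr_pdivlMr// div1r.
by nra.
Qed.

End PositiveRoot.

Local Open Scope complex_scope.
Local Open Scope cstar_scope.

(** * The unitization *)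

Section CStarBasics.
Context {R : realType} {A : cstarAlgType R}.
Implicit Types (a b x y : A) (k : R[i]) (t : R).

Definition cabs k : R := complex.Re `|k|.

Lemma norm_cabs k : `|k| = (cabs k)%:C.
Proof. by rewrite /cabs RRe_real// normr_real. Qed.

Lemma cabs_ge0 k : 0 <= cabs k.
Proof. by rewrite -lecR -norm_cabs; exact: normr_ge0. Qed.

Lemma cabs0 : cabs 0 = 0.
Proof. by rewrite /cabs normr0. Qed.

Lemma cabsM k l : cabs (k * l) = cabs k * cabs l.
Proof.
by apply: complexI; rewrite -norm_cabs normrM !norm_cabs rmorphM.
Qed.

Lemma cabsD k l : cabs (k + l) <= cabs k + cabs l.
Proof. by rewrite -lecR rmorphD/= -!norm_cabs ler_normD. Qed.

Lemma cabs_real t : cabs t%:C = `|t|.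
Proof.
by apply: complexI; rewrite -norm_cabs normc_def /= expr0n/= addr0 sqrtr_sqr.
Qed.

Lemma cabs_conj k : cabs (Num.conj k) = cabs k.
Proof. by rewrite /cabs norm_conjC. Qed.

Lemma cabs_eq0 k : cabs k = 0 -> k = 0.
Proof. by move=> k0; apply/eqP; rewrite -normr_eq0 norm_cabs k0. Qed.

Lemma conj_realC t : Num.conj (t%:C) = t%:C.
Proof. by rewrite conj_Creal// complex_real. Qed.

Lemma norm_cnorm x : `|x| = (cnorm x)%:C.
Proof. by rewrite /cnorm RRe_real// normr_real. Qed.

Lemma cnorm_ge0 x : 0 <= cnorm x.
Proof. by rewrite -lecR -norm_cnorm; exact: normr_ge0. Qed.

Lemma cnorm0 : cnorm (0 : A) = 0.
Proof. by rewrite /cnorm normr0. Qed.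

Lemma cnorm_eq0 x : cnorm x = 0 -> x = 0.
Proof. by move=> x0; apply/eqP; rewrite -normr_eq0 norm_cnorm x0. Qed.

Lemma cnormD x y : cnorm (x + y) <= cnorm x + cnorm y.
Proof. by rewrite -lecR rmorphD/= -!norm_cnorm ler_normD. Qed.

Lemma cnormZ k x : cnorm (k *: x) = cabs k * cnorm x.
Proof.
by apply: complexI; rewrite -norm_cnorm normrZ norm_cnorm norm_cabs rmorphM.
Qed.

Lemma cnormM x y : cnorm (x ** y) <= cnorm x * cnorm y.
Proof. by rewrite -lecR rmorphM/= -!norm_cnorm normcM. Qed.

Lemma cnorm_star x : cnorm (x^star ** x) = cnorm x ^+ 2.
Proof.
by apply: complexI; rewrite -norm_cnorm normc_star norm_cnorm rmorphXn.
Qed.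

Lemma cnorm_adj x : cnorm (x^star) = cnorm x.
Proof.
have H y : cnorm y <= cnorm (y^star).
  have [->|y0] := eqVneq (cnorm y) 0; first exact: cnorm_ge0.
  have yp : 0 < cnorm y by rewrite lt_def y0 cnorm_ge0.
  by rewrite -(ler_pM2r yp) -expr2 -cnorm_star cnormM.
by apply/eqP; rewrite eq_le -{2}(starK x) !H.
Qed.

Lemma cmul0l x : 0 ** x = 0.
Proof. by apply: (addrI (0 ** x)); rewrite -cmulDl !addr0. Qed.

Lemma cmul0r x : x ** 0 = 0.
Proof. by apply: (addrI (x ** 0)); rewrite -cmulDr !addr0. Qed.

Lemma cmulNl x y : (- x) ** y = - (x ** y).
Proof. by apply: (addrI (x ** y)); rewrite -cmulDl !subrr cmul0l. Qed.

Lemma cmulNr x y : x ** (- y) = - (x ** y).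
Proof. by apply: (addrI (x ** y)); rewrite -cmulDr !subrr cmul0r. Qed.

Lemma star0 : (0 : A)^star = 0.
Proof. by rewrite -(scale0r (0 : A)) starZ conjC0 !scale0r. Qed.

End CStarBasics.

(** A separate name, so that of the componentwise structures of the product only the additive group
    is kept. *)
Definition unitz (R : realType) (A : cstarAlgType R) := (A * R[i])%type.

HB.instance Definition _ R (A : cstarAlgType R) :=
  GRing.Zmodule.copy (unitz A) (A * R[i])%type.

Section UnitzRing.
Context {R : realType} {A : cstarAlgType R}.
Implicit Types (u v w : unitz A).

Definition unitz_mul u v : unitz A := unitization_mul u v.

Definition unitz_one : unitz A := (0, 1).

Lemma unitz_eqP u v : u.1 = v.1 -> u.2 = v.2 -> u = v.
Proof. by case: u v => [? ?] [? ?] /= -> ->. Qed.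

Fact unitz_mulA : associative unitz_mul.
Proof.
move=> [x k] [y l] [z m]; rewrite /unitz_mul /unitization_mul /=.
apply: unitz_eqP => /=; last by rewrite mulrA.
rewrite !cmulDl !cmulDr !scalerDr -!cscaleAl -!cscaleAr !cscaleAr !scalerA cmulA.
rewrite [m * l]mulrC [m * k]mulrC.
by rewrite [LHS](AC (4*3) ((1*3*5)*(2*4*6)*7)).
Qed.

Fact unitz_mul1r : left_id unitz_one unitz_mul.
Proof.
move=> [x k]; apply: unitz_eqP => /=; last by rewrite mul1r.
by rewrite cmul0l scaler0 scale1r !add0r.
Qed.

Fact unitz_mulr1 : right_id unitz_one unitz_mul.
Proof.
move=> [x k]; apply: unitz_eqP => /=; last by rewrite mulr1.
by rewrite cmul0r scaler0 scale1r addr0 add0r.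
Qed.

Fact unitz_mulDl : left_distributive unitz_mul +%R.
Proof.
move=> [x k] [y l] [z m]; apply: unitz_eqP => /=; last by rewrite mulrDl.
by rewrite cmulDl scalerDr scalerDl [RHS]addrACA; congr (_ + _); rewrite addrACA.
Qed.

Fact unitz_mulDr : right_distributive unitz_mul +%R.
Proof.
move=> [x k] [y l] [z m]; apply: unitz_eqP => /=; last by rewrite mulrDr.
by rewrite cmulDr scalerDr scalerDl [RHS]addrACA; congr (_ + _); rewrite addrACA.
Qed.

Fact unitz_one_neq0 : unitz_one != 0.
Proof. by apply/eqP => /(congr1 snd) /eqP; rewrite /= oner_eq0. Qed.

HB.instance Definition _ := GRing.Zmodule_isNzRing.Build (unitz A)
  unitz_mulA unitz_mul1r unitz_mulr1 unitz_mulDl unitz_mulDr unitz_one_neq0.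

Definition unitz_scale (t : R) u : unitz A := (t%:C *: u.1, t%:C * u.2).

Fact unitz_scalerA s t u :
  unitz_scale s (unitz_scale t u) = unitz_scale (s * t) u.
Proof.
by apply: unitz_eqP => /=; rewrite ?scalerA ?mulrA -rmorphM.
Qed.

Fact unitz_scale1r : left_id 1 unitz_scale.
Proof. by move=> u; apply: unitz_eqP => /=; rewrite ?scale1r ?mul1r. Qed.

Fact unitz_scalerDr : right_distributive unitz_scale +%R.
Proof.
by move=> t u v; apply: unitz_eqP => /=; rewrite ?scalerDr ?mulrDr.
Qed.

Fact unitz_scalerDl u : {morph unitz_scale^~ u : s t / s + t}.
Proof.
by move=> s t; apply: unitz_eqP => /=; rewrite rmorphD ?scalerDl ?mulrDl.
Qed.

HB.instance Definition _ := GRing.Zmodule_isLmodule.Build R (unitz A)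
  unitz_scalerA unitz_scale1r unitz_scalerDr unitz_scalerDl.

Fact unitz_scalerAl t u v : t *: (u * v) = (t *: u) * v :> unitz A.
Proof.
apply: unitz_eqP => /=; last by rewrite mulrA.
by rewrite !scalerDr cscaleAl !scalerA; congr (_ + _ *: _ + _); rewrite mulrC.
Qed.

HB.instance Definition _ :=
  GRing.Lmodule_isLalgebra.Build R (unitz A) unitz_scalerAl.

Fact unitz_scalerAr t u v : t *: (u * v) = u * (t *: v) :> unitz A.
Proof.
apply: unitz_eqP => /=; last by rewrite mulrCA.
by rewrite !scalerDr cscaleAr !scalerA; congr (_ + _ + _ *: _); rewrite mulrC.
Qed.

HB.instance Definition _ :=
  GRing.Lalgebra_isAlgebra.Build R (unitz A) unitz_scalerAr.

End UnitzRing.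

(** * The C*-norm of the unitization *)

Section UnitzNorm.
Context {R : realType} {A : cstarAlgType R}.
Implicit Types (u v w : unitz A) (a b x y : A) (k : R[i]) (t : R).

Definition act u a : A := u.1 ** a + u.2 *: a.

Lemma act_mul u v a : act (u * v) a = act u (act v a).
Proof.
rewrite /act /= !cmulDl !cmulDr !scalerDr -!cscaleAl -!cscaleAr !scalerA cmulA.
by rewrite -addrA.
Qed.

Lemma actD u v a : act (u + v) a = act u a + act v a.
Proof. by rewrite /act /= cmulDl scalerDl addrACA. Qed.

Lemma act_scale t u a : act (t *: u) a = t%:C *: act u a.
Proof. by rewrite /act /= scalerDr cscaleAl scalerA. Qed.

Lemma actZ u k a : act u (k *: a) = k *: act u a.
Proof. by rewrite /act scalerDr cscaleAr !scalerA mulrC. Qed.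

Lemma act_le u a : cnorm (act u a) <= (cnorm u.1 + cabs u.2) * cnorm a.
Proof.
by rewrite (le_trans (cnormD _ _))// mulrDl cnormZ lerD// cnormM.
Qed.

Definition opn u : R :=
  sup [set cnorm (act u a) | a in [set a | cnorm a <= 1]].

Lemma opn_has_sup u : has_sup [set cnorm (act u a) | a in [set a | cnorm a <= 1]].
Proof.
split; first by exists (cnorm (act u 0)), 0 => //=; rewrite cnorm0.
exists (cnorm u.1 + cabs u.2) => _ [a /= a1 <-].
rewrite (le_trans (act_le _ _))// ler_piMr// addr_ge0// ?cnorm_ge0//.
exact: cabs_ge0.
Qed.

Lemma opn_ub u a : cnorm a <= 1 -> cnorm (act u a) <= opn u.
Proof. by move=> a1; apply: sup_upper_bound (opn_has_sup u) _ _; exists a. Qed.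

Lemma opn_le u C : (forall a, cnorm a <= 1 -> cnorm (act u a) <= C) -> opn u <= C.
Proof.
move=> H; apply: ge_sup; first by case: (opn_has_sup u).
by move=> _ [a /= a1 <-]; apply: H.
Qed.

Lemma opn_ge0 u : 0 <= opn u.
Proof. by apply: le_trans (opn_ub u (a := 0) _); rewrite ?cnorm_ge0// cnorm0. Qed.

Lemma opn_act u a : cnorm (act u a) <= opn u * cnorm a.
Proof.
have [/cnorm_eq0 ->|a0] := eqVneq (cnorm a) 0.
  by rewrite /act cmul0r scaler0 addr0 cnorm0 mulr0.
have {}a0 : 0 < cnorm a by rewrite lt_def a0 cnorm_ge0.
have := @opn_ub u ((cnorm a)^-1%:C *: a).
rewrite actZ !cnormZ cabs_real gtr0_norm ?invr_gt0// mulVf ?gt_eqF//.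
by move=> /(_ (lexx _)); rewrite mulrC ler_pdivrMr.
Qed.

Lemma opnM u v : opn (u * v) <= opn u * opn v.
Proof.
apply: opn_le => a a1; rewrite act_mul (le_trans (opn_act _ _))//.
by rewrite ler_wpM2l ?opn_ge0// opn_ub.
Qed.

Definition unitz_adj u : unitz A := (u.1^star, Num.conj u.2).

Lemma act_star u a : (act u a)^star ** act u a = a^star ** act (unitz_adj u * u) a.
Proof.
rewrite act_mul; move: {2 3}(act u a) => b.
by rewrite /act /= starD starM starZ cmulDl cmulDr cmulA -cscaleAl -cscaleAr.
Qed.

Fact unitz_adjK : involutive unitz_adj.
Proof. by move=> [x k]; apply: unitz_eqP; rewrite /= ?starK ?conjCK. Qed.

Lemma opn_star u : opn (unitz_adj u * u) = opn u ^+ 2.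
Proof.
have H v : opn v ^+ 2 <= opn (unitz_adj v * v).
  have o0 := opn_ge0 (unitz_adj v * v).
  rewrite -(sqr_sqrtr o0) lerXn2r ?nnegrE ?opn_ge0 ?sqrtr_ge0//.
  apply: opn_le => a a1; rewrite -[cnorm _]ger0_norm ?cnorm_ge0//.
  rewrite -sqrtr_sqr ler_sqrt// -cnorm_star act_star.
  rewrite (le_trans (cnormM _ _))// cnorm_adj.
  have := opn_act (unitz_adj v * v) a; have := cnorm_ge0 a.
  have := cnorm_ge0 (act (unitz_adj v * v) a); nra.
have H2 v : opn v <= opn (unitz_adj v).
  have := le_trans (H v) (opnM _ _); rewrite expr2.
  have [->|v0] := eqVneq (opn v) 0; first by rewrite opn_ge0.
  by rewrite ler_pM2r// lt_def v0 opn_ge0.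
apply/eqP; rewrite eq_le H andbT (le_trans (opnM _ _))// expr2.
by rewrite ler_wpM2r ?opn_ge0// -{2}(unitz_adjK u) H2.
Qed.

(** The operator norm of left multiplication on A is only a seminorm if A has a unit e, since (- e,
    1) acts as 0. The maximum with the modulus of the scalar part is a C*-norm in all cases. *)
Definition unitz_nrm u : R := Num.max (opn u) (cabs u.2).

Definition unitz_im : unitz A := (0, 'i).

Fact unitz_adjD : {morph unitz_adj : u v / u + v}.
Proof. by move=> u v; apply: unitz_eqP; rewrite /= ?starD ?rmorphD. Qed.

Fact unitz_adjZ t u : unitz_adj (t *: u) = t *: unitz_adj u.
Proof.
by apply: unitz_eqP; rewrite /= ?starZ ?rmorphM/= conj_realC.
Qed.

Fact unitz_adjM u v : unitz_adj (u * v) = unitz_adj v * unitz_adj u.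
Proof.
apply: unitz_eqP; rewrite /= ?rmorphM 1?mulrC//.
by rewrite !starD !starM !starZ addrAC.
Qed.

Fact unitz_imC u : unitz_im * u = u * unitz_im.
Proof.
apply: unitz_eqP; rewrite /= 1?mulrC//.
by rewrite cmul0l cmul0r !scaler0 !add0r !addr0.
Qed.

Fact unitz_im_sqr : unitz_im * unitz_im = -1.
Proof.
apply: unitz_eqP; rewrite /= ?cmul0l ?scaler0 ?addr0 ?oppr0//.
by rewrite -expr2 sqr_i.
Qed.

Lemma conj_i : Num.conj ('i : R[i]) = - 'i.
Proof.
have i0 : ('i : R[i]) != 0 by rewrite eq_complex /= oner_eq0 andbF.
apply: (mulfI i0); rewrite -normCK mulrN -expr2 sqr_i opprK normc_def /=.
by rewrite expr0n/= expr1n add0r sqrtr1 expr1n.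
Qed.

Fact unitz_adj_im : unitz_adj unitz_im = - unitz_im.
Proof.
by apply: unitz_eqP; rewrite /= ?star0 ?oppr0// conj_i.
Qed.

Fact unitz_nrmD u v : unitz_nrm (u + v) <= unitz_nrm u + unitz_nrm v.
Proof.
rewrite {1}/unitz_nrm ge_max; apply/andP; split.
  apply: opn_le => a a1; rewrite actD (le_trans (cnormD _ _))//.
  by rewrite lerD// le_max opn_ub.
by rewrite (le_trans (cabsD _ _))// lerD// le_max lexx orbT.
Qed.

Fact unitz_nrmZ t u : unitz_nrm (t *: u) = `|t| * unitz_nrm u.
Proof.
have H s v : unitz_nrm (s *: v) <= `|s| * unitz_nrm v.
  rewrite {1}/unitz_nrm ge_max; apply/andP; split.
    apply: opn_le => a a1; rewrite act_scale cnormZ cabs_real.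
    by rewrite ler_wpM2l// le_max opn_ub.
  by rewrite /= cabsM cabs_real ler_wpM2l// le_max lexx orbT.
apply/eqP; rewrite eq_le H /=.
have [->|t0] := eqVneq t 0.
  by rewrite normr0 mul0r le_max opn_ge0.
have := H t^-1 (t *: u); rewrite scalerA mulVf// scale1r normfV.
by rewrite mulrC ler_pdivlMr ?normr_gt0// mulrC.
Qed.

Fact unitz_nrmM u v : unitz_nrm (u * v) <= unitz_nrm u * unitz_nrm v.
Proof.
rewrite {1}/unitz_nrm ge_max; apply/andP; split.
  by rewrite (le_trans (opnM _ _))// ler_pM ?opn_ge0// le_max lexx.
by rewrite /= cabsM ler_pM ?cabs_ge0// le_max lexx orbT.
Qed.

Fact unitz_nrm_star u : unitz_nrm (unitz_adj u * u) = unitz_nrm u ^+ 2.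
Proof.
rewrite /unitz_nrm opn_star /= cabsM cabs_conj -expr2.
have := opn_ge0 u; have := cabs_ge0 u.2.
by case: (leP (opn u)) => H k0 o0; case: leP => // H2; nra.
Qed.

Lemma opn_embed x : opn (x, 0) = cnorm x.
Proof.
apply/eqP; rewrite eq_le; apply/andP; split.
  apply: opn_le => a a1; rewrite /act /= scale0r addr0 (le_trans (cnormM _ _))//.
  by rewrite ler_piMr// cnorm_ge0.
have [->|x0] := eqVneq (cnorm x) 0; first exact: opn_ge0.
have {}x0 : 0 < cnorm x by rewrite lt_def x0 cnorm_ge0.
(* The adjoint of x, up to scaling, is a vector at which the supremum is attained. *)
rewrite -(ler_pM2r x0) -expr2 -(cnorm_adj x) -cnorm_star starK.
by have := opn_act (x, 0) x^star; rewrite /act /= scale0r addr0.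
Qed.

Lemma unitz_nrm_embed x : unitz_nrm (x, 0) = cnorm x.
Proof. by rewrite /unitz_nrm opn_embed /= cabs0 max_l// cnorm_ge0. Qed.

Lemma unitz_nrm_scalar k : unitz_nrm (0, k) = cabs k.
Proof.
rewrite /unitz_nrm /= max_r//; apply: opn_le => a a1.
by rewrite /act /= cmul0l add0r cnormZ ler_piMr// cabs_ge0.
Qed.

Lemma unitz_nrm_fst u : cnorm u.1 <= 2 * unitz_nrm u.
Proof.
have -> : cnorm u.1 = unitz_nrm (u + (-1 : R) *: ((0, u.2) : unitz A)).
  rewrite -unitz_nrm_embed; congr unitz_nrm; rewrite scaleN1r.
  by apply: unitz_eqP; rewrite /= ?subr0 ?subrr.
rewrite (le_trans (unitz_nrmD _ _))// unitz_nrmZ unitz_nrm_scalar.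
rewrite normrN normr1 mul1r mulr_natl mulr2n lerD2l.
by rewrite le_max lexx orbT.
Qed.

Fact unitz_nrm0_eq0 u : unitz_nrm u = 0 -> u = 0.
Proof.
move=> u0; apply: unitz_eqP => /=.
  apply: cnorm_eq0; apply/eqP; rewrite eq_le cnorm_ge0 andbT.
  by rewrite (le_trans (unitz_nrm_fst _))// u0 mulr0.
apply: cabs_eq0; apply/eqP; rewrite eq_le cabs_ge0 andbT.
by rewrite -u0 le_max lexx orbT.
Qed.

End UnitzNorm.

Lemma cauchy_seq_cvg (K : numFieldType) (V : completeNormedModType K)
    (s : nat -> V) :
  (forall e : K, 0 < e -> exists m, forall n, (m <= n)%N -> `|s m - s n| < e) ->
  exists l, forall e : K, 0 < e -> exists m, forall n, (m <= n)%N ->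
    `|s n - l| < e.
Proof.
move=> H; have : cvg (s @ \oo).
  apply: cauchy_cvg; apply: cauchy_exP => e /H[m Hm].
  exists (s m); exists m => // n /= mn.
  by rewrite -ball_normE; apply: Hm.
move=> /cvg_ex[l /= /cvgrPdist_lt sl]; exists l => e /sl[m _ Hm].
by exists m => n mn; rewrite distrC; apply: Hm.
Qed.

(** Telescope from an index m at which [b m] is within e of the supremum of [b]. *)
Lemma dominated_cauchy (R : realType) (N : nat -> nat -> R) (b : nat -> R) B :
  (forall n, N n n = 0) -> (forall m n p, N m p <= N m n + N n p) ->
  (forall n, N n n.+1 <= b n.+1 - b n) -> (forall n, b n <= B) ->
  forall e, 0 < e -> exists m, forall n, (m <= n)%N -> N m n < e.
Proof.
move=> N0 Ntri Nb bB e e0.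
have hs : has_sup (range b) by split; [exists (b 0%N), 0%N|exists B => _ [n _ <-]].
have [_ [m _ <-] hm] := sup_adherent e0 hs; exists m => n mn.
have H k : N m (m + k)%N <= b (m + k)%N - b m.
  elim: k => [|k IH]; first by rewrite addn0 N0 subrr.
  by have := Ntri m (m + k)%N (m + k.+1)%N; have := Nb (m + k)%N; rewrite addnS; lra.
have := H (n - m)%N; rewrite subnKC//.
have : b n <= sup (range b) by apply: sup_upper_bound => //; exists n.
by lra.
Qed.

Section UnitzComplete.
Context {R : realType} {A : cstarAlgType R}.

Lemma complex_gt0E (e : R[i]) : 0 < e -> e = (complex.Re e)%:C /\ 0 < complex.Re e.
Proof.
rewrite ltcE => /andP[/eqP i0 r0]; split => //.
by case: e i0 r0 => a b /= -> _.
Qed.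

Lemma dominated_cvg (s : nat -> A) (b : nat -> R) B :
  (forall n, cnorm (s n.+1 - s n) <= b n.+1 - b n) -> (forall n, b n <= B) ->
  exists l, forall e, 0 < e ->
    exists m, forall n, (m <= n)%N -> cnorm (s n - l) <= e.
Proof.
move=> sb bB.
have cN x : cnorm (- x) = cnorm (x : A) by rewrite /cnorm normrN.
have [|l hl] := @cauchy_seq_cvg _ A s.
  move=> e /complex_gt0E[-> e0].
  have [||||m hm] := @dominated_cauchy R (fun m n => cnorm (s m - s n)) b B _ _ _ _ _ e0.
  - by move=> n; rewrite subrr cnorm0.
  - move=> m n p; have -> : s m - s p = (s m - s n) + (s n - s p) by rewrite addrA subrK.
    exact: cnormD.
  - by move=> n; rewrite -cN opprB.
  - exact: bB.
  - by exists m => n /hm; rewrite norm_cnorm ltcR.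
exists l => e e0; have [|m hm] := hl e%:C; first by rewrite ltcR.
by exists m => n /hm; rewrite norm_cnorm ltcR => /ltW.
Qed.

Lemma dominated_cvg_real (s : nat -> R) (b : nat -> R) B :
  (forall n, `|s n.+1 - s n| <= b n.+1 - b n) -> (forall n, b n <= B) ->
  exists l, forall e, 0 < e ->
    exists m, forall n, (m <= n)%N -> `|s n - l| < e.
Proof.
move=> sb bB; apply: (@cauchy_seq_cvg R R) => e e0.
apply: (@dominated_cauchy R (fun m n => `|s m - s n|) b B) => //.
- by move=> n; rewrite subrr normr0.
- move=> m n p; have -> : s m - s p = (s m - s n) + (s n - s p) by ring.
  exact: ler_normD.
- by move=> n; rewrite distrC.
Qed.

Lemma cabs_le_ReIm (k : R[i]) : cabs k <= `|complex.Re k| + `|complex.Im k|.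
Proof.
rewrite {1}(complexE k) (le_trans (cabsD _ _))// cabsM !cabs_real.
by rewrite /cabs normc_def /= expr0n/= expr1n add0r sqrtr1 mul1r.
Qed.

Lemma Re_le_cabs (k : R[i]) : `|complex.Re k| <= cabs k.
Proof.
rewrite /cabs normc_def /= -sqrtr_sqr ler_sqrt ?lerDl ?sqr_ge0//.
by rewrite addr_ge0// sqr_ge0.
Qed.

Lemma Im_le_cabs (k : R[i]) : `|complex.Im k| <= cabs k.
Proof.
rewrite /cabs normc_def /= -sqrtr_sqr ler_sqrt ?lerDr ?sqr_ge0//.
by rewrite addr_ge0// sqr_ge0.
Qed.

Fact unitz_complete (s : nat -> unitz A) (b : nat -> R) B :
  (forall n, unitz_nrm (s n.+1 - s n) <= b n.+1 - b n) ->
  (forall n, b n <= B) ->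
  exists l, forall e, 0 < e ->
    exists m, forall n, (m <= n)%N -> unitz_nrm (s n - l) <= e.
Proof.
move=> sb bB.
have [||x hx] := @dominated_cvg (fun n => (s n).1) (fun n => 2 * b n) (2 * B).
- by move=> n; have := unitz_nrm_fst (s n.+1 - s n); have := sb n; rewrite /=; lra.
- by move=> n; rewrite ler_pM2l.
have kb n : cabs (s n.+1 - s n).2 <= b n.+1 - b n.
  by rewrite (le_trans _ (sb n))// le_max lexx orbT.
have ReB (k l : R[i]) : complex.Re (k - l) = complex.Re k - complex.Re l.
  by case: k l => ? ? [].
have ImB (k l : R[i]) : complex.Im (k - l) = complex.Im k - complex.Im l.
  by case: k l => ? ? [].
have [|p hp] := @dominated_cvg_real (fun n => complex.Re (s n).2) b B _ bB.
  by move=> n; rewrite -ReB (le_trans (Re_le_cabs _))//; apply: kb.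
have [|q hq] := @dominated_cvg_real (fun n => complex.Im (s n).2) b B _ bB.
  by move=> n; rewrite -ImB (le_trans (Im_le_cabs _))//; apply: kb.
exists (x, Complex p q) => e e0; have e3 : 0 < e / 3 by rewrite divr_gt0.
have [m1 {}hx] := hx _ e3; have [m2 {}hp] := hp _ e3; have [m3 {}hq] := hq _ e3.
exists (maxn m1 (maxn m2 m3)) => n; rewrite !geq_max => /and3P[n1 n2 n3].
have -> : s n - (x, Complex p q) =
    ((s n).1 - x, 0) + (0, (s n).2 - Complex p q) :> unitz A.
  by apply: unitz_eqP; rewrite /= ?addr0 ?add0r.
rewrite (le_trans (unitz_nrmD _ _))// unitz_nrm_embed unitz_nrm_scalar.
have := cabs_le_ReIm ((s n).2 - Complex p q); rewrite ReB ImB /=.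
by have := hx n n1; have := hp n n2; have := hq n n3; lra.
Qed.

HB.instance Definition _ := Algebra_isUnitalCStar.Build R (unitz A)
  unitz_adjK unitz_adjD unitz_adjZ unitz_adjM unitz_imC unitz_im_sqr
  unitz_adj_im unitz_nrmD unitz_nrmZ unitz_nrmM unitz_nrm_star unitz_nrm0_eq0
  unitz_complete.

End UnitzComplete.

(** * The algebra inside its unitization *)

Section Embedding.
Context {R : realType} {A : cstarAlgType R}.
Implicit Types (u v w : unitz A) (a b c x y : A) (k l : R[i]) (t : R).

Definition emb a : unitz A := (a, 0).

Lemma emb_inj : injective emb.
Proof. by move=> a b []. Qed.

Lemma embP u : u.2 = 0 -> emb u.1 = u.
Proof. by case: u => x k /= ->. Qed.

Lemma embD a b : emb (a + b) = emb a + emb b.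
Proof. by apply: unitz_eqP; rewrite /= ?addr0. Qed.

Lemma embN a : emb (- a) = - emb a.
Proof. by apply: unitz_eqP; rewrite /= ?oppr0. Qed.

Lemma embB a b : emb (a - b) = emb a - emb b.
Proof. by rewrite embD embN. Qed.

Lemma embM a b : emb (a ** b) = emb a * emb b.
Proof. by apply: unitz_eqP; rewrite /= ?scale0r ?addr0 ?mulr0. Qed.

Lemma embZ t a : emb (t%:C *: a) = t *: emb a.
Proof. by apply: unitz_eqP; rewrite /= ?mulr0. Qed.

Lemma adj_emb a : adj (emb a) = emb (a^star).
Proof. by apply: unitz_eqP => //; apply: conjC0. Qed.

Lemma nrm_emb a : nrm (emb a) = cnorm a.
Proof. exact: unitz_nrm_embed. Qed.

Lemma snd_nrm u : cabs u.2 <= nrm u.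
Proof. by rewrite /nrm /= /unitz_nrm le_max lexx orbT. Qed.

Lemma pos_snd_ge0 u : pos u -> exists2 t, 0 <= t & u.2 = t%:C.
Proof.
move=> pu; have /(congr1 snd)/= su := pos_sa pu; case: pu => _ [t ht].
have /complex_realP[r uE] : u.2 \is Num.real by rewrite CrealE; apply/eqP.
exists r => //; have := le_trans (snd_nrm _) ht.
rewrite /= uE mulr1 -rmorphB/= cabs_real => H.
by have := ler_norm (t - r); lra.
Qed.

Lemma pairA t x : t%:A + emb x = (x, t%:C).
Proof. by apply: unitz_eqP; rewrite /= ?scaler0 ?add0r ?mulr1 ?addr0. Qed.

Lemma identity_mulBl e x l z : is_identity e ->
  (l *: e - x) ** z = l *: z - x ** z.
Proof. by move=> ide; rewrite cmulDl cmulNl -cscaleAl (ide z).1. Qed.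

Lemma identity_mulBr e x l z : is_identity e ->
  z ** (l *: e - x) = l *: z - z ** x.
Proof. by move=> ide; rewrite cmulDr cmulNr -cscaleAr (ide z).2. Qed.

(** On the complement 1 - e the element acts as the scalar l, so the inverse in the unitization is y
    + l^-1 (1 - e). *)
Lemma unital_unitz_inv e x l : is_identity e -> l != 0 ->
  invertible_wrt e (l *: e - x) -> unitization_invertible (- x, l).
Proof.
move=> ide l0 [y [xy yx]]; pose z := y - l^-1 *: e; exists (z, l^-1).
have lz : l^-1 *: (l *: e - x) = e - l^-1 *: x.
  by rewrite scalerBr scalerA mulVf// scale1r.
rewrite /unitization_mul /= divff// mulVf//; split; congr pair.
  rewrite cmulNl addrAC [- _ + _]addrC -(identity_mulBl _ _ _ ide).
  rewrite /z cmulDr cmulNr xy -cscaleAr (ide _).2 lz.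
  by rewrite opprB addrCA subrr addr0 scalerN subrr.
rewrite cmulNr [- _ + _]addrC -(identity_mulBr _ _ _ ide).
rewrite /z cmulDl cmulNl yx -cscaleAl (ide _).1 lz.
by rewrite opprB addrCA subrr addr0 scalerN subrr.
Qed.

Lemma unitz_unital_inv e x l : is_identity e ->
  unitization_invertible (- x, l) -> invertible_wrt e (l *: e - x).
Proof.
move=> ide [[y m] [[h1 h2] [h3 h4]]]; exists (y + m *: e).
rewrite (identity_mulBl _ _ _ ide) (identity_mulBr _ _ _ ide).
rewrite cmulDr cmulDl -cscaleAl -cscaleAr (ide _).1 (ide _).2 scalerDr scalerA.
rewrite h2 scale1r; split.
  rewrite -[RHS]addr0 -h1 cmulNl scalerN opprD.
  by rewrite (AC (2*2) (2*(3*4*1))).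
rewrite -[RHS]addr0 -h3 cmulNr scalerN opprD.
by rewrite (AC (2*2) (2*(3*1*4))).
Qed.

(** If the spectrum is nonnegative, then t + x is invertible for t > 0 and [pos_of_inv] applies.
    Conversely let l = r + i s be off the half-line and h = r - x. If s = 0 then r < 0 and - r + x
    is invertible; otherwise (h - i s) (h + i s) = h^2 + s^2 is. *)
Lemma positiveP x : positive x <-> pos (emb x).
Proof.
split=> [[x1 sp]|px].
  apply: pos_of_inv; first by rewrite adj_emb x1.
  move=> t t0; have l0 : ~ 0 <= - t%:C :> R[i].
    by rewrite oppr_ge0 lecR leNgt t0.
  have [v [vE _]] : unitization_invertible (- x, - t%:C).
    have [[e ide]|nu] := pselect (@unital R A).
      apply: (@unital_unitz_inv e) => //.
        by rewrite oppr_eq0; apply/eqP => /complexI tz; rewrite tz ltxx in t0.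
      apply: contrapT => ni; apply/l0/sp; left; by exists e.
    by apply: contrapT => ni; apply/l0/sp; right.
  exists (- v : unitz A); rewrite pairA.
  have -> : (x, t%:C) = - (- x, - t%:C) :> unitz A.
    by apply: unitz_eqP; rewrite /= opprK.
  by rewrite mulrNN.
split; first by apply: emb_inj; rewrite -adj_emb (pos_sa px).
move=> l; apply: contraPT => nl.
suff li : unitization_invertible (- x, l).
  by case=> [[e ide]|[_]]; apply=> //; apply: unitz_unital_inv.
pose r := complex.Re l; pose i := complex.Im l.
pose h := r%:A - emb x; pose w := h - i *: im; pose z := h + i *: im.
have zE : (- x, l) = z.
  apply: unitz_eqP; rewrite /= ?scaler0 ?add0r ?addr0//.
  by rewrite mulr1 oppr0 addr0 {1}(complexE l) mulrC.
suff [v [v1 v2]] : exists v, z * v = 1 /\ v * z = 1 by exists v; rewrite zE.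
have h1 : adj h = h by rewrite adjB adjA (pos_sa px).
have him : im * h = h * im by apply: imC.
have wz : w * z = z * w by rewrite /w /z; cring.
have [i0|i0] := eqVneq i 0.
  have r0 : 0 < - r by move: nl; rewrite lecE -/i i0 eqxx /= -ltNge; lra.
  have [y [y1 y2 _]] := pos_inv px r0; exists (- y).
  have -> : z = - ((- r)%:A + emb x) by rewrite /z /h i0 scale0r; ncring.
  by rewrite !mulrNN.
have i2 : 0 < i ^+ 2 by rewrite lt_def sqrf_eq0 i0 sqr_ge0.
have [y [y1 y2 _]] := pos_inv (pos_sq h1) i2.
have E : w * z = (i ^+ 2)%:A + h * h.
  transitivity (h * h - (i ^+ 2) *: (im * im)); first by rewrite /w /z; cring.
  by rewrite im_sqr scalerN opprK addrC.
have zwy : z * (w * y) = 1 by rewrite mulrA -wz E.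
have ywz : (y * w) * z = 1 by rewrite -mulrA E.
exists (w * y); split => //.
have -> : w * y = y * w by rewrite -[LHS]mul1r -ywz -[y * w * z * _]mulrA zwy mulr1.
by [].
Qed.

Lemma posballP a : posball a <-> pos (emb a) /\ pos (1 - emb a).
Proof.
rewrite /posball /= positiveP -nrm_emb; split=> -[pa H]; split => //.
  exact: nrm_contr.
exact: contr_nrm.
Qed.

Lemma cleP a b : cle a b <-> pos (emb b - emb a).
Proof. by rewrite /cle positiveP embB. Qed.

Lemma llP a b : ll a b <-> emb a * (1 - emb b) = 0.
Proof.
rewrite /ll mulrBr mulr1 -embM -embB; split=> [H|/emb_inj/eqP].
  by rewrite -H subrr.
by rewrite subr_eq0 => /eqP.
Qed.

(** The root taken in the unitization lies in A because its scalar part has square 0; uniqueness of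
    positive roots identifies it with the one chosen in A. *)
Lemma csqrtP a : pos (emb a) -> emb (csqrt a) = usqrt (emb a).
Proof.
move=> pa; have [ps ss] := usqrtP pa.
have s2 : (usqrt (emb a)).2 = 0.
  by move/(congr1 snd): ss => /= /eqP; rewrite mulf_eq0 orbb => /eqP.
have [|/positiveP py yy] := @xgetPex _ 0 [set y | positive y /\ y ** y = a].
  exists (usqrt (emb a)).1; split.
    by apply/positiveP; rewrite embP.
  by apply: emb_inj; rewrite embM embP.
by apply/esym/usqrtE => //; rewrite -embM yy.
Qed.

Lemma pospartP a : adj (emb a) = emb a -> emb (pospart a) = upos (emb a).
Proof.
move=> a1; rewrite /pospart.
have -> : 2%:R^-1 = (2^-1)%:C :> R[i] by rewrite fmorphV rmorphMn.
rewrite embZ embD csqrtP ?embM//; exact: pos_sq.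
Qed.

Lemma odotP a b : pos (emb a) ->
  emb (odot a b) = usqrt (emb a) * emb b * usqrt (emb a).
Proof. by move=> pa; rewrite /odot !embM csqrtP. Qed.

Lemma dfunP a b : dfun a b = (nrm (emb a * (1 - emb b)))%:E.
Proof. by rewrite /dfun -nrm_emb embB embM mulrBr mulr1. Qed.

Lemma hfunP a b : adj (emb a) = emb a -> adj (emb b) = emb b ->
  hfun a b = (nrm (upos (emb a - emb b)))%:E.
Proof.
move=> a1 b1; rewrite /hfun -nrm_emb pospartP ?embB//.
by rewrite adjB a1 b1.
Qed.

Lemma ereal_inf0P (S : set (\bar R)) : (forall x : \bar R, S x -> 0 <= x)%E ->
  ereal_inf S = 0%E <-> forall e, 0 < e -> exists2 x : \bar R, S x & (x < e%:E)%E.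
Proof.
move=> S0; split=> [S1 e e0|H].
  have /ereal_inf_lt[x Sx xe] : (ereal_inf S < e%:E)%E by rewrite S1 lte_fin.
  by exists x.
apply/eqP; rewrite eq_le; apply/andP; split; last first.
  by apply: le_ereal_inf_tmp => x /S0.
apply/lee_addgt0Pr => e /H[x Sx /ltW xe]; rewrite add0e.
exact: le_trans (ereal_inf_lbound Sx) xe.
Qed.

Lemma closureP (Y : set A) a :
  closure Y a <-> forall e, 0 < e -> exists2 y, Y y & cnorm (a - y) < e.
Proof.
split=> [cY e e0|H B].
  have [|y [Yy]] := cY (ball a e%:C); first by apply: nbhsx_ballx; rewrite ltcR.
  by rewrite -ball_normE /= norm_cnorm ltcR; exists y.
move=> /nbhs_ballP[e /= /complex_gt0E[-> e0] eB].
have [y Yy ay] := H _ e0; exists y; split => //; apply: eB.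
by rewrite -ball_normE /= norm_cnorm ltcR.
Qed.

End Embedding.

(** * The order interval [0, 1] *)

Section UnitInterval.
Context {R : realType} {U : ucstarType R}.
Implicit Types (a b c e u v x y z : U) (t d : R).

Definition ui a := pos a /\ pos (1 - a).

Lemma ui_sa a : ui a -> adj a = a.
Proof. by case=> /pos_sa. Qed.

Lemma ui_nrm a : ui a -> nrm a <= 1.
Proof. by case; apply: contr_nrm. Qed.

Lemma uiC a : ui a -> ui (1 - a).
Proof. by case=> pa p1a; split => //; rewrite opprB addrCA subrr addr0. Qed.

Lemma ui1 : ui 1.
Proof. by split; [apply: pos1|rewrite subrr; apply: pos0]. Qed.

Lemma uiP a : ui a <-> [/\ adj a = a, nrm a <= 1 & nrm (1 - a) <= 1].
Proof.
split=> [ua|[a1 na n1a]].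
  by split; [exact: ui_sa|exact: ui_nrm|apply: ui_nrm; apply: uiC].
split; split; rewrite ?adjB ?adj1 ?a1//; exists 1; rewrite scale1r//.
by rewrite opprB addrCA subrr addr0.
Qed.

Lemma ui_closed b : (forall d, 0 < d -> exists2 a, ui a & nrm (b - a) < d) -> ui b.
Proof.
move=> H; apply/uiP; split.
- apply/eqP; rewrite -subr_eq0; apply/eqP; apply: (@nrm_eps0 _ _ _ 2) => d.
  move=> /H[a /ui_sa a1 /ltW ab].
  have -> : adj b - b = adj (b - a) - (b - a) by rewrite adjB a1; ncring.
  by have := nrmB (adj (b - a)) (b - a); rewrite nrm_adj; lra.
- apply/ler_addgt0Pr => d /H[a /ui_nrm a1 /ltW ab].
  by have := nrmD (b - a) a; rewrite subrK; lra.
- apply/ler_addgt0Pr => d /H[a /uiC /ui_nrm a1 /ltW ab].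
  by have := nrm_tri a 1 b; rewrite (nrm_distC a b); lra.
Qed.

Lemma ui_conj c b : ui c -> ui b -> ui (c * b * c).
Proof.
move=> uc [pb p1b]; have c1 := ui_sa uc; split; first exact: conj_sa.
have -> : 1 - c * b * c = c * (1 - b) * c + (1 - c * c) by ncring.
apply: posD; first exact: conj_sa.
have -> : 1 - c * c = (1 - c) + (c - c * c) by ncring.
by case: uc => pc p1c; apply: posD => //; apply: contr_sq.
Qed.

Lemma uiM a b : ui a -> ui b -> a * b = b * a -> ui (a * b).
Proof.
move=> [pa p1a] [pb p1b] ab; split; first exact: posM.
have -> : 1 - a * b = (1 - a) + a * (1 - b) by ncring.
by apply: posD => //; apply: posM => //; cring.
Qed.

Lemma uiX a n : ui a -> ui (a ^+ n).
Proof.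
move=> ua; elim: n => [|n IH]; first by rewrite expr0; apply: ui1.
by rewrite exprS; apply: uiM => //; rewrite -exprS exprSr.
Qed.

Lemma ui_conv a b t : 0 <= t <= 1 -> ui a -> ui b -> ui (t *: a + (1 - t) *: b).
Proof.
move=> /andP[t0 t1] [pa p1a] [pb p1b]; have t1' : 0 <= 1 - t by lra.
split; first by apply: posD; apply: posZ.
have -> : 1 - (t *: a + (1 - t) *: b) = t *: (1 - a) + (1 - t) *: (1 - b) by ncring.
by apply: posD; apply: posZ.
Qed.

Lemma ui_sqrt a : ui a -> ui (usqrt a).
Proof.
move=> [pa p1a]; have ps := usqrt_pos pa; split => //; apply: nrm_contr => //.
rewrite -(@expr_le1 _ 2) ?nrm_ge0// -nrm_sa ?pos_sa//.
by rewrite usqrt_sq// contr_nrm.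
Qed.

Lemma near_le e a b : ui b -> pos (b - a) ->
  nrm (e * (1 - b)) ^+ 2 <= nrm (e * (1 - a) * adj e).
Proof.
move=> /uiC[p1b pb] pba; apply: le_trans (nrm_contr_sq _ p1b pb) _.
apply: nrm_conj_le => //.
by have -> : 1 - a - (1 - b) = b - a by ncring.
Qed.

Lemma near_le1 e a b : nrm e <= 1 -> ui b -> pos (b - a) ->
  nrm (e * (1 - b)) ^+ 2 <= nrm (e * (1 - a)).
Proof.
move=> e1 ub pba; apply: le_trans (near_le _ ub pba) _.
by rewrite (le_trans (nrmM _ _))// nrm_adj ler_piMr// nrm_ge0.
Qed.

Lemma near_mul e x y : nrm y <= 1 ->
  nrm (e * (1 - x * y)) <= nrm (e * (1 - x)) + nrm (e * (1 - y)).
Proof.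
move=> y1; have -> : e * (1 - x * y) = e * (1 - x) * y + e * (1 - y) by ncring.
rewrite (le_trans (nrmD _ _))// lerD2r (le_trans (nrmM _ _))//.
by rewrite ler_piMr// nrm_ge0.
Qed.

Lemma near_close e a b : nrm e <= 1 ->
  nrm (e * (1 - b)) <= nrm (e * (1 - a)) + nrm (b - a).
Proof.
move=> e1; have -> : e * (1 - b) = e * (1 - a) - e * (b - a) by ncring.
rewrite (le_trans (nrmB _ _))// lerD2l (le_trans (nrmM _ _))//.
by rewrite ler_piMl// nrm_ge0.
Qed.

Lemma near_trans e c b : nrm (1 - b) <= 1 -> nrm e <= 1 ->
  nrm (e * (1 - b)) <= nrm (e * (1 - c)) + nrm (c * (1 - b)).
Proof.
move=> b1 e1.
have -> : e * (1 - b) = e * (1 - c) * (1 - b) + e * (c * (1 - b)) by ncring.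
have := nrmD (e * (1 - c) * (1 - b)) (e * (c * (1 - b))).
have := nrmM_le (lexx (nrm (e * (1 - c)))) b1.
have := nrmM_le e1 (lexx (nrm (c * (1 - b)))).
by lra.
Qed.

Lemma near_close_l c c' b : nrm (1 - b) <= 1 ->
  nrm (c' * (1 - b)) <= nrm (c * (1 - b)) + nrm (c' - c).
Proof.
move=> b1; have -> : c' * (1 - b) = c * (1 - b) + (c' - c) * (1 - b) by ncring.
rewrite (le_trans (nrmD _ _))// lerD2l (le_trans (nrmM _ _))//.
by rewrite ler_piMr// nrm_ge0.
Qed.

Definition hull c b := 1 - (1 - c) * (1 - b) * (1 - c).

Lemma hull_ui c b : ui c -> ui b -> ui (hull c b).
Proof. by move=> uc ub; apply: uiC; apply: ui_conj; apply: uiC. Qed.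

Lemma hull_ge c b : ui c -> ui b -> pos (hull c b - c).
Proof.
move=> uc [pb _].
have -> : hull c b - c = (c - c * c) + (1 - c) * b * (1 - c) by rewrite /hull; ncring.
apply: posD; first by case: uc => ? ?; apply: contr_sq.
by apply: conj_sa => //; apply: ui_sa; apply: uiC.
Qed.

Lemma nrm_mulC a b : adj a = a -> adj b = b -> nrm (a * b) = nrm (b * a).
Proof. by move=> a1 b1; rewrite -nrm_adj adjM a1 b1. Qed.

Lemma hull_near c b : ui c -> ui b -> nrm (hull c b - b) <= 2 * nrm (c * (1 - b)).
Proof.
move=> uc ub; have -> : hull c b - b = c * (1 - b) + (1 - c) * ((1 - b) * c).
  by rewrite /hull; ncring.
have := nrmD (c * (1 - b)) ((1 - c) * ((1 - b) * c)).
have := nrmM_le (ui_nrm (uiC uc)) (lexx (nrm ((1 - b) * c))).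
by rewrite (nrm_mulC _ (ui_sa uc)) ?ui_sa//; [lra|apply: uiC].
Qed.

(** x^n (1 - x) is small, and replacing x by a >= x costs a square. All large n are covered because
    the applications only have special exponents: powers of 2 when F is closed under squares,
    successors for nonempty products. *)
Lemma pow_near x a d : ui x -> ui a -> pos (a - x) -> 0 < d ->
  exists m, forall n, (m <= n)%N -> nrm (x ^+ n * (1 - a)) < d.
Proof.
move=> ux ua pax d0; have d2 : 0 < d ^+ 2 by rewrite exprn_gt0.
have [px p1x] := ux; have [m hm] := pos_pow_small px p1x d2.
exists m => n /hm H; rewrite -(@ltr_pXn2r _ 2) ?nnegrE ?nrm_ge0 ?ltW//.
by apply: le_lt_trans (near_le1 _ ua pax) H; apply: ui_nrm; apply: uiX.
Qed.

(* If [e] is a high power of [x = a b a] then [e a] is close to [e], so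
   [e b e] is close to [e x e], hence to [e^2]. *)
Lemma pow_near2 a b d : ui a -> ui b -> 0 < d -> exists m, forall n, (m <= n)%N ->
  nrm ((a * b * a) ^+ n * (1 - a)) < d /\ nrm ((a * b * a) ^+ n * (1 - b)) < d.
Proof.
move=> ua ub d0; set x := a * b * a.
have ux : ui x by apply: ui_conj.
have ax : pos (a - x).
  have -> : a - x = (a - a * a) + a * (1 - b) * a by rewrite /x; ncring.
  apply: posD; first by case: ua => ? ?; apply: contr_sq.
  by apply: conj_sa; [apply: ui_sa|case: ub].
have xx : pos (x - x) by rewrite subrr; apply: pos0.
have d3 : 0 < d ^+ 2 / 3 by rewrite divr_gt0// exprn_gt0.
have [m1 h1] := pow_near ux ua ax d3.
have [m2 h2] := pow_near ux ux xx d3.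
have [m3 h3] := pow_near ux ua ax d0.
exists (maxn m1 (maxn m2 m3)) => n; rewrite !geq_max => /and3P[n1 n2 n3].
split; first exact: h3.
have {h1 n1} := h1 _ n1; have {h2 n2} := h2 _ n2.
have := uiX n ux; set e := x ^+ n => ue H2 H1.
rewrite -(@ltr_pXn2r _ 2) ?nnegrE ?nrm_ge0 ?ltW//.
have ub' := uiC ub; case: (ub') => pb' p1b'.
apply: le_lt_trans (nrm_contr_sq e pb' p1b') _; rewrite (ui_sa ue).
have -> : e * (1 - b) * e = e * (1 - x) * e - e * (1 - a) * (b * e)
   - e * (a * b) * ((1 - a) * e) by rewrite /x; ncring.
have e1 := ui_nrm ue; have a1 := ui_nrm ua; have b1 := ui_nrm ub.
have N1 := nrmM_le (lexx (nrm (e * (1 - x)))) e1.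
have N2 := nrmM_le (lexx (nrm (e * (1 - a)))) (nrmM_le b1 e1).
have N3 := nrmM_le (nrmM_le e1 (nrmM_le a1 b1)) (lexx (nrm ((1 - a) * e))).
have N4 : nrm ((1 - a) * e) = nrm (e * (1 - a)).
  by apply: nrm_mulC; apply: ui_sa => //; apply: uiC.
rewrite N4 in N3.
have := nrmB (e * (1 - x) * e - e * (1 - a) * (b * e)) (e * (a * b) * ((1 - a) * e)).
have := nrmB (e * (1 - x) * e) (e * (1 - a) * (b * e)).
have := nrm_ge0 (e * (1 - a)); lra.
Qed.

(** Both t (1 - a) and (1 - t) (1 - b) are positive with sum 1 - s, so t (1 - a) <= 1 - s; compress
    by e. *)
Lemma near_conv e a b t : 0 < t < 1 -> ui a -> ui b -> nrm e <= 1 ->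
  t * nrm (e * (1 - a)) ^+ 2 <= nrm (e * (1 - (t *: a + (1 - t) *: b))).
Proof.
move=> /andP[t0 t1] ua ub e1; have [pa p1a] := uiC ua.
set s := t *: a + _.
have us : ui s by rewrite /s; apply: ui_conv => //; rewrite !ltW.
apply: (@le_trans _ _ (nrm (e * (1 - s) * adj e))); last first.
  by rewrite (le_trans (nrmM _ _))// nrm_adj ler_piMr// nrm_ge0.
apply: (@le_trans _ _ (t * nrm (e * (1 - a) * adj e))).
  by rewrite ler_pM2l// nrm_contr_sq.
rewrite -{1}(gtr0_norm t0) -nrmZ scalerAl scalerAr.
apply: nrm_conj_le; first by apply: posZ => //; apply: ltW.
have -> : 1 - s - t *: (1 - a) = (1 - t) *: (1 - b) by rewrite /s; ncring.
by apply: posZ; [lra|case: (uiC ub)].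
Qed.

Lemma near_conv_le e a b t : 0 < t < 1 ->
  nrm (e * (1 - (t *: a + (1 - t) *: b))) <=
  nrm (e * (1 - a)) + nrm (e * (1 - b)).
Proof.
move=> /andP[t0 t1].
have -> : e * (1 - (t *: a + (1 - t) *: b)) =
  t *: (e * (1 - a)) + (1 - t) *: (e * (1 - b)) by ncring.
rewrite (le_trans (nrmD _ _))// !nrmZ !gtr0_norm ?subr_gt0//.
have := nrm_ge0 (e * (1 - a)); have := nrm_ge0 (e * (1 - b)); nra.
Qed.

(** ** Separating an element from its spectrum below [1 - t] *)

(* With p and n the positive and negative parts of y - (1 - t), these are
   k = p / t and c = 1 - n / (1 - t), so that k = k c. *)
Lemma spectral_cut y t : 0 < t < 1 -> ui y -> exists c k,
  [/\ ui c, ui k, k * (1 - c) = 0 & nrm (c - y) <= 2 * t / (1 - t)] /\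
  [/\ c = (1 - t)^-1 *: (y - t *: k), (t *: k) * (y - (1 - t)%:A) = (t *: k) * (t *: k),
    forall e, nrm (e * (1 - k)) <= 2 / t * nrm (e * (1 - y)) &
    forall w, y * w = 0 -> c * w = 0].
Proof.
move=> /andP[t0 t1] [py p1y]; have s0 : 0 < 1 - t by rewrite subr_gt0.
have y1 := pos_sa py.
have h1 : adj (y - (1 - t)%:A) = y - (1 - t)%:A by rewrite adjB adjA y1.
have [p [n [pp pn pn0 np0 hE]]] := pos_decomp h1.
have [p1 n1] := (pos_sa pp, pos_sa pn).
have yE : y = (1 - t)%:A + p - n by rewrite -addrA -hE; ncring.
(* Compressing y >= 0 by n kills p and leaves (1 - t) n^2 - n^3 >= 0; for p below, 1 - y is
   compressed in the same way. *)
have nn : nrm n <= 1 - t.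
  apply: pos_cube_le => //; first exact: ltW.
  have -> : (1 - t) *: (n * n) - n * n * n = n * y * n - n * p * n.
    by rewrite yE; ncring.
  by rewrite np0 mul0r subr0; apply: conj_sa.
have npt : nrm p <= t.
  apply: pos_cube_le => //; first exact: ltW.
  have -> : t *: (p * p) - p * p * p = p * (1 - y) * p - p * n * p.
    by rewrite yE; ncring.
  by rewrite pn0 mul0r subr0; apply: conj_sa.
have rescale r x : 0 < r -> pos x -> nrm x <= r -> ui (r^-1 *: x).
  move=> r0 px xr; have prx : pos (r^-1 *: x) by apply: posZ; rewrite ?invr_ge0 ?ltW.
  by split => //; apply: nrm_contr => //; apply: nrm_rescale.
pose k := t^-1 *: p; pose c := 1 - (1 - t)^-1 *: n.
have tk : t *: k = p by rewrite scalerA mulfV ?gt_eqF// scale1r.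
have cE : c = (1 - t)^-1 *: (y - p).
  rewrite yE /c (_ : _ - p = (1 - t)%:A - n); last by ncring.
  by rewrite scalerBr scalerA mulVf ?gt_eqF// scale1r.
exists c, k; split; split.
- by apply: uiC; apply: rescale.
- exact: rescale.
- by rewrite /c opprB addrCA subrr addr0 -scalerAl -scalerAr pn0 !scaler0.
- have -> : c - y = (1 - t)^-1 *: (t *: y - p).
    have sE : y = (1 - t)^-1 *: ((1 - t) *: y).
      by rewrite scalerA mulVf ?gt_eqF// scale1r.
    by rewrite cE [X in _ - X = _]sE -scalerBr; congr (_ *: _); ncring.
  rewrite nrmZ gtr0_norm ?invr_gt0// mulrC ler_pM2r ?invr_gt0//.
  have := nrmB (t *: y) p; rewrite nrmZ gtr0_norm//.
  by have := contr_nrm py p1y; nra.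
- by rewrite tk.
- by rewrite tk hE mulrBr pn0 subr0.
(* Here t (1 - k) = t - p = (1 - y) - n. Moreover |e n| <= |e (1 - y)|, because p n = 0 gives (1 -
   y)^2 = (t - p)^2 + 2 t n + n^2. *)
- move=> e; have -> : e * (1 - k) = t^-1 *: (e * (1 - y) - e * n).
    rewrite -mulrBr scalerAr; congr (_ * _).
    rewrite yE (_ : 1 - _ - n = t%:A - p); last by ncring.
    by rewrite scalerBr scalerA mulVf ?gt_eqF// scale1r.
  rewrite nrmZ gtr0_norm ?invr_gt0// [2 / t]mulrC -mulrA ler_pM2l ?invr_gt0//.
  rewrite (le_trans (nrmB _ _))// mulr_natl mulr2n lerD2l.
  rewrite -(@ler_pXn2r _ 2) ?nnegrE ?nrm_ge0// -!nrm_starr !adjM n1 adjB adj1 y1.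
  rewrite !mulrA -[e * n * n]mulrA -[e * (1 - y) * (1 - y)]mulrA.
  apply: nrm_conj_le; first exact: pos_sq.
  have -> : (1 - y) * (1 - y) - n * n =
    (t%:A - p) * (t%:A - p) + (2 * t) *: n - p * n - n * p by rewrite yE; ncring.
  rewrite pn0 np0 !subr0; apply: posD; last by apply: posZ => //; lra.
  by apply: pos_sq; rewrite adjB adjA p1.
(* Multiplying y w = 0 by p shows that v = p w satisfies p v = - (1 - t) v, a negative eigenvalue of
   p >= 0; hence v = 0. *)
- move=> w yw; rewrite cE -scalerAl mulrBl yw sub0r.
  pose v := p * w.
  have pv : p * v = - ((1 - t) *: v).
    rewrite /v mulrA -[p * p]subr0 -pn0 -mulrBr -hE.
    by rewrite mulrBr mulrBl -mulrA yw; ncring.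
  suff -> : p * w = 0 by rewrite oppr0 scaler0.
  rewrite -/v; apply: nrm0_eq0; apply/eqP.
  rewrite -[_ == _](@sqrf_eq0 R) -nrm_star; apply/eqP.
  have pvv := star_pos v.
  have : pos (- ((1 - t) *: (adj v * v))).
    by rewrite scalerAr -mulrN -pv mulrA; apply: conj_pos.
  move=> H; have /pos_anti : pos ((1 - t) *: (adj v * v)).
    by apply: posZ => //; apply: ltW.
  move=> /(_ H)/eqP; rewrite scaler_eq0 gt_eqF//= => /eqP ->; exact: nrm0.
Qed.

(** ** Lower bounds of two invertible elements *)

Definition bounded_below z := exists2 t, 0 < t & pos (z - t%:A).

(* The witness is (z1^-1 + z2^-1 - 1)^-1. *)
Lemma ui_meet z1 z2 : ui z1 -> ui z2 -> bounded_below z1 -> bounded_below z2 ->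
  exists z, [/\ ui z, bounded_below z, pos (z1 - z), pos (z2 - z) &
    exists C, forall e, nrm (e * (1 - z)) <=
      C * (nrm (e * (1 - z1)) + nrm (e * (1 - z2)))].
Proof.
move=> u1 u2 [t1 t10 b1] [t2 t20 b2].
have inv x t : ui x -> 0 < t -> pos (x - t%:A) ->
    exists y, [/\ x * y = 1, y * x = 1, pos y & pos (y - 1)].
  move=> ux t0 bx; have [y] := pos_inv bx t0.
  rewrite addrC subrK => -[xy yx py]; exists y; split => //.
  have -> : y - 1 = y * (1 - x) by rewrite mulrBr mulr1 yx.
  by apply: posM => //; [case: (uiC ux)|rewrite mulrBr mulrBl xy yx mulr1 mul1r].
have [y1 [zy1 yz1 py1 q1]] := inv _ _ u1 t10 b1.
have [y2 [zy2 yz2 py2 q2]] := inv _ _ u2 t20 b2.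
have [z [wz zw pz]] := pos_inv (posD q1 q2) ltr01.
set w := _ + _ in wz zw.
have wE : w = y1 + y2 - 1 by rewrite /w; ncring.
have pw : pos w by rewrite /w; apply: posD; [apply: posA|apply: posD].
(* Inversion reverses the order: w = x^-1 + q with q >= 0 gives z <= x, by x - z = z q z +
   [adj (q * z)] x (q z). *)
have below x y q : pos x -> y * x = 1 -> x * y = 1 -> pos q -> w = y + q ->
    pos (x - z).
  move=> px yx xy pq wq; have z1' := pos_sa pz.
  have E1 : x - z = z * q * x.
    have -> : q = w - y by rewrite wq addrC addKr.
    by rewrite mulrBr mulrBl zw mul1r -mulrA yx mulr1.
  have E2 : x = z + x * q * z.
    have -> : q = w - y by rewrite wq addrC addKr.
    by rewrite mulrBr mulrBl -mulrA wz mulr1 xy mul1r addrC subrK.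
  have -> : x - z = z * q * z + adj (q * z) * x * (q * z).
    rewrite E1 adjM (pos_sa pq) z1' {1}E2 mulrDr !mulrA.
    by [].
  by apply: posD; [apply: conj_sa|apply: conj_pos].
have p1 : pos (z1 - z).
  by apply: (below z1 y1 (y2 - 1)) => //; [case: u1|rewrite wE addrA].
have p2 : pos (z2 - z).
  by apply: (below z2 y2 (y1 - 1)) => //; [case: u2|rewrite wE; ncring].
have uz : ui z.
  split => //; have -> : 1 - z = (1 - z1) + (z1 - z) by ncring.
  by apply: posD => //; case: u1.
exists z; split => //.
  pose W := nrm w + 1; have W0 : 0 < W by rewrite ltr_wpDl// nrm_ge0.
  exists W^-1; rewrite ?invr_gt0//.
  have -> : z - W^-1%:A = W^-1 *: (z * (W%:A - w)).
    rewrite mulrBr zw -scalerAr mulr1 scalerBr scalerA mulVf ?gt_eqF//.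
    by rewrite scale1r.
  apply: posZ; rewrite ?invr_ge0 ?ltW//; apply: posM => //.
    by apply: sa_ub; [exact: pos_sa|rewrite lerDl].
  by rewrite mulrBr mulrBl wz zw; ncring.
(* Subtracting 1 in w pays off here: w - 1 = (1 - z1) y1 + (1 - z2) y2 and 1 - z = (w - 1) z, so z
   is near 1 where z1 and z2 are. *)
exists (nrm y1 + nrm y2) => e.
have -> : e * (1 - z) = (e * (1 - z1) * y1 + e * (1 - z2) * y2) * z.
  have -> : e * (1 - z1) * y1 + e * (1 - z2) * y2 = e * (w - 1).
    rewrite wE -!mulrA !mulrBl zy1 zy2; ncring.
  by rewrite -mulrA mulrBl wz mul1r.
rewrite (le_trans (nrmM _ _))//.
have := nrmD (e * (1 - z1) * y1) (e * (1 - z2) * y2).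
have := nrmM (e * (1 - z1)) y1; have := nrmM (e * (1 - z2)) y2.
have := ui_nrm uz; have := nrm_ge0 z; have := nrm_ge0 y1; have := nrm_ge0 y2.
have := nrm_ge0 (e * (1 - z1)); have := nrm_ge0 (e * (1 - z2)).
have := nrm_ge0 (e * (1 - z1) * y1 + e * (1 - z2) * y2).
set A1 := nrm (e * (1 - z1)); set A2 := nrm (e * (1 - z2)).
set B := nrm (_ + _) => B0 A20 A10 n2 n1 nz nz1 h2 h1 hB.
apply: (@le_trans _ _ B); first by rewrite ler_piMr.
nra.
Qed.

End UnitInterval.

(** * Filters *)

Section Filters.
Context {R : realType} {A : cstarAlgType R}.
Implicit Types (a b c x y z : A) (u v : unitz A) (t d : R) (F Y : set A).

Local Notation near c a := (nrm (emb c * (1 - emb a))).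

Definition dclosed F := forall b, posball b ->
  (forall d, 0 < d -> exists2 c, F c & near c b < d) -> F b.

Definition ddirected F := forall a b, F a -> F b ->
  forall d, 0 < d -> exists c, [/\ F c, near c a < d & near c b < d].

Definition dfilter F := dclosed F /\ ddirected F.

Definition upclosed F := forall a b, F a -> posball b -> pos (emb b - emb a) -> F b.

Lemma posball_nrm a : posball a -> nrm (emb a) <= 1.
Proof. by move=> /posballP/ui_nrm. Qed.

Lemma posball_of u : u.2 = 0 -> ui u -> exists2 a : A, posball a & emb a = u.
Proof.
move=> u2 uu; exists u.1; last exact: embP.
by apply/posballP; rewrite embP.
Qed.

Lemma hull_snd a b : (hull (emb a) (emb b)).2 = 0.
Proof. by rewrite /= !subr0 !mulr1 subrr. Qed.

Lemma hull_ex c b : posball c -> posball b -> exists h : A,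
  [/\ posball h, emb h = hull (emb c) (emb b), pos (emb h - emb c) &
      cnorm (b - h) <= 2 * near c b].
Proof.
move=> /posballP uc /posballP ub.
have [h ph hE] := posball_of (hull_snd c b) (hull_ui uc ub).
exists h; split => //; first by rewrite hE; apply: hull_ge.
by rewrite -nrm_emb embB hE nrm_distC; apply: hull_near.
Qed.

Lemma dfun_inf0 Y b : ereal_inf [set dfun c b | c in Y] = 0%E <->
  forall d, 0 < d -> exists2 c, Y c & near c b < d.
Proof.
rewrite ereal_inf0P => [|_ [c _ <-]]; last by rewrite dfunP lee_fin nrm_ge0.
split=> H d /H.
  by move=> [_ [c Yc <-]]; rewrite dfunP lte_fin; exists c.
by move=> [c Yc cb]; exists (dfun c b); [exists c|rewrite dfunP lte_fin].
Qed.

Lemma dfun_inf0_2 Y a b :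
  ereal_inf [set (dfun c b + dfun c a)%E | c in Y] = 0%E <->
  forall d, 0 < d -> exists c, [/\ Y c, near c a < d & near c b < d].
Proof.
rewrite ereal_inf0P => [|_ [c _ <-]]; last first.
  by rewrite !dfunP -EFinD lee_fin addr_ge0// nrm_ge0.
split=> H d d0.
  have [_ [c Yc <-]] := H d d0; rewrite !dfunP -EFinD lte_fin => cd; exists c.
  have := nrm_ge0 (emb c * (1 - emb a)); have := nrm_ge0 (emb c * (1 - emb b)).
  by split=> //; lra.
have [|c [Yc ca cb]] := H (d / 2); first by rewrite divr_gt0.
exists (dfun c b + dfun c a)%E; first by exists c.
by rewrite !dfunP -EFinD lte_fin; lra.
Qed.

Lemma rel_inf0 (r : A -> A -> Prop) Y b :
  ereal_inf [set rel_fun r c b | c in Y] = 0%E <-> exists2 c, Y c & r c b.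
Proof.
rewrite ereal_inf0P => [|_ [c _ <-]]; last first.
  by rewrite /rel_fun; case: asboolP; rewrite ?leey.
split=> [/(_ 1 ltr01)[_ [c Yc <-]]|[c Yc rcb] d d0].
  by rewrite /rel_fun; case: asboolP => // rcb _; exists c.
by exists (rel_fun r c b); [exists c|rewrite /rel_fun asboolT// lte_fin].
Qed.

Lemma upclosedP F : is_Dclosed (rel_fun cle) F <-> upclosed F.
Proof.
split=> H => [a b Fa pb ab|b pb /rel_inf0[c Fc /cleP cb]].
  by apply: H => //; apply/rel_inf0; exists a => //; apply/cleP.
exact: H cb.
Qed.

Lemma closed_cnormP F : closed F <->
  forall b, (forall d, 0 < d -> exists2 a, F a & cnorm (b - a) < d) -> F b.
Proof.
split=> H b; first by move=> /closureP; apply: H.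
by move=> /closureP; apply: H.
Qed.

Lemma closure_posball F : F `<=` posball -> closure F `<=` posball.
Proof.
move=> FP b /closureP H; apply/posballP; apply: ui_closed => d /H[a /FP pa ba].
by exists (emb a); [exact/posballP|rewrite -embB nrm_emb].
Qed.

Lemma is_filter_dfunP F : F `<=` posball -> is_filter dfun F <-> dfilter F.
Proof.
move=> FP; split=> [[_ H]|[Fc Fd]].
  split=> [b pb Hb|a b Fa Fb].
    suff [] : F b /\ F b by [].
    apply/(H b b pb pb)/dfun_inf0_2 => d /Hb[c Fc cb]; by exists c.
  by apply/dfun_inf0_2/(H a b (FP _ Fa) (FP _ Fb)).
split=> // a b pa pb; rewrite dfun_inf0_2; split=> [[]|H]; first exact: Fd.
by split; apply: Fc => // d /H[c [Fc' ca cb]]; exists c.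
Qed.

Lemma dfilter_initial F a d : dfilter F -> F a -> 0 < d -> exists2 c, F c & near c a < d.
Proof. by move=> [_ Fd] Fa /(Fd _ _ Fa Fa)[c [Fc ca _]]; exists c. Qed.

Lemma near_up c a b d : posball c -> posball b -> pos (emb b - emb a) -> 0 < d ->
  near c a < d ^+ 2 -> near c b < d.
Proof.
move=> pc /posballP ub ab d0 ca.
rewrite -(@ltr_pXn2r _ 2) ?nnegrE ?nrm_ge0 ?ltW//.
by apply: le_lt_trans ca; apply: near_le1 => //; apply: posball_nrm.
Qed.

Lemma dfilter_upclosed F : F `<=` posball -> dfilter F -> upclosed F.
Proof.
move=> FP Fg a b Fa pb ab; have [Fc _] := Fg; apply: Fc => // d d0.
have [|c Fc ca] := dfilter_initial Fg Fa (d := d ^+ 2).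
  by rewrite exprn_gt0.
by exists c => //; apply: near_up ab d0 ca => //; apply: FP.
Qed.

Lemma dfilter_closed F : F `<=` posball -> dfilter F -> closed F.
Proof.
move=> FP Fg; apply/closed_cnormP => b Hb; have [Fc _] := Fg.
have pb : posball b by apply: (closure_posball FP); apply/closureP.
apply: Fc => // d d0; have d2 : 0 < d / 2 by rewrite divr_gt0.
have [a Fa ba] := Hb _ d2; have [c Fc ca] := dfilter_initial Fg Fa d2.
exists c => //; have := near_close (emb a) (emb b) (posball_nrm (FP _ Fc)).
by rewrite -embB nrm_emb; lra.
Qed.

(** If c (1 - b) is small, c can be moved into Y, and the hull of c and b is then in Y and close to
    b. The hypothesis offers the hull both by its formula and as an upper bound of c, since
    different sets Y exploit one or the other. *)
Lemma hull_dclosed Y : Y `<=` posball ->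
  (forall c b h, Y c -> posball b -> posball h ->
     emb h = hull (emb c) (emb b) -> pos (emb h - emb c) -> Y h) ->
  dclosed (closure Y).
Proof.
move=> YP H b pb Hb; apply/closureP => d d0.
have /posballP/uiC/ui_nrm b1 := pb.
have d4 : 0 < d / 4 by rewrite divr_gt0.
have [c /closureP/(_ _ d4)[c' Yc' cc'] cb] := Hb _ d4.
have [h [ph hE hc bh]] := hull_ex (YP _ Yc') pb.
exists h; first exact: (H c' b).
have := near_close_l (emb c) (emb c') b1.
by rewrite nrm_distC -embB nrm_emb; lra.
Qed.

Lemma upclosed_dclosed F : F `<=` posball -> closed F -> upclosed F -> dclosed F.
Proof.
move=> FP Fcl Fu; rewrite (closure_id F).1//; apply: hull_dclosed => //.
by move=> c b h Fc pb ph _; apply: Fu.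
Qed.

Lemma sq_closedP F : F `<=` posball -> sq_closed F ->
  forall a k, F a -> exists2 c, F c & emb c = emb a ^+ (2 ^ k).
Proof.
move=> FP Fs a k Fa; elim: k => [|k [c Fc cE]].
  by exists a; rewrite ?expr1.
exists (c ** c); first exact: Fs.
by rewrite embM cE expnSr exprM.
Qed.

Lemma pow2_le m : (m <= 2 ^ m)%N.
Proof. by rewrite ltnW// ltn_expl. Qed.

Lemma ui_refl (u : unitz A) : pos (u - u).
Proof. by rewrite subrr; apply: pos0. Qed.

Lemma sq_closed_initial F : F `<=` posball -> sq_closed F ->
  forall a d, F a -> 0 < d -> exists2 c, F c & near c a < d.
Proof.
move=> FP Fs a d Fa d0; have ua : ui (emb a) by apply/posballP/FP.
have [m hm] := pow_near ua ua (ui_refl _) d0.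
have [c Fc cE] := sq_closedP FP Fs m Fa.
by exists c => //; rewrite cE; apply: hm; apply: pow2_le.
Qed.

Lemma emb_segment t a b :
  emb (segment_pt t a b) = t *: emb a + (1 - t) *: emb b.
Proof. by rewrite embD !embZ. Qed.

Lemma posball_segment t a b : 0 < t < 1 -> posball a -> posball b ->
  posball (segment_pt t a b).
Proof.
move=> /andP[t0 t1] /posballP ua /posballP ub; apply/posballP.
by rewrite emb_segment; apply: ui_conv => //; rewrite !ltW.
Qed.

Lemma posball_sq a : posball a -> posball (a ** a).
Proof.
move=> /posballP ua; apply/posballP; rewrite embM; exact: uiM.
Qed.

Lemma posball_odot a b : posball a -> posball b -> posball (odot a b).
Proof.
move=> /posballP ua /posballP ub; apply/posballP.
by rewrite odotP; [apply: ui_conj => //; apply: ui_sqrt|case: ua].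
Qed.

(** ** Algebraic characterisations *)

(** As sqrt a >= a, the square of |c (1 - sqrt a)| is at most |c (1 - a)|; each of the three factors
    of sqrt a b sqrt a then costs at most d / 3. *)
Lemma dfilter_odot F : F `<=` posball -> dfilter F -> odot_closed F.
Proof.
move=> FP [Fc Fd] a b Fa Fb; have [pa pb] := (FP _ Fa, FP _ Fb).
have /posballP ua := pa; have /posballP ub := pb.
apply: Fc; first exact: posball_odot.
move=> d d0; have d3 : 0 < d / 3 by rewrite divr_gt0.
pose d' := Num.min ((d / 3) ^+ 2) (d / 3).
have d'0 : 0 < d' by rewrite lt_min exprn_gt0.
have [c [Fc' + +]] := Fd _ _ Fa Fb _ d'0.
rewrite !lt_min => /andP[ca _] /andP[_ cb].
exists c => //; rewrite odotP; last by case: ua.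
have us := ui_sqrt ua; have us1 := ui_nrm us.
have cs : nrm (emb c * (1 - usqrt (emb a))) < d / 3.
  rewrite -(@ltr_pXn2r _ 2) ?nnegrE ?nrm_ge0 ?ltW//; apply: le_lt_trans ca.
  apply: near_le1 => //; first exact/posball_nrm/FP.
  have {2}<- : usqrt (emb a) * usqrt (emb a) = emb a by apply: usqrt_sq; case: ua.
  by case: us => ? ?; apply: contr_sq.
have := near_mul (emb c) (usqrt (emb a) * emb b) us1.
have := near_mul (emb c) (usqrt (emb a)) (ui_nrm ub).
by lra.
Qed.

Lemma odot_sq a : posball a -> odot a a = a ** a.
Proof.
move=> /posballP[pa _]; apply: emb_inj; rewrite odotP// embM.
have -> : usqrt (emb a) * emb a = emb a * usqrt (emb a) by apply: usqrtC.
by rewrite -mulrA usqrt_sq.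
Qed.

(** F contains squares, so a b a, which is the [odot] product of a^2 and b, lies in F, and so do its
    powers with exponent a power of 2. *)
Lemma odot_dfilter F : F `<=` posball -> closed F -> upclosed F -> odot_closed F ->
  dfilter F.
Proof.
move=> FP Fcl Fu Fo; split; first exact: upclosed_dclosed.
have Fs : sq_closed F by move=> a Fa; rewrite -odot_sq; [apply: Fo|apply: FP].
move=> a b Fa Fb d d0.
have ua : ui (emb a) by apply/posballP/FP.
have ub : ui (emb b) by apply/posballP/FP.
pose x := odot (a ** a) b.
have Fx : F x by apply: Fo => //; apply: Fs.
have xE : emb x = emb a * emb b * emb a.
  rewrite odotP embM; last by apply: pos_sq; apply: ui_sa.
  by rewrite (usqrtE (k := emb a))//; case: ua.
have [m hm] := pow_near2 ua ub d0.
have [c Fc cE] := sq_closedP FP Fs m Fx.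
have [] := hm _ (pow2_le m).
by exists c; rewrite cE xE.
Qed.

Lemma dfilter_sq F : F `<=` posball -> dfilter F -> sq_closed F.
Proof.
by move=> FP Fg a Fa; rewrite -odot_sq; [apply: dfilter_odot|apply: FP].
Qed.

Lemma dfilter_convex F : F `<=` posball -> dfilter F -> is_convex F.
Proof.
move=> FP [Fc Fd] a b t Fa Fb t01.
have pa : posball a by apply: FP. have pb : posball b by apply: FP.
apply: Fc; first exact: posball_segment.
move=> d d0; have [|c [Fc' ca cb]] := Fd _ _ Fa Fb (d / 2).
  by rewrite divr_gt0.
exists c => //; rewrite emb_segment.
have := near_conv_le (emb c) (emb a) (emb b) t01.
by lra.
Qed.

Lemma near_segment c a b t d : 0 < t < 1 -> posball c -> posball a -> posball b ->
  0 < d -> near c (segment_pt t a b) < t * d ^+ 2 -> near c a < d.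
Proof.
move=> t01 pc /posballP ua /posballP ub d0 H.
rewrite -(@ltr_pXn2r _ 2) ?nnegrE ?nrm_ge0 ?ltW//.
have := near_conv t01 ua ub (posball_nrm pc); rewrite -emb_segment => H2.
have t0 : 0 < t by case/andP: t01.
by rewrite -(ltr_pM2l t0); apply: le_lt_trans H.
Qed.

Lemma segmentC t a b : segment_pt t a b = segment_pt (1 - t) b a.
Proof. by apply: emb_inj; rewrite !emb_segment; ncring. Qed.

Lemma sq_convex_dfilter F : F `<=` posball -> closed F -> upclosed F ->
  sq_closed F -> is_convex F -> dfilter F.
Proof.
move=> FP Fcl Fu Fs Fx; split; first exact: upclosed_dclosed.
move=> a b Fa Fb d d0; have [pa pb] := (FP _ Fa, FP _ Fb).
have h01 : 0 < (2^-1 : R) < 1 by apply/andP; split; lra.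
have Fm : F (segment_pt 2^-1 a b) by apply: Fx.
have e0 : 0 < 2^-1 * d ^+ 2 by rewrite mulr_gt0 ?invr_gt0// exprn_gt0.
have [c Fc cm] := sq_closed_initial FP Fs Fm e0.
exists c; split => //; first by apply: (near_segment h01 _ pa pb d0 cm); apply: FP.
apply: (@near_segment c b a 2^-1) => //; first exact: FP.
rewrite segmentC; have -> : 1 - 2^-1 = 2^-1 :> R by field.
exact: cm.
Qed.

(** ** Norm filters *)

Definition isprod F (u : unitz A) := exists a s,
  [/\ F a, forall x, x \in s -> F x & emb (foldl cmul a s) = u].

Lemma isprod1 F a : F a -> isprod F (emb a).
Proof. by move=> Fa; exists a, [::]. Qed.

Lemma isprodM F u v : isprod F u -> isprod F v -> isprod F (u * v).
Proof.
move=> [a [s [Fa Fs <-]]] [b [r [Fb Fr <-]]]; exists a, (s ++ b :: r); split=> //.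
  move=> x; rewrite mem_cat inE => /or3P[/Fs//|/eqP->//|/Fr//].
rewrite foldl_cat /= -embM; congr emb.
elim/last_ind: r {Fr} => [//|r x IH]; rewrite !foldl_rcons IH.
by rewrite cmulA.
Qed.

Lemma isprodX F u n : isprod F u -> isprod F (u ^+ n.+1).
Proof.
by move=> pu; elim: n => [|n IH]; rewrite ?expr1// exprS; apply: isprodM.
Qed.

Lemma isprod_nrm F u : F `<=` posball -> isprod F u -> nrm u <= 1.
Proof.
move=> FP [a [s [Fa Fs <-]]]; elim/last_ind: s Fs => [|s x IH] Fs.
  exact/posball_nrm/FP.
rewrite foldl_rcons embM -[1]mulr1; apply: nrmM_le.
  by apply: IH => y ys; apply: Fs; rewrite mem_rcons inE ys orbT.
by apply/posball_nrm/FP/Fs; rewrite mem_rcons inE eqxx.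
Qed.

Lemma norm_filterP F : is_norm_filter F <-> forall b, posball b ->
  (forall d, 0 < d -> exists2 u, isprod F u & nrm (u * (1 - emb b)) < d) -> F b.
Proof.
have E b p : (cnorm (p - p ** b)) = nrm (emb p * (1 - emb b)).
  by rewrite -nrm_emb embB embM mulrBr mulr1.
have infP b : ereal_inf [set r | exists a s, [/\ F a, forall x, x \in s -> F x &
    r = (cnorm (foldl cmul a s - foldl cmul a s ** b))%:E]] = 0%E <->
    (forall d, 0 < d -> exists2 u, isprod F u & nrm (u * (1 - emb b)) < d).
  rewrite ereal_inf0P => [|_ [a [s [_ _ ->]]]]; last by rewrite lee_fin cnorm_ge0.
  split=> H d /H.
    move=> [_ [a [s [Fa Fs ->]]]]; rewrite lte_fin E => lt_d.
    by exists (emb (foldl cmul a s)) => //; exists a, s.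
  move=> [u [a [s [Fa Fs <-]]] lt_d].
  by eexists; [exists a, s; split => //|rewrite lte_fin E].
by split=> H b pb /infP; apply: H.
Qed.

(** For a product p of elements of F, induction on the length gives c in F with c (1 - p) small;
    then c (1 - b) is bounded by c (1 - p) and p (1 - b). *)
Lemma dfilter_norm_filter F : F `<=` posball -> dfilter F -> is_norm_filter F.
Proof.
move=> FP [Fc Fd]; apply/norm_filterP => b pb Hb; apply: Fc => // d d0.
have d2 : 0 < d / 2 by rewrite divr_gt0.
have [u [a [s [Fa Fs <-]]] ub] := Hb _ d2.
have [c Fc' cu] : exists2 c, F c & nrm (emb c * (1 - emb (foldl cmul a s))) < d / 2.
  move: (d / 2) d2 => {ub} e; elim/last_ind: s Fs e => [|s x IH] Fs e e0.
    by have [c [Fc' ca _]] := Fd _ _ Fa Fa _ e0; exists c.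
  have e4 : 0 < e / 4 by rewrite divr_gt0.
  have [y ys|c1 Fc1 c1s] := IH _ _ e4.
    by apply: Fs; rewrite mem_rcons inE ys orbT.
  have Fx : F x by apply: Fs; rewrite mem_rcons inE eqxx.
  have [c [Fc' cc1 cx]] := Fd _ _ Fc1 Fx _ e4.
  exists c => //; rewrite foldl_rcons embM.
  have x1 := posball_nrm (FP _ Fx); have c1' := posball_nrm (FP _ Fc').
  have p1 : nrm (emb (foldl cmul a s)) <= 1.
    apply: (isprod_nrm FP); exists a, s; split => // y ys.
    by apply: Fs; rewrite mem_rcons inE ys orbT.
  have := near_mul (emb c) (emb (foldl cmul a s)) x1.
  (* A product of positive contractions need not be positive, so only |1 - p| <= 2 is available; the
     total is 2 e / 4 + e / 4 + e / 4. *)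
  have cp : nrm (emb c * (1 - emb (foldl cmul a s))) <= 2 * near c c1 + e / 4.
    set p := emb (foldl _ _ _) in p1 *; have -> : emb c * (1 - p) =
      emb c * (1 - emb c1) * (1 - p) + emb c * (emb c1 * (1 - p)) by ncring.
    have := nrmD (emb c * (1 - emb c1) * (1 - p)) (emb c * (emb c1 * (1 - p))).
    have q1 : nrm (1 - p) <= 2 by have := nrmB 1 p; rewrite nrm1; lra.
    have := nrmM_le (lexx (near c c1)) q1; have := nrmM_le c1' (ltW c1s).
    by lra.
  by lra.
exists c => //.
have /posballP/uiC/ui_nrm b1 := pb.
have := near_trans (emb (foldl cmul a s)) b1 (posball_nrm (FP _ Fc')).
by lra.
Qed.

(** High powers of a and of a b a are themselves products of elements of F, so they can test
    membership of upper bounds, squares, limits and convex combinations. *)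
Lemma norm_filter_dfilter F : F `<=` posball -> is_norm_filter F -> dfilter F.
Proof.
move=> FP /norm_filterP NF.
have near_pow a d : F a -> 0 < d -> exists2 u, isprod F u & nrm (u * (1 - emb a)) < d.
  move=> Fa d0; have ua : ui (emb a) by apply/posballP/FP.
  have [m hm] := pow_near ua ua (ui_refl _) d0.
  by exists (emb a ^+ m.+1); [apply/isprodX/isprod1|apply: hm].
apply: sq_convex_dfilter => //.
- apply/closed_cnormP => b Hb.
  have pb : posball b by apply: (closure_posball FP); apply/closureP.
  apply: NF => // d d0; have d2 : 0 < d / 2 by rewrite divr_gt0.
  have [a Fa ba] := Hb _ d2; have [u pu ua] := near_pow _ _ Fa d2.
  exists u => //; have := near_close (emb a) (emb b) (isprod_nrm FP pu).
  by rewrite -embB nrm_emb; lra.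
- move=> a b Fa pb ab; apply: NF => // d d0.
  have [|u pu ua] := near_pow _ (d ^+ 2) Fa; first by rewrite exprn_gt0.
  exists u => //; rewrite -(@ltr_pXn2r _ 2) ?nnegrE ?nrm_ge0 ?ltW//.
  apply: le_lt_trans ua; apply: near_le1 => //; first exact: isprod_nrm pu.
  exact/posballP.
- move=> a Fa; have pa := FP _ Fa.
  apply: NF; first exact: posball_sq.
  move=> d d0; have d2 : 0 < d / 2 by rewrite divr_gt0.
  have [u pu ua] := near_pow _ _ Fa d2; exists u => //; rewrite embM.
  by have := near_mul u (emb a) (posball_nrm pa); lra.
- move=> a b t Fa Fb t01; have [pa pb] := (FP _ Fa, FP _ Fb).
  apply: NF; first exact: posball_segment.
  have /posballP ua := pa; have /posballP ub := pb.
  move=> d d0; have d2 : 0 < d / 2 by rewrite divr_gt0.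
  have [m /(_ m.+1 (leqnSn m))[]] := pow_near2 ua ub d2.
  set u := _ ^+ _ => h1 h2; exists u.
    by apply: isprodX; apply: isprodM; [apply: isprodM|]; apply: isprod1.
  by rewrite emb_segment; have := near_conv_le u (emb a) (emb b) t01; lra.
Qed.

(** ** Filters for the distance h *)

(** Since a c a <= a^2 <= a, the difference c - a is below c - a c a, whose norm is at most 2 |c (1
    - a)|. *)
Lemma near_upos c a : posball c -> posball a ->
  nrm (upos (emb c - emb a)) <= 2 * near c a.
Proof.
move=> /posballP uc /posballP ua.
have [c1 a1] := (ui_sa uc, ui_sa ua).
have aca1 : adj (emb a * emb c * emb a) = emb a * emb c * emb a.
  by rewrite !adjM a1 c1 mulrA.
apply: upos_le; first by rewrite adjB c1 a1.
  by rewrite mulr_ge0// nrm_ge0.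
have H : nrm (emb c - emb a * emb c * emb a) <= 2 * near c a.
  have -> : emb c - emb a * emb c * emb a =
    emb c * (1 - emb a) + (1 - emb a) * emb c * emb a by ncring.
  have := nrmD (emb c * (1 - emb a)) ((1 - emb a) * emb c * emb a).
  have := nrmM_le (lexx (nrm ((1 - emb a) * emb c))) (ui_nrm ua).
  have -> : nrm ((1 - emb a) * emb c) = near c a.
    by apply: nrm_mulC => //; apply: ui_sa; apply: uiC.
  by lra.
have -> : (2 * near c a)%:A - (emb c - emb a) =
  ((2 * near c a)%:A - (emb c - emb a * emb c * emb a)) +
  (emb a - emb a * emb a) + emb a * (1 - emb c) * emb a by ncring.
apply: posD; [apply: posD|].
- by apply: sa_ub => //; rewrite adjB c1 aca1.
- by case: ua => ? ?; apply: contr_sq.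
- by apply: conj_sa => //; case: uc.
Qed.

(** Compress 1 - a <= (1 - c) + r by e, where r is the positive part of c - a. *)
Lemma upos_near e c a : posball e -> posball c -> posball a ->
  near e a ^+ 2 <= near e c + nrm (upos (emb c - emb a)).
Proof.
move=> pe /posballP uc /posballP ua; have /posballP ue := pe.
have e1 := ui_nrm ue.
have [p1a pa] := uiC ua; have := nrm_contr_sq (emb e) p1a pa.
rewrite (ui_sa ue) => /le_trans; apply.
have d1 : adj (emb c - emb a) = emb c - emb a by rewrite adjB !ui_sa.
have [pu pn _ _] := uposP d1; set r := upos _ in pu pn *.
apply: (@le_trans _ _ (nrm (emb e * (1 - emb c + r) * emb e))).
  rewrite -{2 4}(ui_sa ue); apply: nrm_conj_le => //.
  by have -> : 1 - emb c + r - (1 - emb a) = r - (emb c - emb a) by ncring.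
have -> : emb e * (1 - emb c + r) * emb e =
  emb e * (1 - emb c) * emb e + emb e * r * emb e by ncring.
rewrite (le_trans (nrmD _ _))// lerD//.
  by rewrite (le_trans (nrmM _ _))// ler_piMr// nrm_ge0.
have := nrmM_le (nrmM_le e1 (lexx (nrm r))) e1; lra.
Qed.

Lemma hfun_inf0_2 F a b : F `<=` posball -> posball a -> posball b ->
  ereal_inf [set (hfun c b + hfun c a)%E | c in F] = 0%E <->
  forall d, 0 < d -> exists c, [/\ F c, nrm (upos (emb c - emb a)) < d &
    nrm (upos (emb c - emb b)) < d].
Proof.
move=> FP /posballP/ui_sa a1 /posballP/ui_sa b1.
have E c : F c -> (hfun c b + hfun c a =
  (nrm (upos (emb c - emb b)) + nrm (upos (emb c - emb a)))%:E)%E.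
  by move=> /FP/posballP/ui_sa c1; rewrite !hfunP.
rewrite ereal_inf0P => [|_ [c Fc <-]]; last first.
  by rewrite E// lee_fin addr_ge0// nrm_ge0.
split=> H d d0.
  have [_ [c Fc <-]] := H d d0; rewrite E// lte_fin => cd; exists c.
  have := nrm_ge0 (upos (emb c - emb a)); have := nrm_ge0 (upos (emb c - emb b)).
  by split=> //; lra.
have [|c [Fc ca cb]] := H (d / 2); first by rewrite divr_gt0.
exists (hfun c b + hfun c a)%E; first by exists c.
by rewrite E// lte_fin; lra.
Qed.

Lemma is_initial_dfunP F : is_initial dfun F <->
  forall b, F b -> forall d, 0 < d -> exists2 c, F c & near c b < d.
Proof. by split=> H b Fb; apply/dfun_inf0/H. Qed.

(** A small positive part of c - a says that c is almost below a. Initiality supplies e in F with e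
    (1 - c) small, and [upos_near] then makes e (1 - a) small; [near_upos] gives the way back. *)
Lemma hfilterP F : F `<=` posball ->
  is_initial dfun F /\ is_filter hfun F <-> dfilter F.
Proof.
move=> FP; rewrite is_initial_dfunP; split=> [[Fi [_ Fh]]|Fg].
  split=> [b pb Hb|a b Fa Fb d d0].
    suff [] : F b /\ F b by [].
    apply/(Fh b b pb pb)/(hfun_inf0_2 FP pb pb) => d d0.
    have [|c Fc cb] := Hb (d / 2); first by rewrite divr_gt0.
    have := near_upos (FP _ Fc) pb.
    by exists c; split => //; lra.
  have [pa pb] := (FP _ Fa, FP _ Fb).
  have d2 : 0 < d ^+ 2 / 2 by rewrite divr_gt0// exprn_gt0.
  have /(hfun_inf0_2 FP pa pb)/(_ _ d2)[c [Fc ca cb]] :=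
    (Fh a b pa pb).1 (conj Fa Fb).
  have [e Fe ec] := Fi _ Fc _ d2.
  have [pe pc] := (FP _ Fe, FP _ Fc).
  exists e; split => //; rewrite -(@ltr_pXn2r _ 2) ?nnegrE ?nrm_ge0 ?ltW//.
    by have := upos_near pe pc pa; lra.
  by have := upos_near pe pc pb; lra.
split; first by move=> b Fb d; apply: dfilter_initial.
split=> // a b pa pb; rewrite (hfun_inf0_2 FP pa pb); have [Fc Fd] := Fg.
split=> [[Fa Fb] d d0|H].
  have [|c [Fc' ca cb]] := Fd _ _ Fa Fb (d / 2); first by rewrite divr_gt0.
  have := near_upos (FP _ Fc') pa; have := near_upos (FP _ Fc') pb.
  by exists c; split => //; lra.
suff K x : posball x -> (forall d, 0 < d ->
    exists2 c, F c & nrm (upos (emb c - emb x)) < d) -> F x.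
  by split; apply: K => // d /H[c [Fc' ca cb]]; exists c.
move=> px Hx; apply: Fc => // d d0.
have d2 : 0 < d ^+ 2 / 2 by rewrite divr_gt0// exprn_gt0.
have [c Fc' cx] := Hx _ d2; have [e Fe ec] := dfilter_initial Fg Fc' d2.
exists e => //; rewrite -(@ltr_pXn2r _ 2) ?nnegrE ?nrm_ge0 ?ltW//.
by have := upos_near (FP _ Fe) (FP _ Fc') px; lra.
Qed.

End Filters.

Section Closures.
Context {R : realType} {A : cstarAlgType R}.
Implicit Types (a b c x y z : A) (u v : unitz A) (t d : R) (F Y : set A).

Local Notation near c a := (nrm (emb c * (1 - emb a))).

(** ** Closures of order filters *)

Lemma le_filterP Y : Y `<=` posball -> is_filter (rel_fun cle) Y <->
  upclosed Y /\ (forall a b, Y a -> Y b -> exists c,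
    [/\ Y c, pos (emb a - emb c) & pos (emb b - emb c)]).
Proof.
move=> YP; rewrite rel_filterP//; split=> [H|[Yu Yd] a b pa pb].
  split=> [a b Ya pb ab|a b Ya Yb].
    suff [] : Y b /\ Y b by [].
    by apply/(H b b pb pb); exists a => //; split; apply/cleP.
  have [c Yc [/cleP ca /cleP cb]] := (H a b (YP _ Ya) (YP _ Yb)).1 (conj Ya Yb).
  by exists c.
split=> [[Ya Yb]|[c Yc [/cleP ca /cleP cb]]].
  by have [c [Yc ca cb]] := Yd _ _ Ya Yb; exists c => //; split; apply/cleP.
by split; [exact: (Yu c)|exact: (Yu c)].
Qed.

Lemma closure_ddirected Y : Y `<=` posball ->
  (forall a b d, Y a -> Y b -> 0 < d ->
    exists c, [/\ Y c, near c a < d & near c b < d]) ->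
  ddirected (closure Y).
Proof.
move=> YP H a b /closureP Ha /closureP Hb d d0.
have d2 : 0 < d / 2 by rewrite divr_gt0.
have [a' Ya' aa'] := Ha _ d2; have [b' Yb' bb'] := Hb _ d2.
have [c [Yc ca cb]] := H _ _ _ Ya' Yb' d2.
have c1 := posball_nrm (YP _ Yc).
exists c; split; first exact: subset_closure.
  have := near_close (emb a') (emb a) c1; rewrite -embB nrm_emb; lra.
have := near_close (emb b') (emb b) c1; rewrite -embB nrm_emb; lra.
Qed.

Lemma le_filter_closure_dfilter Y : Y `<=` posball ->
  is_initial dfun Y -> is_filter (rel_fun cle) Y -> dfilter (closure Y).
Proof.
move=> YP /is_initial_dfunP Yi /(le_filterP YP)[Yu Yd]; split.
  by apply: hull_dclosed => // c b h Yc pb ph _; apply: Yu.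
apply: closure_ddirected => // a b d Ya Yb d0.
have [c [Yc ca cb]] := Yd _ _ Ya Yb.
have [|e Ye ec] := Yi _ Yc (d ^+ 2); first by rewrite exprn_gt0.
by exists e; split => //; [apply: near_up ca d0 ec|apply: near_up cb d0 ec];
  apply: YP.
Qed.

(** * An order filter whose closure is a given nonempty d-filter *)

Section LowerBounds.
Context (F : set A) (r : A).
Context (FP : F `<=` posball) (Fg : dfilter F) (Fr : F r).

(* Invertible elements of the unitization belonging to the filter that F
   generates there, compressed by [r] to land in A. *)
Definition inner u := [/\ ui u, bounded_below u &
  forall d, 0 < d -> exists2 c, F c & nrm (emb c * (1 - u)) < d].

Definition inner_up : set A := [set b | posball b /\
  exists2 u, inner u & pos (emb b - emb r * u * emb r)].

Lemma compress_snd u : (emb r * u * emb r).2 = 0.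
Proof. by rewrite /= !mul0r. Qed.

Lemma compress_ex u : inner u -> exists2 c, F c & emb c = emb r * u * emb r.
Proof.
move=> [uu _ Hu]; have ur : ui (emb r) by apply/posballP/FP.
have [c pc cE] := posball_of (compress_snd u) (ui_conj ur uu).
exists c => //; have [Fc Fd] := Fg; apply: Fc => // d d0.
have d4 : 0 < d / 4 by rewrite divr_gt0.
have [c1 Fc1 c1u] := Hu _ d4; have [e [Fe er ec1]] := Fd _ _ Fr Fc1 _ d4.
exists e => //; rewrite cE.
have eu := near_trans (emb c1) (ui_nrm (uiC uu)) (posball_nrm (FP Fe)).
have := near_mul (emb e) (emb r * u) (ui_nrm ur).
by have := near_mul (emb e) (emb r) (ui_nrm uu); lra.
Qed.

Lemma inner_up_sub : inner_up `<=` F.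
Proof.
move=> b [pb [u /compress_ex[c Fc cE] ub]].
by apply: (dfilter_upclosed FP Fg Fc) => //; rewrite cE.
Qed.

Lemma inner_meet u v : inner u -> inner v -> exists w,
  [/\ inner w, pos (u - w) & pos (v - w)].
Proof.
move=> [uu bu Hu] [uv bv Hv]; have [Fc Fd] := Fg.
have [w [uw bw wu wv [C HC]]] := ui_meet uu uv bu bv.
exists w; split => //; split => // d d0.
have C0 : 0 < `|C| + 1 by rewrite ltr_wpDl.
pose d' := d / (`|C| + 1) / 4; have d'0 : 0 < d' by rewrite !divr_gt0.
have [c1 Fc1 c1u] := Hu _ d'0; have [c2 Fc2 c2v] := Hv _ d'0.
have [c [Fc' cc1 cc2]] := Fd _ _ Fc1 Fc2 _ d'0; exists c => //.
have c'1 := posball_nrm (FP Fc').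
have := near_trans (emb c1) (ui_nrm (uiC uu)) c'1.
have := near_trans (emb c2) (ui_nrm (uiC uv)) c'1 => h2 h1.
apply: le_lt_trans (HC _) _.
apply: (@le_lt_trans _ _ ((`|C| + 1) * (nrm (emb c * (1 - u)) + nrm (emb c * (1 - v))))).
  rewrite ler_wpM2r ?addr_ge0 ?nrm_ge0//.
  by rewrite (le_trans (ler_norm C))// lerDl.
rewrite mulrC -ltr_pdivlMr//.
have : d / (`|C| + 1) = 4 * d' by rewrite /d'; field.
lra.
Qed.

Lemma inner_up_filter : is_filter (rel_fun cle) inner_up.
Proof.
have ur : ui (emb r) by apply/posballP/FP.
apply/le_filterP; first by move=> b [].
split=> [a b [pa [u iu ua]] pb ab|a b [pa [u iu ua]] [pb [v iv vb]]].
  split => //; exists u => //.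
  have -> : emb b - emb r * u * emb r =
    (emb b - emb a) + (emb a - emb r * u * emb r) by ncring.
  exact: posD.
have [w [iw wu wv]] := inner_meet iu iv.
have [c Fc cE] := compress_ex iw.
have le (x : unitz A) : pos (x - w) -> pos (emb r * x * emb r - emb c).
  by move=> xw; rewrite cE -mulrBl -mulrBr; apply: conj_sa => //; apply: ui_sa.
exists c; split.
- split; first exact: FP.
  by exists w => //; rewrite cE; apply: ui_refl.
- have -> : emb a - emb c =
    (emb a - emb r * u * emb r) + (emb r * u * emb r - emb c) by ncring.
  by apply: posD => //; apply: le.
- have -> : emb b - emb c =
    (emb b - emb r * v * emb r) + (emb r * v * emb r - emb c) by ncring.
  by apply: posD => //; apply: le.
Qed.

(** For b in F take c in F with c (1 - b) and c (1 - r) small. The element u = (1 - t) c + t is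
    bounded below by t and close to c, r u r is still close to c, and the hull of r u r and b is
    close to b. *)
Lemma inner_up_dense : F `<=` closure inner_up.
Proof.
have [Fc Fd] := Fg; have ur : ui (emb r) by apply/posballP/FP.
move=> b Fb; have pb := FP Fb; apply/closureP => d d0.
(* Compression moves c by at most 3 t, and the hull doubles t + 3 t, so b is approximated within 8 t
   < d. *)
pose t := Num.min (d / 9) 2^-1.
have t0 : 0 < t by rewrite lt_min divr_gt0//= invr_gt0.
have t9 : t <= d / 9 by rewrite ge_min lexx.
have t1 : t < 1 by rewrite gt_min [2^-1 < 1]invf_lt1 ?ltr1n ?orbT.
have [c [Fc' cb cr]] := Fd _ _ Fb Fr _ t0.
have uc : ui (emb c) by apply/posballP/FP.
pose u := (1 - t) *: emb c + (1 - (1 - t)) *: 1.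
have uE : 1 - u = (1 - t) *: (1 - emb c) by rewrite /u; ncring.
have uc' : u - emb c = t *: (1 - emb c) by rewrite /u; ncring.
have iu : inner u.
  split.
  - by apply: ui_conv; [apply/andP; split; lra|exact: uc|exact: ui1].
  - exists t => //; have -> : u - t%:A = (1 - t) *: emb c by rewrite /u; ncring.
    by apply: posZ; [lra|case: uc].
  - move=> e e0; have [e1 Fe1 e1c] := dfilter_initial Fg Fc' e0.
    exists e1 => //; rewrite uE -scalerAr nrmZ ger0_norm; last by lra.
    by have := nrm_ge0 (emb e1 * (1 - emb c)); nra.
have [c' Fc'' c'E] := compress_ex iu.
have c'c : nrm (emb c' - emb c) <= 3 * t.
  have -> : emb c' - emb c = emb r * (u - emb c) * emb r
      - ((1 - emb r) * emb c * emb r + emb c * (1 - emb r)).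
    by rewrite c'E; ncring.
  have r1 := ui_nrm ur.
  have n1 : nrm (u - emb c) <= t.
    rewrite uc' nrmZ gtr0_norm//.
    by have := ui_nrm (uiC uc); have := nrm_ge0 (1 - emb c); nra.
  have := nrmB (emb r * (u - emb c) * emb r)
    ((1 - emb r) * emb c * emb r + emb c * (1 - emb r)).
  have := nrmD ((1 - emb r) * emb c * emb r) (emb c * (1 - emb r)).
  have := nrmM_le (nrmM_le r1 n1) r1.
  have n2 : nrm ((1 - emb r) * emb c) <= t.
    rewrite nrm_mulC; [exact: ltW|apply: ui_sa; exact: uiC|exact: ui_sa].
  by have := nrmM_le n2 r1; lra.
have [h [ph hE hc bh]] := hull_ex (FP Fc'') pb.
exists h.
  by split => //; exists u => //; rewrite -c'E.
have /posballP/uiC/ui_nrm b1 := pb.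
have := near_close_l (emb c) (emb c') b1.
lra.
Qed.

Lemma inner_up_initial : is_initial dfun inner_up.
Proof.
apply/is_initial_dfunP => b Yb d d0; have Fb := inner_up_sub Yb.
have d2 : 0 < d / 2 by rewrite divr_gt0.
have [c Fc cb] := dfilter_initial Fg Fb d2.
have /closureP/(_ _ d2)[y Yy cy] := inner_up_dense Fc.
exists y => //.
have /posballP/uiC/ui_nrm b1 := FP Fb.
have := near_close_l (emb c) (emb y) b1.
by rewrite nrm_distC -embB nrm_emb; lra.
Qed.

End LowerBounds.

Lemma le_filter_closureP F : F `<=` posball ->
  (exists2 Y : set A, is_initial dfun Y /\ is_filter (rel_fun cle) Y &
    F = closure Y) <-> dfilter F.
Proof.
move=> FP; split=> [[Y [Yi Yf] ->]|Fg].
  by apply: le_filter_closure_dfilter => //; case: Yf.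
(* The compression needs an element r of F; the empty set is the closure of the empty order
   filter. *)
have [F0|[r Fr]] : F = set0 \/ F !=set0.
  by have [->|/set0P] := eqVneq F set0; [left|right].
  exists set0; last by rewrite closure0.
  split; first by [].
  by apply/le_filterP => //; split.
exists (inner_up F r).
  by split; [exact: inner_up_initial|exact: inner_up_filter].
apply/seteqP; split; first exact: inner_up_dense.
rewrite [X in _ `<=` X](closure_id F).1; last exact: dfilter_closed.
by apply: closure_subset; apply: inner_up_sub.
Qed.

(** ** Faces *)

Lemma dfun_inf0r Y c : ereal_inf [set dfun c b | b in Y] = 0%E <->
  forall d, 0 < d -> exists2 b, Y b & near c b < d.
Proof.
rewrite ereal_inf0P => [|_ [b _ <-]]; last by rewrite dfunP lee_fin nrm_ge0.
split=> H d /H.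
  by move=> [_ [b Yb <-]]; rewrite dfunP lte_fin; exists b.
by move=> [b Yb cb]; exists (dfun c b); [exists b|rewrite dfunP lte_fin].
Qed.

Lemma snd_exp u n : u.2 = 1 -> (u ^+ n).2 = 1.
Proof.
by move=> u1; elim: n => [//|n IH]; rewrite exprS /= u1 IH mulr1.
Qed.

(* [1 - (1 - z)^n] for [z = y* y] is an approximate unit for [y]. *)
Lemma approx_unit y d : nrm (emb y) <= 1 -> 0 < d ->
  exists2 b, posball b & nrm (emb y * (1 - emb b)) < d.
Proof.
move=> ny d0; pose z := adj (emb y) * emb y; pose h := 1 - z.
have uz : ui z.
  have pz : pos z by apply: star_pos.
  by split => //; apply: nrm_contr => //; rewrite nrm_star expr_le1 ?nrm_ge0.
have uh : ui h by apply: uiC.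
have [ph p1h] := uh.
have d2 : 0 < d ^+ 2 by rewrite exprn_gt0.
have [n /(_ n (leqnn n)) hn] := pos_pow_small ph p1h d2.
have hn2 : (1 - h ^+ n).2 = 0.
  by rewrite /= snd_exp ?subrr//= mulr0 subr0.
have uhn := uiX n uh.
have [b pb bE] := posball_of hn2 (uiC uhn).
exists b => //; rewrite bE opprB addrCA subrr addr0.
rewrite -(@ltr_pXn2r _ 2) ?nnegrE ?nrm_ge0 ?ltW//.
apply: le_lt_trans hn; rewrite -nrm_star adjM (ui_sa uhn).
have -> : 1 - h = z by rewrite /h; ncring.
have -> : h ^+ n * adj (emb y) * (emb y * h ^+ n) = h ^+ n * z * h ^+ n.
  by rewrite /z !mulrA.
rewrite (le_trans (nrmM _ _))// ler_piMr ?nrm_ge0//; exact: ui_nrm.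
Qed.

(** With a in F and u an approximate unit for c (1 - a), the hull of a and u lies above a, hence in
    F, and c (1 - hull) = c (1 - a) (1 - u) (1 - a). *)
Lemma dfilter_cofinal F : F `<=` posball -> dfilter F -> F !=set0 -> is_cofinal dfun F.
Proof.
move=> FP Fg [a Fa] c pc; apply/dfun_inf0r => d d0.
have pa := FP _ Fa; have /posballP ua := pa.
have y1 : nrm (emb (c - c ** a)) <= 1.
  have -> : emb (c - c ** a) = emb c * (1 - emb a).
    by rewrite embB embM mulrBr mulr1.
  by have := nrmM_le (posball_nrm pc) (ui_nrm (uiC ua)); rewrite mulr1.
have [u pu yu] := approx_unit y1 d0.
have [h [ph hE ha _]] := hull_ex pa pu.
exists h; first exact: (dfilter_upclosed FP Fg Fa).
rewrite hE; have -> : emb c * (1 - hull (emb a) (emb u)) =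
  emb (c - c ** a) * (1 - emb u) * (1 - emb a).
  by rewrite /hull embB embM; ncring.
apply: le_lt_trans yu; rewrite (le_trans (nrmM _ _))// ler_piMr ?nrm_ge0//.
by apply: ui_nrm; apply: uiC.
Qed.

Lemma dfilter_face F : F `<=` posball -> dfilter F -> is_face F.
Proof.
move=> FP Fg a b t pa pb t01; split=> [[Fa Fb]|Fm].
  exact: (dfilter_convex FP Fg).
suff K x y (s : R) : 0 < s < 1 -> posball x -> posball y -> F (segment_pt s x y) -> F x.
  split; first exact: (K a b t).
  apply: (K b a (1 - t)) => //; last by rewrite -segmentC.
  by case/andP: t01 => ? ?; apply/andP; split; lra.
move=> s01 px py Fs; have [Fc Fd] := Fg; apply: Fc => // d d0.
have s0 : 0 < s by case/andP: s01.
have [|c Fc' cs] := dfilter_initial Fg Fs (d := s * d ^+ 2).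
  by rewrite mulr_gt0// exprn_gt0.
by exists c => //; apply: (near_segment s01 _ px py d0 cs); apply: FP.
Qed.

Section Faces.
Context (F : set A).
Context (FP : F `<=` posball) (Ff : is_face F).

(** a is the midpoint of a^2 and 2 a - a^2 = 1 - (1 - a)^2, both in the unit interval. *)
Lemma face_sq a : F a -> F (a ** a) /\
  (forall g, emb g = 1 - (1 - emb a) * (1 - emb a) -> F g).
Proof.
move=> Fa; have pa := FP Fa; have /posballP ua := pa.
have h01 : 0 < (2^-1 : R) < 1 by apply/andP; split; lra.
have pg g : emb g = 1 - (1 - emb a) * (1 - emb a) -> posball g.
  move=> gE; apply/posballP; rewrite gE; apply: uiC; apply: uiM => //; exact: uiC.
have K g : emb g = 1 - (1 - emb a) * (1 - emb a) -> F (a ** a) /\ F g.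
  move=> gE; apply/(Ff (posball_sq pa) (pg _ gE) h01).
  have -> : segment_pt 2^-1 (a ** a) g = a => //.
  by apply: emb_inj; rewrite emb_segment embM gE; ncring.
split; last by move=> g /K[].
have [||g _ gE] := @posball_of _ A (1 - (1 - emb a) * (1 - emb a)).
- by rewrite /= !subr0 !mulr1 subrr.
- by apply: uiC; apply: uiM => //; exact: uiC.
by have [] := K _ gE.
Qed.

(* With [y = (1 - c) v b v (1 - c)] one has [y <= 2 v + 2 c], so a convex
   combination of [2 c - c^2] and [(v + c) / 2] is also one of the hull
   [2 c - c^2 + y] and of [(v + c) / 2 - y / 4]. *)
Lemma face_hull c (v : A) b (h : A) : F c -> F v -> posball b -> posball h ->
  emb h = hull (emb c) (emb v * emb b * emb v) -> F h.
Proof.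
move=> Fc Fv pb ph hE.
have /posballP uc := FP Fc; have /posballP uv := FP Fv; have /posballP ub := pb.
have [c1 v1] := (ui_sa uc, ui_sa uv).
have h01 : 0 < (2^-1 : R) < 1 by apply/andP; split; lra.
(* With weights 1/5 and 4/5, the y in the hull cancels against the y / 4 removed from the midpoint
   m. *)
have h05 : 0 < (5^-1 : R) < 1 by apply/andP; split; lra.
have [||g _ gE] := @posball_of _ A (1 - (1 - emb c) * (1 - emb c)).
- by rewrite /= !subr0 !mulr1 subrr.
- by apply: uiC; apply: uiM => //; exact: uiC.
have Fg : F g by apply: (face_sq Fc).2.
pose m := segment_pt 2^-1 v c.
have Fm : F m by apply/(Ff (FP Fv) (FP Fc) h01).
pose y := (1 - emb c) * (emb v * emb b * emb v) * (1 - emb c).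
have u1c := uiC uc; have s1c := ui_sa u1c.
have uy : ui y by apply: ui_conj => //; apply: ui_conj.
have mE : emb m = 2^-1 *: (emb v + emb c) by rewrite emb_segment; ncring.
have [k2 uk] : (emb m - 4^-1 *: y).2 = 0 /\ ui (emb m - 4^-1 *: y).
  split; first by rewrite /= !(mul0r, mulr0) subr0.
  have um : ui (emb m) by apply/posballP/FP.
  split; last first.
    have -> : 1 - (emb m - 4^-1 *: y) = (1 - emb m) + 4^-1 *: y by ncring.
    by apply: posD; [case: um|apply: posZ; [lra|case: uy]].
  (* This rests on y <= (1 - c) v^2 (1 - c) and (1 - c) v^2 (1 - c) + (1 + c) v^2 (1 + c) = 2 v^2 +
     2 c v^2 c. *)
  have -> : emb m - 4^-1 *: y = 4^-1 *: (
    (1 - emb c) * (emb v * (1 - emb b) * emb v) * (1 - emb c) +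
    (2 *: (emb v - emb v * emb v) + 2 *: (emb c - emb c * emb c) +
     2 *: (emb c * (1 - emb v * emb v) * emb c)) +
    (1 + emb c) * (emb v * emb v) * (1 + emb c)).
    by rewrite mE /y; ncring.
  apply: posZ; first by lra.
  have pvv : pos (emb v * emb v) by apply: pos_sq.
  have p1vv : pos (1 - emb v * emb v).
    have -> : 1 - emb v * emb v = (1 - emb v) + (emb v - emb v * emb v) by ncring.
    by case: uv => ? ?; apply: posD => //; apply: contr_sq.
  apply: posD; last by apply: conj_sa => //; rewrite adjD adj1 c1.
  apply: posD; first by apply: conj_sa => //; apply: conj_sa => //; case: (uiC ub).
  apply: posD; last by apply: posZ => //; apply: conj_sa.
  apply: posD; apply: posZ => //; first by case: uv => ? ?; apply: contr_sq.
  by case: uc => ? ?; apply: contr_sq.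
have [k pk kE] := posball_of k2 uk.
suff [] : F h /\ F k by [].
apply/(Ff ph pk h05).
have -> : segment_pt 5^-1 h k = segment_pt 5^-1 g m.
  by apply: emb_inj; rewrite !emb_segment kE mE hE gE /hull /y; ncring.
by apply/(Ff (FP Fg) (FP Fm) h05).
Qed.

(** The face argument needs the part added to the hull to be dominated by elements of F, which b
    need not be. Cofinality gives v in F with b (1 - v) small, and v b v <= v^2 replaces b;
    closedness absorbs the error. *)
Lemma face_dfilter : closed F -> is_cofinal dfun F -> dfilter F.
Proof.
move=> Fcl Fco.
have Fs : sq_closed F by move=> a /face_sq[].
have Fd : dclosed F.
  rewrite (closure_id F).1//; apply: hull_dclosed => // c b h Fc pb ph hE _.
  move/closed_cnormP: (Fcl); apply => d d0.
  have [v Fv bv] := (dfun_inf0r F b).1 (Fco b pb) (d / 2) (divr_gt0 d0 (ltr0n _ 2)).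
  have /posballP uv := FP Fv; have /posballP ub := pb; have /posballP uc := FP Fc.
  have uvb := ui_conj uv ub.
  have [||h' ph' h'E] := @posball_of _ A (hull (emb c) (emb v * emb b * emb v)).
  - by rewrite /= !(mul0r, subr0, mulr1) subrr.
  - exact: hull_ui.
  exists h'; first exact: (face_hull Fc Fv pb ph' h'E).
  rewrite -nrm_emb embB hE h'E.
  have -> : hull (emb c) (emb b) - hull (emb c) (emb v * emb b * emb v) =
    (1 - emb c) * ((1 - emb v) * emb b + emb v * (emb b * (1 - emb v))) * (1 - emb c).
    by rewrite /hull; ncring.
  have n1 := ui_nrm (uiC uc).
  have n2 := nrmD ((1 - emb v) * emb b) (emb v * (emb b * (1 - emb v))).
  have n3 := nrmM_le (ui_nrm uv) (lexx (near b v)).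
  have n4 : nrm ((1 - emb v) * emb b) = near b v.
    by apply: nrm_mulC; apply: ui_sa => //; apply: uiC.
  set q := (1 - emb v) * emb b + _ in n2 *.
  have := nrmM_le (nrmM_le n1 (lexx (nrm q))) n1.
  by lra.
apply: sq_convex_dfilter => //.
  move=> a b Fa pb ab; apply: Fd => // d d0.
  have [|c Fc ca] := sq_closed_initial FP Fs Fa (d := d ^+ 2).
    by rewrite exprn_gt0.
  by exists c => //; apply: near_up ab d0 ca => //; apply: FP.
by move=> a b t Fa Fb t01; apply/(Ff (FP Fa) (FP Fb) t01).
Qed.

End Faces.

End Closures.

(** ** Filters for the relation [<<] *)

Section WayBelow.
Context {R : realType} {A : cstarAlgType R}.
Implicit Types (a b c k x y z : A) (u v : unitz A) (t d : R) (F Y : set A).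

Local Notation near c a := (nrm (emb c * (1 - emb a))).
Local Notation below c a := (emb c * (1 - emb a) = 0).

Lemma below_trans c b a : below c b -> below b a -> below c a.
Proof.
move=> cb ba; have -> : emb c * (1 - emb a) =
    emb c * (1 - emb b) * (1 - emb a) + emb c * (emb b * (1 - emb a)) by ncring.
by rewrite cb ba mul0r mulr0 addr0.
Qed.

Lemma ll_filterP Y : Y `<=` posball -> is_filter (rel_fun ll) Y <->
  (forall a c, Y c -> posball a -> below c a -> Y a) /\
  (forall a b, Y a -> Y b -> exists c, [/\ Y c, below c a & below c b]).
Proof.
move=> YP; rewrite rel_filterP//; split=> [H|[Yu Yd] a b pa pb].
  split=> [a c Yc pa ca|a b Ya Yb].
    suff [] : Y a /\ Y a by [].
    by apply/(H a a pa pa); exists c => //; split; apply/llP.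
  have [c Yc [/llP ca /llP cb]] := (H a b (YP _ Ya) (YP _ Yb)).1 (conj Ya Yb).
  by exists c.
split=> [[Ya Yb]|[c Yc [/llP ca /llP cb]]].
  by have [c [Yc ca cb]] := Yd _ _ Ya Yb; exists c => //; split; apply/llP.
by split; [exact: (Yu a c)|exact: (Yu b c)].
Qed.

(** If e << c then e << h for every hull h over c, because 1 - h has 1 - c as its left factor. *)
Lemma ll_filter_closure_dfilter Y : Y `<=` posball ->
  is_filter (rel_fun ll) Y -> dfilter (closure Y).
Proof.
move=> YP /(ll_filterP YP)[Yu Yd]; split.
  apply: hull_dclosed => // c b h Yc pb ph hE _.
  have [e [Ye ec _]] := Yd _ _ Yc Yc; apply: (Yu h e) => //.
  have -> : 1 - emb h = (1 - emb c) * ((1 - emb b) * (1 - emb c)).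
    by rewrite hE /hull; ncring.
  by rewrite [LHS]mulrA ec mul0r.
apply: closure_ddirected => // a b d Ya Yb d0.
by have [c [Yc ca cb]] := Yd _ _ Ya Yb; exists c; rewrite ca cb nrm0.
Qed.

(** An exact relation k << c inside F near any given y. The last clause lets c inherit every
    relation y << a, by taking w = 1 - a. *)
Lemma filter_interp F y d : F `<=` posball -> dfilter F -> F y -> 0 < d ->
  exists c k, [/\ F c, F k, below k c, nrm (emb c - emb y) < d &
    forall w : unitz A, emb y * w = 0 -> emb c * w = 0].
Proof.
move=> FP Fg Fy d0; have /posballP uy := FP _ Fy; have [Fc _] := Fg.
pose t := Num.min (d / 8) 4^-1.
have t0 : 0 < t by rewrite lt_min divr_gt0//= invr_gt0.
have t8 : t <= d / 8 by rewrite ge_min lexx.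
have t4 : t <= 4^-1 by rewrite ge_min lexx orbT.
have t01 : 0 < t < 1 by apply/andP; split => //; lra.
have [c [k [[uc uk kc cy] [cE tkE kn cw]]]] := spectral_cut t01 uy.
(* The scalar part s >= 0 of k satisfies - t s (1 - t) = (t s)^2, whose two sides have opposite
   signs. *)
have k2 : k.2 = 0.
  have [s s0 ks] := pos_snd_ge0 uk.1.
  move/(congr1 snd): tkE; rewrite /= ks mulr1 sub0r -!rmorphM -rmorphN -rmorphM.
  move=> /complexI H; suff -> : s = 0 by [].
  have [//|s1] := eqVneq s 0; have ts : 0 < t * s by rewrite mulr_gt0// lt_def s1.
  by move: H; set q := t * s in ts *; nra.
have c2 : c.2 = 0 by rewrite cE /= k2 !(mulr0, subr0).
have [k' pk' k'E] := posball_of k2 uk; have [c' pc' c'E] := posball_of c2 uc.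
have Fk : F k'.
  apply: Fc => // e e0; have [|x Fx xy] := dfilter_initial Fg Fy (d := e * t / 2).
    by rewrite divr_gt0// mulr_gt0.
  exists x => //; rewrite k'E; apply: le_lt_trans (kn _) _.
  have -> : e = 2 / t * (e * t / 2) by field; rewrite gt_eqF.
  by rewrite ltr_pM2l// divr_gt0.
have kc' : below k' c' by rewrite k'E c'E.
exists c', k'; split => //.
- by apply: Fc => // e e0; exists k' => //; rewrite kc' nrm0.
- rewrite c'E; apply: le_lt_trans cy _.
  by rewrite ltr_pdivrMr; [nra|lra].
- by rewrite c'E.
Qed.

Lemma conj_in F a b : F `<=` posball -> dfilter F -> F a -> F b ->
  exists2 x, F x & emb x = emb a * emb b * emb a.
Proof.
move=> FP Fg Fa Fb; have /posballP ua := FP _ Fa.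
exists (odot (a ** a) b); first exact: dfilter_odot (dfilter_sq FP Fg Fa) Fb.
rewrite odotP embM; last by apply: pos_sq; apply: ui_sa.
by rewrite (usqrtE (k := emb a))//; case: ua.
Qed.

(** If a1 << b1 and a2 << b2, then x = a1 a2 a1 kills both 1 - b1 and 1 - b2, the latter by
    commutativity; interpolating near x gives the common lower bound. *)
Lemma ll_filter_commutative F : commutative_calg A -> F `<=` posball -> dfilter F ->
  exists2 Y, is_filter (rel_fun ll) Y & F = closure Y.
Proof.
move=> Ac FP Fg; have [Fc Fd] := Fg.
pose Y : set A := [set b | posball b /\ exists2 a, F a & below a b].
have YF : Y `<=` F.
  by move=> b [pb [a Fa ab]]; apply: Fc => // d d0; exists a => //; rewrite ab nrm0.
exists Y.
  apply/ll_filterP; first by move=> b [].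
  split=> [a c [pc [e Fe ec]] pa ca|b1 b2 [p1 [a1 F1 ab1]] [p2 [a2 F2 ab2]]].
    by split => //; exists c => //; apply: YF; split=> //; exists e.
  have [x Fx xE] := conj_in FP Fg F1 F2.
  have [c [k [Fc' Fk kc _ cw]]] := filter_interp FP Fg Fx ltr01.
  exists c; split; first by split; [exact: FP|exists k].
    by apply: cw; rewrite xE -mulrA ab1 mulr0.
  apply: cw; rewrite xE.
  have -> : emb a1 * emb a2 = emb a2 * emb a1 by rewrite -!embM Ac.
  have -> : emb a2 * emb a1 * emb a1 = emb a1 * emb a1 * emb a2.
    by rewrite -!embM ![a2 ** _]Ac -cmulA [a2 ** a1]Ac cmulA.
  by rewrite -mulrA ab2 mulr0.
apply/seteqP; split; last first.
  rewrite [X in _ `<=` X](closure_id F).1; last exact: dfilter_closed.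
  exact: closure_subset.
move=> b Fb; apply/closureP => d d0.
have [c [k [Fc' Fk kc cb _]]] := filter_interp FP Fg Fb d0.
exists c; first by split; [exact: FP|exists k].
by rewrite -nrm_emb embB nrm_distC.
Qed.

(** The dense sequence need not meet F. Index n codes a pair (i, m), and [T n] is an element of F
    within 1 / (m + 1) of the i-th dense point whenever there is one. *)
Lemma separable_targets F f0 : separable_space A -> F f0 ->
  exists (T : nat -> A) (tol : nat -> R), [/\ forall n, F (T n),
    forall n, 0 < tol n & forall b d, F b -> 0 < d ->
    exists2 n, tol n < d & cnorm (b - T n) < d].
Proof.
move=> [S Sc Sd] Ff0.
have [s Ss] : exists s : nat -> A, S `<=` range s.
  have [S0|[s]] := pfcard_geP Sc.
    have [|x []] := Sd setT _ openT; first by exists 0.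
    by rewrite S0.
  by exists s => x /(@surj _ _ _ _ s)[n _ <-]; exists n.
have dense_s b d : 0 < d -> exists i, cnorm (b - s i) < d.
  move=> d0; have cS : closure S b.
    move=> B; rewrite nbhsE => -[O [Oo Ob] OB].
    by have [|x [Ox Sx]] := Sd O _ Oo; [exists b|exists x; split => //; apply: OB].
  have /closureP/(_ _ d0)[x /Ss[i _ <-] bx] := cS; by exists i.
pose ix n : nat * nat := odflt (0%N, 0%N) (choice.unpickle n).
pose tol n : R := (ix n).2.+1%:R^-1.
have tol0 n : 0 < tol n by rewrite invr_gt0.
have exT n : exists g, F g /\
    ((exists2 g', F g' & cnorm (g' - s (ix n).1) < tol n) ->
     cnorm (g - s (ix n).1) < tol n).
  have [[g Fg gs]|ng] := pselect (exists2 g', F g' & cnorm (g' - s (ix n).1) < tol n).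
    by exists g.
  by exists f0.
have [T HT] := choice exT.
exists T, tol; split => // [n|b d Fb d0]; first by have [] := HT n.
pose m := Num.truncn (d / 2)^-1; have d2 : 0 < d / 2 by rewrite divr_gt0.
have md : m.+1%:R^-1 < d / 2.
  by rewrite -[ltRHS]invrK ltf_pV2 ?posrE ?invr_gt0// truncnS_gt.
have [|i bi] := dense_s b (m.+1%:R^-1); first by rewrite invr_gt0.
pose n := choice.pickle (i, m).
have ixn : ix n = (i, m) by rewrite /ix choice.pickleK.
have tn : tol n = m.+1%:R^-1 by rewrite /tol ixn.
exists n; first by rewrite tn (lt_trans md)// ltr_pdivrMr//; lra.
have [_ H] := HT n; have {H} : cnorm (T n - s i) < tol n.
  by move: H; rewrite ixn tn; apply; exists b.
rewrite tn => Ti; have := cnormD (b - s i) (s i - T n).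
rewrite addrA subrK -!nrm_emb [emb (s i - _)]embB nrm_distC -embB !nrm_emb.
by move: bi Ti md; set e := m.+1%:R^-1; lra.
Qed.

(** A chain of elements c_n of F with c_(n+1) << c_n is built so that c_(n+1) (1 - T n) is within
    the n-th tolerance; Y consists of all b with some c_n << b. Each c_n carries a k_n << c_n in F,
    which leaves room for the next step. *)
Lemma ll_filter_separable F : separable_space A -> F `<=` posball -> dfilter F ->
  exists2 Y, is_filter (rel_fun ll) Y & F = closure Y.
Proof.
move=> As FP Fg; have [Fc Fd] := Fg.
have [->|/set0P[f0 Ff0]] := eqVneq F set0.
  exists set0; last by rewrite closure0.
  by apply/ll_filterP => //; split.
have [T [tol [FT tol0 Tdense]]] := separable_targets As Ff0.
pose good (p : A * A) := [/\ F p.1, F p.2 & below p.2 p.1].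
have step (np : nat * (A * A)) : exists q : A * A, good np.2 ->
    [/\ good q, below q.1 np.2.1 & near q.1 (T np.1) < tol np.1].
  case: np => n [c k] /=; have [gp|ngp] := pselect (good (c, k)); last by exists (c, k).
  have [/= Fc' Fk kc] := gp; have /posballP uk := FP _ Fk.
  have t4 : 0 < tol n / 4 by rewrite divr_gt0.
  have [e [Fe eT ek]] := Fd _ _ (FT n) Fk _ t4.
  (* y = k e k kills 1 - c because k does, and is within 2 |e (1 - k)| of e. The errors add up to at
     most tol / 4 + 2 tol / 4 + tol / 4. *)
  have [y Fy yE] := conj_in FP Fg Fk Fe.
  have [c' [k' [Fc'' Fk' kc' cy cw]]] := filter_interp FP Fg Fy t4.
  exists (c', k') => _; split => //=; first by apply: cw; rewrite yE -mulrA kc mulr0.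
  have /posballP ue := FP _ Fe.
  have ye : nrm (emb y - emb e) <= 2 * near e k.
    have -> : emb y - emb e =
      - (emb e * (1 - emb k) + (1 - emb k) * emb e * emb k) by rewrite yE; ncring.
    rewrite nrmN.
    have := nrmD (emb e * (1 - emb k)) ((1 - emb k) * emb e * emb k).
    have := nrmM_le (lexx (nrm ((1 - emb k) * emb e))) (ui_nrm uk).
    have -> : nrm ((1 - emb k) * emb e) = near e k.
      by apply: nrm_mulC; apply: ui_sa => //; apply: uiC.
    by lra.
  have /posballP/uiC/ui_nrm T1 := FP _ (FT n).
  have := near_close_l (emb e) (emb y) T1.
  have := near_close_l (emb y) (emb c') T1.
  by lra.
have [f Hf] := choice step.
have [c0 [k0 [Fc0 Fk0 kc0 _ _]]] := filter_interp FP Fg Ff0 ltr01.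
pose ch := fix ch n : A * A := if n is n'.+1 then f (n', ch n') else (c0, k0).
have ch_good n : good (ch n).
  by elim: n => [//|n IH]; have [] := Hf (n, ch n) IH.
have ch_step n : below (ch n.+1).1 (ch n).1 /\ near (ch n.+1).1 (T n) < tol n.
  by have [] := Hf (n, ch n) (ch_good n).
have chF n : F (ch n).1 by have [] := ch_good n.
have ch_mono n m : below (ch (n + m).+1).1 (ch n).1.
  elim: m => [|m IH]; first by rewrite addn0; have [] := ch_step n.
  by rewrite addnS; apply: below_trans IH; have [] := ch_step (n + m).+1.
pose Y : set A := [set b | posball b /\ exists n, below (ch n).1 b].
have YF : Y `<=` F.
  move=> b [pb [n nb]]; apply: Fc => // d d0.
  by exists (ch n).1 => //; rewrite nb nrm0.
have Ych n : Y (ch n).1.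
  by split; [exact: FP|exists n.+1; have [] := ch_step n].
exists Y.
  apply/ll_filterP; first by move=> b [].
  split=> [a c [pc [n nc]] pa ca|b1 b2 [p1 [n1 h1]] [p2 [n2 h2]]].
    by split => //; exists n; apply: below_trans ca.
  exists (ch (n1 + n2).+1).1; split => //.
    by apply: below_trans h1; apply: ch_mono.
  by apply: below_trans h2; rewrite addnC; apply: ch_mono.
apply/seteqP; split; last first.
  rewrite [X in _ `<=` X](closure_id F).1; last exact: dfilter_closed.
  exact: closure_subset.
move=> b Fb; apply/closureP => d d0; have pb := FP _ Fb.
(* c_(n+1) (1 - b) is below 2 d / 5, and the hull doubles this. *)
have d5 : 0 < d / 5 by rewrite divr_gt0.
have [n nt nb] := Tdense _ _ Fb d5; have [_ nT] := ch_step n.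
have [h [ph hE _ bh]] := hull_ex (FP _ (chF n.+1)) pb.
exists h.
  split => //; exists n.+2; have [st _] := ch_step n.+1.
  have -> : 1 - emb h = (1 - emb (ch n.+1).1) *
     ((1 - emb b) * (1 - emb (ch n.+1).1)) by rewrite hE /hull; ncring.
  by rewrite [LHS]mulrA st mul0r.
have := near_close (emb (T n)) (emb b) (posball_nrm (FP _ (chF n.+1))).
by rewrite -embB nrm_emb; lra.
Qed.

End WayBelow.

(** The face condition is compared for nonempty F: the empty set satisfies the other conditions, but
    an infimum over it is [+oo], so it is not d-cofinal. *)
Theorem theorem2p2 (R : realType) (A : cstarAlgType R) (F : set A)
    (FP : F `<=` posball) :
  let c1 := is_filter dfun F in
  let c2 := is_initial dfun F /\ is_filter hfun F in
  let c3 := exists2 Y : set A,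
    is_initial dfun Y /\ is_filter (rel_fun cle) Y & F = closure Y in
  let c4 := [/\ closed F, is_Dclosed (rel_fun cle) F & odot_closed F] in
  let c5 := [/\ closed F, is_Dclosed (rel_fun cle) F, sq_closed F
               & is_convex F] in
  let c6 := [/\ closed F, is_cofinal dfun F & is_face F] in
  let c7 := is_norm_filter F in
  let c8 := exists2 Y : set A, is_filter (rel_fun ll) Y & F = closure Y in
  [/\ [<-> c1; c2; c3; c4; c5; c7],
      F !=set0 -> (c1 <-> c6)
    & separable_space A \/ commutative_calg A -> (c1 <-> c8)].
Proof.
move=> c1 c2 c3 c4 c5 c6 c7 c8.
have e1 : c1 <-> dfilter F by exact: is_filter_dfunP.
have e2 : c2 <-> dfilter F by exact: hfilterP.
have e3 : c3 <-> dfilter F by exact: le_filter_closureP.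
have e4 : c4 <-> dfilter F.
  split=> [[Fcl /upclosedP Fu Fo]|Fg]; first exact: odot_dfilter.
  split; [exact: dfilter_closed|apply/upclosedP; exact: dfilter_upclosed|].
  exact: dfilter_odot.
have e5 : c5 <-> dfilter F.
  split=> [[Fcl /upclosedP Fu Fs Fx]|Fg]; first exact: sq_convex_dfilter.
  split; [exact: dfilter_closed|apply/upclosedP; exact: dfilter_upclosed| |].
    exact: dfilter_sq.
  exact: dfilter_convex.
have e7 : c7 <-> dfilter F.
  by split; [exact: norm_filter_dfilter|exact: dfilter_norm_filter].
split.
- tfae.
  + by move=> /e1 /e2.
  + by move=> /e2 /e3.
  + by move=> /e3 /e4.
  + by move=> /e4 /e5.
  + by move=> /e5 /e7.
  + by move=> /e7 /e1.
- move=> F0; rewrite e1; split=> [Fg|[Fcl Fco Ff]]; last exact: face_dfilter.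
  by split; [exact: dfilter_closed|exact: dfilter_cofinal|exact: dfilter_face].
- move=> sc; rewrite e1; split=> [Fg|[Y Yf FY]].
    by case: sc => ?; [exact: ll_filter_separable|exact: ll_filter_commutative].
  by rewrite FY; apply: ll_filter_closure_dfilter => //; case: Yf.
Qed.
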